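(* Let $a_1,a_2,c_1,c_2>0$ and $\sigma,y\in\mathbb R$, and consider the two-region pollution control problem with state $$dY(z)=(u_1(z)+u_2(z))dz+\sigma B(dz),\qquad Y(0,x)=Y(t,0)=y,\qquad z=(t,x)\in R_Z=[0,T]\times[0,X],\ Z=(T,X),$$ and costs $J_i=\mathbb E\big[\int_{R_Z}a_iu_i^2(\zeta)d\zeta+c_iY^2(Z)\big]$, $i=1,2$. Put $$\alpha=1+\frac{c_2a_1}{c_1a_2},\qquad \beta=a_1+\frac{c_2^2a_1^2}{c_1^2a_2}.$$ Then the optimal emission reductions $(\widehat u_1,\widehat u_2)$ (in the sense described in the context) are given by $$\widehat u_2=\frac{c_2a_1}{c_1a_2}\,\widehat u_1,\qquad \widehat u_1=-\frac{\alpha}{2\beta}\,\widehat p,$$ where $\widehat p$ is the first component of the solution $(\widehat p,\widehat q,\widehat r)$ of the backward equation $$d\widehat p(z)=\widehat q(z)B(dz)+M^{\widehat r}(dz),\qquad \widehat p(Z)=2(c_1+c_2)\widehat Y(Z),$$ with $\widehat Y$ the state corresponding to $(\widehat u_1,\widehat u_2)$.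
   Context: $B=\{B(t,x)\}$ is a Brownian sheet with filtration $\mathcal F_{t,x}=\sigma(B(s,a):0\le s\le t,\ a\in[0,x])$; $z=(t,x)$, $R_z=[0,t]\times[0,x]$. Controls $u_i$ are $\mathcal F_{t,x}$-adapted real-valued processes. The state equation means $Y(z)=y+\int_{R_z}(u_1+u_2)(\zeta)d\zeta+\sigma B(R_z)$, where $B(R_z)=\int_{R_z}B(d\zeta)$. $M^{r}(z)=\iint_{R_z\times R_z}r(\zeta,\zeta')B(d\zeta)B(d\zeta')$ is the Wong–Zakai double stochastic integral, only values with $\zeta\bar\wedge\zeta'$ (first coordinate of $\zeta$ $\le$ that of $\zeta'$, second coordinate of $\zeta$ $\ge$ that of $\zeta'$) contributing, with $r$ measurable, $r(\zeta,\zeta')$ measurable with respect to $\mathcal F_{\zeta\vee\zeta'}$ ($\vee$ = componentwise maximum) and square integrable over $\Omega\times\{\zeta\bar\wedge\zeta'\}$. The process $\widehat q$ is adapted and square integrable, and the backward equation means that $\widehat p(z)=\widehat p(Z)-\int_{R_Z\setminus R_z}\widehat q(\zeta)B(d\zeta)-(M^{\widehat r}(Z)-M^{\widehat r}(z))$. Meaning of ''optimal''. In the game, a pair $(\widehat u_1,\widehat u_2)$ is a Nash equilibrium if neither region can lower its own cost $J_i$ by changing only its own control. The paper takes the coordination proportion $u_2=\frac{c_2a_1}{c_1a_2}u_1$ obtained from the first-order Nash conditions of the two regions and substitutes it in the state equation, which becomes $dY(z)=\alpha u_1(z)dz+\sigma B(dz)$. The game is thereby reduced to the single-agent problem of minimizing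 over $u_1$ the sum of the two costs, $$J(u_1)=\mathbb E\Big[\int_{R_Z}\beta u_1^2(\zeta)d\zeta+(c_1+c_2)Y^2(Z)\Big].$$ The optimal emission reductions are the pair $(\widehat u_1,\widehat u_2)$ in which the two regions coordinate their controls according to this proportion and $\widehat u_1$ is the optimal control of this single-agent problem. *)

(* Defs.v *)
(* Points of the plane are pairs z = (t, x) : R * R; a two-parameter process is
   a function of type R * R -> Omega -> R. *)
From HB Require Import structures.
From mathcomp Require Import all_boot all_order all_algebra.
From mathcomp Require Import all_classical all_reals all_analysis.
From mathcomp Require Import measurable_realfun measure_function.
From mathcomp Require Import ring.

Set Implicit Arguments.
Unset Strict Implicit.
Unset Printing Implicit Defensive.

Import Order.TTheory GRing.Theory Num.Theory.
Import numFieldNormedType.Exports.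

Local Open Scope classical_set_scope.
Local Open Scope ring_scope.

Definition ple (R : realType) (z w : R * R) : bool :=
  (z.1 <= w.1) && (z.2 <= w.2).

Definition pmin (R : realType) (z w : R * R) : R * R :=
  (Num.min z.1 w.1, Num.min z.2 w.2).

Definition pmax (R : realType) (z w : R * R) : R * R :=
  (Num.max z.1 w.1, Num.max z.2 w.2).

(* R_z = [0, t] x [0, x] *)
Definition rect (R : realType) (z : R * R) : set (R * R) :=
  [set w | ple (0, 0) w && ple w z].

(* (lo, hi], open below and to the left *)
Definition box (R : realType) (lo hi : R * R) : set (R * R) :=
  [set w | (lo.1 < w.1 <= hi.1) && (lo.2 < w.2 <= hi.2)].

(* Lebesgue measure typed on the canonical measurable structure of R, so that
   its products live on the canonical structures of R * R etc. *)
Definition leb1 (R : realType) : set R -> \bar R := @lebesgue_measure R.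

Fact leb1_0 (R : realType) : @leb1 R set0 = 0%E.
Proof. exact: measure0. Qed.
Fact leb1_ge0 (R : realType) A : (0 <= @leb1 R A)%E.
Proof. exact: measure_ge0. Qed.
Fact leb1_sigma_additive (R : realType) : semi_sigma_additive (@leb1 R).
Proof. exact: (@measure_semi_sigma_additive _ _ _ (@lebesgue_measure R)). Qed.
HB.instance Definition _ (R : realType) := isMeasure.Build _ _ _ (@leb1 R)
  (leb1_0 R) (@leb1_ge0 R) (@leb1_sigma_additive R).
Fact leb1_sigma_finite (R : realType) : sigma_finite setT (@leb1 R).
Proof. exact: (@sigma_finiteT _ _ _ (@lebesgue_measure R)). Qed.
HB.instance Definition _ (R : realType) :=
  Measure_isSigmaFinite.Build _ _ _ (@leb1 R) (@leb1_sigma_finite R).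

(* The library does not infer sigma-finiteness of a product measure; [sfprod] is
   the product measure together with this instance. *)
Definition sfprod (d1 d2 : measure_display) (T1 : measurableType d1)
    (T2 : measurableType d2) (R : realType)
    (m1 : {sigma_finite_measure set T1 -> \bar R})
    (m2 : {sigma_finite_measure set T2 -> \bar R}) :
  set (T1 * T2) -> \bar R := (m1 \x m2)%E.

HB.instance Definition _ (d1 d2 : measure_display) (T1 : measurableType d1)
    (T2 : measurableType d2) (R : realType)
    (m1 : {sigma_finite_measure set T1 -> \bar R})
    (m2 : {sigma_finite_measure set T2 -> \bar R}) :=
  Measure.copy (sfprod m1 m2) (m1 \x m2)%E.

Fact sfprod_sigma_finite (d1 d2 : measure_display) (T1 : measurableType d1)
    (T2 : measurableType d2) (R : realType)
    (m1 : {sigma_finite_measure set T1 -> \bar R})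
    (m2 : {sigma_finite_measure set T2 -> \bar R}) :
  sigma_finite setT (sfprod m1 m2).
Proof.
have /sigma_finiteP[F [TF ndF Foo]] := sigma_finiteT m1.
have /sigma_finiteP[G [TG ndG Goo]] := sigma_finiteT m2.
exists (fun n => F n `*` G n).
  rewrite -setXTT TF TG predeqE => -[x y]; split.
    move=> [/= [n _ Fnx] [k _ Gky]]; exists (maxn n k) => //; split.
    - by move: x Fnx; exact/subsetPset/ndF/leq_maxl.
    - by move: y Gky; exact/subsetPset/ndG/leq_maxr.
  by move=> [n _ []/= ? ?]; split; exists n.
move=> k; have [? ?] := Foo k; have [? ?] := Goo k.
split; first exact: measurableX.
by rewrite /sfprod product_measure1E// lte_mul_pinfty// ge0_fin_numE.
Qed.

HB.instance Definition _ (d1 d2 : measure_display) (T1 : measurableType d1)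
    (T2 : measurableType d2) (R : realType)
    (m1 : {sigma_finite_measure set T1 -> \bar R})
    (m2 : {sigma_finite_measure set T2 -> \bar R}) :=
  Measure_isSigmaFinite.Build _ _ _ (sfprod m1 m2) (sfprod_sigma_finite m1 m2).

Notation leb2 R := (sfprod (@leb1 R) (@leb1 R)).

Definition l2_cvg (d : measure_display) (T : measurableType d) (R : realType)
    (mu : set T -> \bar R) (D : set T) (f : nat -> T -> R) (g : T -> R) : Prop :=
  (fun n => \int[mu]_(x in D) ((f n x - g x) ^+ 2)%:E)%E @ \oo --> 0%E.

Definition square_integrable (d : measure_display) (T : measurableType d)
    (R : realType) (mu : set T -> \bar R) (D : set T) (f : T -> R) : Prop :=
  measurable_fun D f /\ (\int[mu]_(x in D) ((f x) ^+ 2)%:E < +oo)%E.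

(* B(lo, hi], the mass of the rectangle (lo, hi] *)
Definition sheet_incr (R : realType) (Omega : Type)
    (B : R * R -> Omega -> R) (lo hi : R * R) (om : Omega) : R :=
  B hi om - B (lo.1, hi.2) om - B (hi.1, lo.2) om + B lo om.

(* Brownian sheet on the quadrant, in its continuous version: null on the axes,
   with independent centred Gaussian increments over disjoint rectangles, the
   variance being the area.  [normal_prob m s] takes the standard deviation. *)
Definition brownian_sheet (d : measure_display) (Omega : measurableType d)
    (R : realType) (P : probability Omega R) (B : R * R -> Omega -> R) : Prop :=
  [/\ forall z, ple (0, 0) z -> measurable_fun setT (B z),
      forall z om, ple (0, 0) z -> (z.1 == 0) || (z.2 == 0) -> B z om = 0,
      forall om, {within [set z : R * R | ple (0, 0) z],
                    continuous (fun z => B z om)},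
      forall lo hi : R * R, ple (0, 0) lo -> lo.1 < hi.1 -> lo.2 < hi.2 ->
        forall U : set R, measurable U ->
          P (sheet_incr B lo hi @^-1` U) =
          normal_prob 0 (Num.sqrt ((hi.1 - lo.1) * (hi.2 - lo.2))) U
    & forall (n : nat) (lo hi : 'I_n -> R * R),
        (forall i, ple (0, 0) (lo i) && ple (lo i) (hi i)) ->
        trivIset setT (fun i => box (lo i) (hi i)) ->
        forall U : 'I_n -> set R, (forall i, measurable (U i)) ->
          P (\bigcap_(i in setT) (sheet_incr B (lo i) (hi i) @^-1` U i)) =
          (\prod_(i < n) fine (P (sheet_incr B (lo i) (hi i) @^-1` U i)))%:E].

(* F_z, not augmented by the null sets *)
Definition sheet_filtration (R : realType) (Omega : Type)
    (B : R * R -> Omega -> R) (z : R * R) : set (set Omega) :=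
  <<s [set A | exists w (U : set R),
                 [/\ rect z w, measurable U & A = B w @^-1` U]] >>.

Definition measurable_wrt (R : realType) (Omega : Type)
    (G : set (set Omega)) (X : Omega -> R) : Prop :=
  forall U : set R, measurable U -> G (X @^-1` U).

(* jointly measurable on R_Z x Omega and adapted *)
Definition adapted (d : measure_display) (Omega : measurableType d)
    (R : realType) (B : R * R -> Omega -> R) (Z : R * R)
    (f : R * R -> Omega -> R) : Prop :=
  measurable_fun (rect Z `*` setT) (fun w : (R * R) * Omega => f w.1 w.2) /\
  forall z, rect Z z -> measurable_wrt (sheet_filtration B z) (f z).

(* the integrand om, zeta |-> sp_coef om * 1_(sp_lo, sp_hi](zeta) *)
Record sheet_piece (R : realType) (Omega : Type) := SheetPiece {
  sp_lo : R * R;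
  sp_hi : R * R;
  sp_coef : Omega -> R }.

Definition sheet_piece_ok (R : realType) (Omega : Type)
    (B : R * R -> Omega -> R) (Z : R * R) (e : sheet_piece R Omega) : Prop :=
  [/\ [&& ple (0, 0) (sp_lo e), ple (sp_lo e) (sp_hi e) & ple (sp_hi e) Z],
      measurable_wrt (sheet_filtration B (sp_lo e)) (sp_coef e)
    & exists C : R, forall om, `|sp_coef e om| <= C].

Definition sheet_simple_eval (R : realType) (Omega : Type)
    (s : seq (sheet_piece R Omega)) (z : R * R) (om : Omega) : R :=
  \sum_(e <- s) sp_coef e om * \1_(box (sp_lo e) (sp_hi e)) z.

(* the intersection of (lo, hi] with R_z is (pmin lo z, pmin hi z] *)
Definition sheet_simple_int (R : realType) (Omega : Type)
    (B : R * R -> Omega -> R) (s : seq (sheet_piece R Omega))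
    (z : R * R) (om : Omega) : R :=
  \sum_(e <- s)
    sp_coef e om * sheet_incr B (pmin (sp_lo e) z) (pmin (sp_hi e) z) om.

(* I(z) is (a version of) the integral of q over R_z against B, for every z in
   R_Z: the L2 limit of the integrals of simple adapted fields converging to q
   in L2(R_Z x Omega). *)
Definition is_sheet_integral (d : measure_display) (Omega : measurableType d)
    (R : realType) (P : probability Omega R) (B : R * R -> Omega -> R)
    (Z : R * R) (q I : R * R -> Omega -> R) : Prop :=
  exists s : nat -> seq (sheet_piece R Omega),
    [/\ forall n, forall i : 'I_(size (s n)),
          sheet_piece_ok B Z (tnth (in_tuple (s n)) i),
        l2_cvg (sfprod (leb2 R) P) (rect Z `*` setT)
          (fun n w => sheet_simple_eval (s n) w.1 w.2) (fun w => q w.1 w.2)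
      & forall z, rect Z z -> measurable_fun setT (I z) /\
          l2_cvg P setT (fun n => sheet_simple_int B (s n) z) (I z)].

Definition wz_rel (R : realType) (z w : R * R) : bool :=
  (z.1 <= w.1) && (w.2 <= z.2).

Definition wz_dom (R : realType) (Z : R * R) : set ((R * R) * (R * R)) :=
  [set zz | [/\ rect Z zz.1, rect Z zz.2 & wz_rel zz.1 zz.2]].

(* the integrand
   om, zeta, zeta' |-> wp_coef om * 1_(wp_lo, wp_hi](zeta)
                                  * 1_(wp_lo', wp_hi'](zeta') *)
Record wz_piece (R : realType) (Omega : Type) := WZPiece {
  wp_lo : R * R;
  wp_hi : R * R;
  wp_lo' : R * R;
  wp_hi' : R * R;
  wp_coef : Omega -> R }.

(* the third clause says that zeta and zeta' are related by [wz_rel] whenever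
   they lie in the first and the second rectangle, respectively *)
Definition wz_piece_ok (R : realType) (Omega : Type)
    (B : R * R -> Omega -> R) (Z : R * R) (e : wz_piece R Omega) : Prop :=
  [/\ [&& ple (0, 0) (wp_lo e), ple (wp_lo e) (wp_hi e) & ple (wp_hi e) Z],
      [&& ple (0, 0) (wp_lo' e), ple (wp_lo' e) (wp_hi' e) & ple (wp_hi' e) Z],
      ((wp_hi e).1 <= (wp_lo' e).1) && ((wp_hi' e).2 <= (wp_lo e).2),
      measurable_wrt (sheet_filtration B (pmax (wp_lo e) (wp_lo' e))) (wp_coef e)
    & exists C : R, forall om, `|wp_coef e om| <= C].

Definition wz_simple_eval (R : realType) (Omega : Type)
    (s : seq (wz_piece R Omega)) (z z' : R * R) (om : Omega) : R :=
  \sum_(e <- s) wp_coef e om * \1_(box (wp_lo e) (wp_hi e)) z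
                             * \1_(box (wp_lo' e) (wp_hi' e)) z'.

Definition wz_simple_int (R : realType) (Omega : Type)
    (B : R * R -> Omega -> R) (s : seq (wz_piece R Omega))
    (z : R * R) (om : Omega) : R :=
  \sum_(e <- s)
    wp_coef e om * sheet_incr B (pmin (wp_lo e) z) (pmin (wp_hi e) z) om
                 * sheet_incr B (pmin (wp_lo' e) z) (pmin (wp_hi' e) z) om.

Definition wz_integrand (d : measure_display) (Omega : measurableType d)
    (R : realType) (P : probability Omega R) (B : R * R -> Omega -> R)
    (Z : R * R) (r : R * R -> R * R -> Omega -> R) : Prop :=
  square_integrable (sfprod (sfprod (leb2 R) (leb2 R)) P) (wz_dom Z `*` setT)
    (fun w => r w.1.1 w.1.2 w.2) /\
  forall z z', wz_dom Z (z, z') ->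
    measurable_wrt (sheet_filtration B (pmax z z')) (r z z').

(* M(z) is (a version of) M^r(z) for every z in R_Z *)
Definition is_wz_integral (d : measure_display) (Omega : measurableType d)
    (R : realType) (P : probability Omega R) (B : R * R -> Omega -> R)
    (Z : R * R) (r : R * R -> R * R -> Omega -> R) (M : R * R -> Omega -> R) :
    Prop :=
  exists s : nat -> seq (wz_piece R Omega),
    [/\ forall n, forall i : 'I_(size (s n)),
          wz_piece_ok B Z (tnth (in_tuple (s n)) i),
        l2_cvg (sfprod (sfprod (leb2 R) (leb2 R)) P) (wz_dom Z `*` setT)
          (fun n w => wz_simple_eval (s n) w.1.1 w.1.2 w.2)
          (fun w => r w.1.1 w.1.2 w.2)
      & forall z, rect Z z -> measurable_fun setT (M z) /\
          l2_cvg P setT (fun n => wz_simple_int B (s n) z) (M z)].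

(* dp = q dB + M^r(dz), p(Z) = xi.  The integral of q over R_Z \ R_z is
   I Z - I z, where I z is the integral over R_z. *)
Definition bspde_solution (d : measure_display) (Omega : measurableType d)
    (R : realType) (P : probability Omega R) (B : R * R -> Omega -> R)
    (Z : R * R) (xi : Omega -> R) (p q : R * R -> Omega -> R)
    (r : R * R -> R * R -> Omega -> R) : Prop :=
  [/\ adapted B Z p,
      adapted B Z q /\
        square_integrable (sfprod (leb2 R) P) (rect Z `*` setT)
          (fun w => q w.1 w.2),
      wz_integrand P B Z r,
      {ae P, forall om, p Z om = xi om}
    & exists I M : R * R -> Omega -> R,
        [/\ is_sheet_integral P B Z q I,
            is_wz_integral P B Z r M
          & forall z, rect Z z ->
              {ae P, forall om, p z om =
                 p Z om - (I Z om - I z om) - (M Z om - M z om)}]].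

(* the game has drift v = u1 + u2, the reduced single-agent problem has
   drift v = alpha * u1 *)
Definition state (R : realType) (Omega : Type) (B : R * R -> Omega -> R)
    (y sigma : R) (v : R * R -> Omega -> R) (z : R * R) (om : Omega) : R :=
  y + \int[leb2 R]_(w in rect z) v w om + sigma * sheet_incr B (0, 0) z om.

(* a u^2 integrated over R_Z plus c Y(Z)^2, in expectation.  The value is +oo
   as soon as u is not square integrable over R_Z x Omega, in particular if the
   drift integral in the state fails to exist with positive probability. *)
Definition quadratic_cost (d : measure_display) (Omega : measurableType d)
    (R : realType) (P : probability Omega R) (Z : R * R) (a c : R)
    (u Y : R * R -> Omega -> R) : \bar R :=
  (\int[P]_om (\int[leb2 R]_(w in rect Z) (a * u w om ^+ 2)%:E
               + (c * Y Z om ^+ 2)%:E))%E.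

(* J_i(u1, u2) of the region with weights a, c and own control u *)
Definition region_cost (d : measure_display) (Omega : measurableType d)
    (R : realType) (P : probability Omega R) (B : R * R -> Omega -> R)
    (Z : R * R) (y sigma a c : R) (u u1 u2 : R * R -> Omega -> R) : \bar R :=
  quadratic_cost P Z a c u
    (state B y sigma (fun z om => u1 z om + u2 z om)).

Definition ratio (R : realType) (a1 a2 c1 c2 : R) : R :=
  (c2 * a1) / (c1 * a2).

Definition alpha (R : realType) (a1 a2 c1 c2 : R) : R :=
  1 + (c2 * a1) / (c1 * a2).

Definition beta (R : realType) (a1 a2 c1 c2 : R) : R :=
  a1 + (c2 ^+ 2 * a1 ^+ 2) / (c1 ^+ 2 * a2).

Definition single_agent_cost (d : measure_display) (Omega : measurableType d)
    (R : realType) (P : probability Omega R) (B : R * R -> Omega -> R)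
    (Z : R * R) (y sigma a1 a2 c1 c2 : R) (u : R * R -> Omega -> R) : \bar R :=
  quadratic_cost P Z (beta a1 a2 c1 c2) (c1 + c2) u
    (state B y sigma (fun z om => alpha a1 a2 c1 c2 * u z om)).

(* equality a.e. on R_Z x Omega *)
Definition field_eq (d : measure_display) (Omega : measurableType d)
    (R : realType) (P : probability Omega R) (Z : R * R)
    (f g : R * R -> Omega -> R) : Prop :=
  {ae (sfprod (leb2 R) P), forall w, rect Z w.1 -> f w.1 w.2 = g w.1 w.2}.

(* The coordination u2 = ratio * u1 is part of the notion of optimality, and u1
   minimizes the sum of the two regional costs over coordinated pairs (see
   [single_agent_costE]). *)
Definition optimal_reductions (d : measure_display) (Omega : measurableType d)
    (R : realType) (P : probability Omega R) (B : R * R -> Omega -> R)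
    (Z : R * R) (y sigma a1 a2 c1 c2 : R) (u1 u2 : R * R -> Omega -> R) : Prop :=
  [/\ adapted B Z u1, adapted B Z u2,
      field_eq P Z u2 (fun z om => ratio a1 a2 c1 c2 * u1 z om)
    & forall v, adapted B Z v ->
        (single_agent_cost P B Z y sigma a1 a2 c1 c2 u1
         <= single_agent_cost P B Z y sigma a1 a2 c1 c2 v)%E].

Lemma measurable_rect (R : realType) (Z : R * R) : measurable (rect Z).
Proof.
have -> : rect Z = `[0, Z.1]%classic `*` `[0, Z.2]%classic.
  apply/seteqP; split=> [[a b]|[a b]]; rewrite /rect /ple /= !in_itv /=.
    by case/andP => /andP[-> ->] /andP[-> ->].
  by case=> /andP[-> ->] /andP[-> ->].
exact: measurableX.
Qed.

Lemma measurable_rect_int (d : measure_display) (Omega : measurableType d)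
    (R : realType) (Z : R * R) (f : R * R -> Omega -> R) :
  measurable_fun (rect Z `*` setT) (fun w : (R * R) * Omega => f w.1 w.2) ->
  (forall w om, 0 <= f w om) ->
  measurable_fun setT (fun om => \int[leb2 R]_(w in rect Z) (f w om)%:E : \bar R)%E.
Proof.
move=> mf f0.
have mD : measurable (rect Z `*` @setT Omega).
  by apply: measurableX => //; exact: measurable_rect.
have mE : measurable_fun (rect Z `*` setT)
    (fun w : (R * R) * Omega => (f w.1 w.2)%:E) by exact/measurable_EFinP.
have mg := (measurable_restrictT _ mD).1 mE.
have g0 w : (0 <= ((fun w : (R * R) * Omega => (f w.1 w.2)%:E)
                     \_ (rect Z `*` setT)) w)%E.
  by rewrite patchE; case: ifP => // _; rewrite lee_fin.
have := @measurable_fun_fubini_tonelli_G _ _ _ _ _ (leb2 R) _ mg g0.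
apply: eq_measurable_fun => om _.
rewrite /fubini_G [RHS]integral_mkcond; apply: eq_integral => w _.
rewrite !patchE; congr (if _ then _ else _).
apply/idP/idP; rewrite !inE => //.
by case.
Qed.

Lemma measurable_state (d : measure_display) (Omega : measurableType d)
    (R : realType) (P : probability Omega R) (B : R * R -> Omega -> R)
    (Z : R * R) (y sigma : R) (v : R * R -> Omega -> R) :
  brownian_sheet P B -> ple (0, 0) Z ->
  measurable_fun (rect Z `*` setT) (fun w : (R * R) * Omega => v w.1 w.2) ->
  measurable_fun setT (state B y sigma v Z).
Proof.
case=> mB _ _ _ _ Z0 mv; case/andP: (Z0) => /= Z1 Z2.
apply: measurable_funD; last first.
  apply: measurable_funM => //.
  apply: measurable_funD; last by apply: mB; rewrite /ple/= lexx.
  by apply: measurable_funB; first apply: measurable_funB;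
    apply: mB; rewrite /ple/= ?lexx ?Z1 ?Z2.
apply: measurable_funD => //.
rewrite /Rintegral; apply: measurableT_comp => //.
have mv0 : measurable_fun (rect Z `*` setT)
    (fun w : (R * R) * Omega => Num.max (v w.1 w.2) 0).
  exact: measurable_maxr.
have mvN : measurable_fun (rect Z `*` setT)
    (fun w : (R * R) * Omega => Num.max (- v w.1 w.2) 0).
  by apply: measurable_maxr => //; exact: measurableT_comp.
have pos0 (a : R) : 0 <= Num.max a 0 by rewrite le_max lexx orbT.
have mp := measurable_rect_int mv0 (fun w om => pos0 (v w om)).
have mn := measurable_rect_int mvN (fun w om => pos0 (- v w om)).
apply: eq_measurable_fun (emeasurable_funB mp mn) => om _.
rewrite integralE; congr (_ - _)%E; apply: eq_integral => w _;
  by rewrite (funeposE, funenegE) ?EFinN EFin_max.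
Qed.

Lemma single_agent_costE (d : measure_display) (Omega : measurableType d)
    (R : realType) (P : probability Omega R) (B : R * R -> Omega -> R)
    (Z : R * R) (y sigma a1 a2 c1 c2 : R) (u : R * R -> Omega -> R) :
  brownian_sheet P B -> ple (0, 0) Z ->
  0 < a1 -> 0 < a2 -> 0 < c1 -> 0 < c2 -> adapted B Z u ->
  let u2 := fun z om => ratio a1 a2 c1 c2 * u z om in
  single_agent_cost P B Z y sigma a1 a2 c1 c2 u =
  (region_cost P B Z y sigma a1 c1 u u u2 +
   region_cost P B Z y sigma a2 c2 u2 u u2)%E.
Proof.
move=> hB Z0 a1_gt0 a2_gt0 c1_gt0 c2_gt0 [mu _] /=.
rewrite /single_agent_cost /region_cost.
have -> : (fun z om => alpha a1 a2 c1 c2 * u z om) =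
    (fun z om => u z om + ratio a1 a2 c1 c2 * u z om).
  by apply/funext => z; apply/funext => om; rewrite /alpha /ratio mulrDl mul1r.
set Y := state _ _ _ _.
have mY : measurable_fun setT (Y Z).
  apply: (measurable_state _ _ hB Z0) => //.
  by apply: measurable_funD => //; exact: measurable_funM.
have mq a k : measurable_fun (rect Z `*` setT)
    (fun w : (R * R) * Omega => a * (k * u w.1 w.2) ^+ 2).
  apply: measurable_funM; first exact: measurable_cst.
  by apply: measurable_funX; apply: measurable_funM; first exact: measurable_cst.
have mI a k : 0 < a -> measurable_fun setT
    (fun om => \int[leb2 R]_(w in rect Z) (a * (k * u w om) ^+ 2)%:E : \bar R)%E.
  move=> a0; apply: measurable_rect_int => [|w om]; first exact: mq.
  by rewrite mulr_ge0 ?sqr_ge0 // ltW.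
have mC c : measurable_fun setT (fun om => (c * Y Z om ^+ 2)%:E).
  by apply/measurable_EFinP; apply: measurable_funM => //; exact: measurable_funX.
have I0 a k om : 0 < a ->
    (0 <= \int[leb2 R]_(w in rect Z) (a * (k * u w om) ^+ 2)%:E)%E.
  by move=> a0; apply: integral_ge0 => w _; rewrite lee_fin mulr_ge0 ?sqr_ge0 // ltW.
have C0 c om : 0 < c -> (0 <= (c * Y Z om ^+ 2)%:E)%E.
  by move=> c0; rewrite lee_fin mulr_ge0 ?sqr_ge0 // ltW.
have J1 : quadratic_cost P Z a1 c1 u Y =
    quadratic_cost P Z a1 c1 (fun z om => 1 * u z om) Y.
  by congr (quadratic_cost _ _ _ _ _ _); apply/funext => z; apply/funext => om;
     rewrite mul1r.
rewrite J1 /quadratic_cost -ge0_integralD //; last 4 first.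
- by move=> om _; apply: adde_ge0; [exact: I0|exact: C0].
- by apply: emeasurable_funD => //; exact: mI.
- by move=> om _; apply: adde_ge0; [exact: I0|exact: C0].
- by apply: emeasurable_funD => //; exact: mI.
apply: eq_integral => om _; rewrite addeACA -EFinD -mulrDl; congr (_ + _)%E.
have mu_om a k : measurable_fun (rect Z) (fun w => (a * (k * u w om) ^+ 2)%:E).
  have mD : measurable (rect Z `*` @setT Omega).
    by apply: measurableX => //; exact: measurable_rect.
  apply/measurable_EFinP.
  have mp : measurable_fun (rect Z) (fun w : R * R => (w, om)).
    by apply: measurable_funTS; exact: pair2_measurable.
  have sD : (fun w : R * R => (w, om)) @` rect Z `<=` rect Z `*` setT.
    by move=> _ [w Dw <-].
  exact: (measurable_comp mD sD (mq a k) mp).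
have q_ge0 a k w : 0 < a -> rect Z w -> (0 <= (a * (k * u w om) ^+ 2)%:E)%E.
  by move=> a0 _; rewrite lee_fin mulr_ge0 ?sqr_ge0 // ltW.
rewrite -ge0_integralD //; try exact: measurable_rect; try exact: mu_om;
  try by move=> w; exact: q_ge0.
apply: eq_integral => w _; rewrite -EFinD /beta /ratio; congr (_%:E).
by field; rewrite !gt_eqF.
Qed.

(* Main.v *)
Require Import Defs.
From HB Require Import structures.
From mathcomp Require Import all_boot all_order all_algebra.
From mathcomp Require Import all_classical all_reals all_analysis.
From mathcomp Require Import measurable_realfun measure_function.
From mathcomp Require Import ring lra.

Set Implicit Arguments.
Unset Strict Implicit.
Unset Printing Implicit Defensive.

Import Order.TTheory GRing.Theory Num.Theory.
Import numFieldNormedType.Exports.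
Local Open Scope classical_set_scope.
Local Open Scope ring_scope.

(** The reduced problem is linear-quadratic: minimize
      E [ \int b u^2 + c Y(Z)^2 ]    with    Y(Z) = y + k \int u + sigma B(Z),
    where b = beta, k = alpha and c = c1 + c2, over adapted fields u.

    Sufficiency. Let (p, q, r) solve the backward equation with terminal value
    2 c Y(Z), and let u = - k / (2 b) p. The stochastic integral against the
    sheet and the double integral M^r have increments orthogonal to everything
    known at z, so p is a martingale: E [phi p(Z)] = E [phi p(z)] for phi known
    at z ([adjoint_martingale]). Orthogonality comes from the independence of
    the increment of the sheet over a box from all that happens outside the box
    ([independent_off_sigma], [outside_orthogonal]). For a competitor v the
    derivative of the cost in the direction v - u is the expected integral of
    (2 b u + k p(Z)) (v - u); as v(z) - u(z) is known at z, p(Z) may be replaced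
    by p(z), and the derivative vanishes. Convexity gives
      cost u + b |v - u|^2 <= cost v
    ([verification]). Square integrability of p is not part of the notion of
    solution: it follows because p(0, 0) is deterministic ([adjoint_L2]), and
    competitors that are not square integrable have infinite cost.

    Existence. An optimum is written down explicitly. With K = k^2 c / b, let
      h(t, x) = 2 c sigma / (1 + K (T - t) (X - x)),
      W(z) = \int_{R_z} h dB,   m = 2 c y / (1 + K T X),   p = m + W.
    This p solves the backward equation with q = h and r = 0, and its terminal
    value is 2 c Y(Z) for the control u = - k / (2 b) p because
      2 c sigma B(Z) = W(Z) + K \int W(z) dz
    ([gain_identity]). This is a stochastic Fubini identity; it holds exactly
    for the Riemann sums that define W ([gain_approx_identity]) and passes to
    the limit in L2. Since the filtration is not augmented by null sets, W must
    be constructed as a pointwise upper limit of these sums along a rapidly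
    convergent sequence, in order to be adapted and jointly measurable
    ([fast_limit_cvg], [wiener_adapted], [wiener_sheet_integral]).

    Necessity. By the excess b |v - u|^2 any optimal control agrees almost
    everywhere with the explicit one, so it produces almost surely the same
    terminal state, and the explicit p is an adjoint process for it. Two adjoint
    processes with the same terminal value agree, being martingales
    ([adjoint_unique]); hence every adjoint process of an optimal pair satisfies
    the stated relation. *)

(** * Moments of the centred Gaussian law *)

Section gauss_moments.
Context {R : realType}.
Notation mu := (@lebesgue_measure R).
Import gauss_integral_proof.

Lemma cvg_integral0_gauss :
  @integral0_gauss R x @[x --> +oo] --> Num.sqrt pi / 2.
Proof.
have : Num.sqrt (@integral0_gauss R x ^+ 2) @[x --> +oo]
    --> Num.sqrt (pi / 4).
  apply: continuous_cvg => //;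
    [exact: sqrt_continuous|exact: cvg_integral0_gauss_sqr].
rewrite sqrtrM ?pi_ge0// sqrtrV// (_ : 4 = 2 ^+ 2); last first.
  by rewrite expr2 -natrM.
rewrite sqrtr_sqr ger0_norm//.
rewrite (_ : (fun _ => Num.sqrt _) = integral0_gauss)//.
apply/funext => r; rewrite sqrtr_sqr// ger0_norm//.
exact: integral0_gauss_ge0.
Qed.

Lemma integrable_gauss_segment (a b : R) :
  mu.-integrable `[a, b] (EFin \o gauss_fun).
Proof.
apply: continuous_compact_integrable => //; first exact: segment_compact.
by apply: continuous_subspaceT; exact: continuous_gauss_fun.
Qed.

Lemma derive_integral0_gauss (x : R) : 0 < x ->
  derivable (@integral0_gauss R) x 1 /\
  (@integral0_gauss R)^`()%classic x = gauss_fun x.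
Proof.
move=> x0; apply: (@continuous_FTC1_closed _ gauss_fun 0 x (x + 1)).
- by rewrite ltrDl.
- exact: integrable_gauss_segment.
- by [].
- exact: continuous_gauss_fun.
Qed.

Lemma is_derive_gauss_fun (x : R) :
  is_derive x 1 (@gauss_fun R) (- (2 * x) * gauss_fun x).
Proof.
have H : is_derive x 1 (fun x : R => - x ^+ 2) (- (2 * x)).
  apply: is_derive_eq.
  by rewrite /GRing.scale /=; ring.
have := @is_derive1_comp R expR (fun x : R => - x ^+ 2) x
  (expR (- x ^+ 2)) (- (2 * x)) (is_derive_expR _) H.
by rewrite /comp mulrC.
Qed.

Lemma cvg_mul_gauss_fun : (x * gauss_fun x : R) @[x --> +oo] --> 0.
Proof.
apply: (@squeeze_cvgr _ _ _ _ (cst 0) (fun x => x^-1)).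
- near=> x.
  have x0 : 0 < x by near: x; exact: nbhs_pinfty_gt.
  rewrite /= mulr_ge0 ?(ltW x0) ?gauss_fun_ge0//=.
  rewrite /gauss_fun expRN ler_pdivrMr ?expR_gt0// mulrC ler_pdivlMr//.
  rewrite -expr2.
  by apply: le_trans (expR_ge1Dx (x ^+ 2)); rewrite lerDr.
- exact: cvg_cst.
- apply/gtr0_cvgV0; last exact: cvg_id.
  exact: nbhs_pinfty_gt.
Unshelve. all: end_near. Qed.

(** The antiderivative of [x ^+ 2 * gauss_fun x] vanishing at 0 is
    [(integral0_gauss x - x * gauss_fun x) / 2]. *)
Lemma integral0y_sqr_gauss :
  (\int[mu]_(x in `[0%R, +oo[) (x ^+ 2 * gauss_fun x)%:E =
   (Num.sqrt pi / 4)%:E)%E.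
Proof.
pose F (x : R) := 2^-1 * (integral0_gauss x - x * gauss_fun x).
have dF (x : R) : 0 < x -> is_derive x 1 F (x ^+ 2 * gauss_fun x).
  move=> x0; have [d1 d1E] := derive_integral0_gauss x0.
  have H1 : is_derive x 1 (@integral0_gauss R) (gauss_fun x).
    by apply: DeriveDef => //; rewrite -derive1E.
  have H2 := is_derive_gauss_fun x.
  apply: is_derive_eq; rewrite /GRing.scale /=.
  by move: (gauss_fun x) => e; field.
have F0 : F 0 = 0.
  by rewrite /F mul0r subr0 /integral0_gauss set_itv1 Rintegral_set1 mulr0.
rewrite (@ge0_continuous_FTC2y _ _ F 0 (Num.sqrt pi / 4)).
- by rewrite F0 sube0.
- by move=> x _; rewrite mulr_ge0 ?sqr_ge0 ?gauss_fun_ge0.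
- apply: continuous_subspaceT => x; apply: cvgM; first exact: exprn_continuous.
  exact: continuous_gauss_fun.
- have -> : Num.sqrt pi / 4 = 2^-1 * (Num.sqrt pi / 2 - 0) :> R by field.
  apply: cvgM; first exact: cvg_cst.
  by apply: cvgB; [exact: cvg_integral0_gauss|exact: cvg_mul_gauss_fun].
- by move=> x x0; have [] := dF _ x0.
- have -> : F 0 = 2^-1 * (0 - 0) by rewrite F0 subrr mulr0.
  apply: cvgM; first exact: cvg_cst.
  apply: cvgB.
    have := @parameterized_integral_cvg_left R 0 1 gauss_fun ltr01 (integrable_gauss_segment 0 1).
    exact: cvg_at_right_filter.
  rewrite -[X in _ --> X](mul0r (gauss_fun 0)).
  apply: cvg_at_right_filter; apply: cvgM; first exact: cvg_id.
  exact: continuous_gauss_fun.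
- move=> x; rewrite in_itv/= andbT => x0; rewrite derive1E.
  by have [_] := dF _ x0.
Qed.

Lemma integralT_sqr_gauss :
  (\int[mu]_x (x ^+ 2 * gauss_fun x)%:E = (Num.sqrt pi / 2)%:E)%E.
Proof.
rewrite ge0_symfun_integralT//=.
- rewrite (_ : [set x | _] = `[0, +oo[%classic); last first.
    by apply/seteqP; split => x/=; rewrite in_itv/= andbT.
  by rewrite integral0y_sqr_gauss -EFinM; congr EFin; field.
- by move=> x; rewrite mulr_ge0 ?sqr_ge0 ?gauss_fun_ge0.
- move=> x; apply: cvgM; first exact: exprn_continuous.
  exact: continuous_gauss_fun.
- by move=> x/=; rewrite /gauss_fun sqrrN.
Qed.

Lemma integral_sqr_normal_pdf (s : R) : 0 < s ->
  (\int[mu]_x (x ^+ 2 * normal_pdf 0 s x)%:E = (s ^+ 2)%:E)%E.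
Proof.
move=> s0.
pose r := Num.sqrt (s ^+ 2 *+ 2).
have r0 : 0 < r by rewrite sqrtr_gt0 mulrn_wgt0// exprn_gt0.
have r2 : r ^+ 2 = 2 * s ^+ 2.
  by rewrite sqr_sqrtr ?mulr_natl// mulrn_wge0// sqr_ge0.
pose F (x : R) := x / r.
have F'E : F^`()%classic = cst r^-1.
  apply/funext => x; rewrite /F derive1E deriveM// derive_cst scaler0 add0r.
  by rewrite derive_id /GRing.scale /= mulr1.
have pi0 : 0 < Num.sqrt pi :> R by rewrite sqrtr_gt0 pi_gt0.
transitivity (\int[mu]_x ((2 * s ^+ 2 / Num.sqrt pi)%:E *
   ((((fun x => x ^+ 2 * gauss_fun x) \o F) * F^`()%classic) x)%:E))%E.
  apply: eq_integral => x _; rewrite -EFinM; congr EFin.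
  rewrite F'E normal_pdfE ?gt_eqF// /normal_peak /normal_fun /gauss_fun /= subr0.
  have -> : Num.sqrt (s ^+ 2 * pi *+ 2) = r * Num.sqrt pi.
    by rewrite -mulrnAl sqrtrM// mulrn_wge0// sqr_ge0.
  have -> : - x ^+ 2 / (s ^+ 2 *+ 2) = - (F x) ^+ 2.
    by rewrite /F expr_div_n r2 mulr_natl mulNr.
  rewrite [RHS](_ : _ = 2 * s ^+ 2 / Num.sqrt pi *
    ((F x) ^+ 2 * expR (- F x ^+ 2) * r^-1)) //.
  rewrite /F expr_div_n -r2; move: (expR _) => e; field.
  by rewrite !gt_eqF.
rewrite ge0_integralZl_EFin//.
- rewrite -increasing_ge0_integration_by_substitutionT//.
  + rewrite integralT_sqr_gauss -EFinM; congr EFin; field.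
    by rewrite gt_eqF.
  + by move=> x y xy; rewrite /F ltr_pM2r// invr_gt0.
  + by rewrite F'E => ?; exact: cvg_cst.
  + by rewrite F'E; exact: is_cvg_cst.
  + by rewrite F'E; exact: is_cvg_cst.
  + by apply/gt0_cvgMlNy; [rewrite invr_gt0|exact: cvg_id].
  + by apply/gt0_cvgMly; [rewrite invr_gt0|exact: cvg_id].
  + move=> x; apply: cvgM; first exact: exprn_continuous.
    exact: continuous_gauss_fun.
  + by move=> x; rewrite mulr_ge0 ?sqr_ge0 ?gauss_fun_ge0.
- move=> x _; rewrite lee_fin F'E mulr_ge0 ?invr_ge0 ?(ltW r0)//.
  by rewrite mulr_ge0 ?sqr_ge0 ?gauss_fun_ge0.
- rewrite F'E; apply/measurable_EFinP; apply: measurable_funM => //.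
  apply: (@measurableT_comp _ _ _ _ _ _ (fun x : R => x ^+ 2 * gauss_fun x)).
    by apply: measurable_funM; [exact: exprn_measurable|exact: measurable_gauss_fun].
  exact: measurable_funM.
- by rewrite divr_ge0 ?(ltW pi0)// mulr_ge0 ?sqr_ge0.
Qed.

End gauss_moments.

Section gaussian_law.
Context {R : realType}.
Notation mu := (@lebesgue_measure R).

(** The law of an increment is only known as an abstract measure; integrals
    against it become Lebesgue integrals through the density. *)
Lemma integral_normal_prob (s : R) (f : R -> \bar R) : 0 < s ->
  measurable_fun setT f -> (forall x, 0 <= f x)%E ->
  (\int[normal_prob 0 s]_x f x = \int[mu]_x (f x * (normal_pdf 0 s x)%:E))%E.
Proof.
move=> s0 mf f0.
have dom : normal_prob 0 s `<< mu := normal_prob_dominates 0 s.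
rewrite -(Radon_Nikodym_SigmaFinite.change_of_variables dom)//.
have iRN := Radon_Nikodym_SigmaFinite.f_integrable dom.
have mpdf : measurable_fun setT (fun x => (normal_pdf 0 s x)%:E).
  by apply/measurable_EFinP; exact: measurable_normal_pdf.
apply: ae_eq_integral => //.
- by apply: emeasurable_funM => //; exact: measurable_int iRN.
- exact: emeasurable_funM.
- apply: ae_eqe_mul2l; apply: integral_ae_eq => // E _ mE.
  by rewrite -(Radon_Nikodym_SigmaFinite.f_integral dom mE).
Qed.

(** For an even density the positive and the negative part have the same
    integral; this gives mean zero without integrating x by parts. *)
Lemma ge0_integral_maxr (h : R -> R) :
  measurable_fun setT h -> (forall x, 0 <= h x) -> (forall x, h (- x) = h x) ->
  (\int[mu]_x ((Num.max x 0)%:E * (h x)%:E) =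
   \int[mu]_x ((Num.max (- x)%R 0)%:E * (h x)%:E))%E.
Proof.
move=> mh h0 hN.
pose g (x : R) : \bar R := ((Num.max x 0)%:E * (h x)%:E)%E.
have mg : measurable_fun setT g.
  by apply: emeasurable_funM; apply/measurable_EFinP => //; exact: measurable_maxr.
have g0 x : (0 <= g x)%E.
  by rewrite /g -EFinM lee_fin mulr_ge0// le_max lexx orbT.
transitivity (\int[mu]_(x in `[0%R, +oo[) g x)%E.
  rewrite [RHS]integral_mkcond; apply: eq_integral => x _.
  rewrite patchE; case: ifPn => //; rewrite notin_setE/= in_itv/= andbT => /negP.
  by rewrite -ltNge => /ltW x0; rewrite (max_r x0) mul0e.
rewrite ge0_integration_by_substitution0// [LHS]integral_mkcond.
apply: eq_integral => x _; rewrite patchE; case: ifPn; first by rewrite /g hN.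
rewrite notin_setE/= in_itv/= => /negP.
by rewrite -ltNge => x0; rewrite max_r ?mul0e// oppr_le0 ltW.
Qed.

Context d (Omega : measurableType d) (P : probability Omega R).
Variables (X : Omega -> R) (s : R).
Hypotheses (s0 : 0 < s) (mX : measurable_fun setT X).
Hypothesis lawX : forall U, measurable U -> P (X @^-1` U) = normal_prob 0 s U.

Lemma ge0_integral_gaussian_law (f : R -> \bar R) :
  measurable_fun setT f -> (forall x, 0 <= f x)%E ->
  (\int[P]_om f (X om) = \int[mu]_x (f x * (normal_pdf 0 s x)%:E))%E.
Proof.
move=> mf f0; rewrite -integral_normal_prob//.
have := @ge0_integral_pushforward _ _ Omega (measurableTypeR R) R X mX P
  setT f measurableT mf (fun x _ => f0 x).
rewrite preimage_setT /= => <-.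
by apply: eq_measure_integral => A mA _; exact: lawX.
Qed.

Lemma integral_sqr_gaussian : (\int[P]_om ((X om) ^+ 2)%:E = (s ^+ 2)%:E)%E.
Proof.
rewrite (@ge0_integral_gaussian_law (fun x => (x ^+ 2)%:E)).
- by under eq_integral do rewrite -EFinM; exact: integral_sqr_normal_pdf.
- by apply/measurable_EFinP; exact: exprn_measurable.
- by move=> x; rewrite lee_fin sqr_ge0.
Qed.

Lemma integral_gaussian_pos_neg :
  (\int[P]_om ((EFin \o X)^\+ om) = \int[P]_om ((EFin \o X)^\- om))%E.
Proof.
pose g (x : R) : \bar R := (Num.max x 0)%:E.
have mg : measurable_fun setT g.
  by apply/measurable_EFinP; exact: measurable_maxr.
have g0 x : (0 <= g x)%E by rewrite lee_fin le_max lexx orbT.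
have -> : (\int[P]_om (EFin \o X)^\+ om = \int[P]_om g (X om))%E.
  by apply: eq_integral => om _; rewrite funeposE /g EFin_max.
have -> : (\int[P]_om (EFin \o X)^\- om = \int[P]_om g (- X om)%R)%E.
  by apply: eq_integral => om _; rewrite funenegE /g EFin_max.
rewrite (ge0_integral_gaussian_law mg g0).
rewrite (@ge0_integral_gaussian_law (g \o -%R)) //; last 2 first.
- exact: measurableT_comp.
- by move=> x; exact: g0.
apply: ge0_integral_maxr.
- exact: measurable_normal_pdf.
- by move=> x; exact: normal_pdf_ge0.
- by move=> x; rewrite !normal_pdfE ?gt_eqF// /normal_fun !subr0 sqrrN.
Qed.

Lemma integral_gaussian : (\int[P]_om (X om)%:E = 0)%E.
Proof.
rewrite integralE integral_gaussian_pos_neg subee//.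
rewrite ge0_fin_numE; last by apply: integral_ge0.
apply: (@le_lt_trans _ _ (\int[P]_om (1%:E + ((X om) ^+ 2)%:E))%E).
  apply: ge0_le_integral => //.
  - by apply: measurable_funeneg; apply/measurable_EFinP.
  - apply: emeasurable_funD => //; apply/measurable_EFinP; exact: measurable_funX.
  - move=> om _; rewrite funenegE -EFinN -EFin_max -EFinD lee_fin ge_max.
    apply/andP; split; last by rewrite addr_ge0// sqr_ge0.
    by have := sqr_ge0 (X om + 1); nra.
rewrite ge0_integralD//; first last.
- by apply/measurable_EFinP; exact: measurable_funX.
- by move=> om _; rewrite lee_fin sqr_ge0.
have -> : (\int[P]__ 1 = 1)%E.
  by rewrite integral_cst// mul1e; exact: probability_setT.
by rewrite integral_sqr_gaussian -EFinD ltry.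
Qed.

End gaussian_law.

(** * Square-integrable functions *)

Section square_integrable_theory.
Context d (T : measurableType d) (R : realType).
Variables (mu : {measure set T -> \bar R}) (D : set T).
Hypothesis mD : measurable D.
Implicit Types f g : T -> R.
Local Notation L1 f := (mu.-integrable D (EFin \o f)).
Local Notation L2 f := (square_integrable mu D f).

Lemma L1_measurable f : L1 f -> measurable_fun D f.
Proof. by move=> /integrableP[/measurable_EFinP]. Qed.

Lemma L1_le f g : measurable_fun D f -> (forall x, D x -> `|f x| <= g x) ->
  L1 g -> L1 f.
Proof.
move=> mf fg ig; apply: le_integrable ig => //; first exact/measurable_EFinP.
by move=> x Dx; rewrite lee_fin (le_trans (fg _ Dx))// ler_norm.
Qed.

Lemma L1D f g : L1 f -> L1 g -> L1 (fun x => f x + g x).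
Proof. exact: integrableD. Qed.

Lemma L1Z (k : R) f : L1 f -> L1 (fun x => k * f x).
Proof. exact: integrableZl. Qed.

Lemma L1N f : L1 f -> L1 (fun x => - f x).
Proof. exact: integrableN. Qed.

Lemma L1B f g : L1 f -> L1 g -> L1 (fun x => f x - g x).
Proof. by move=> ? ?; apply: L1D => //; exact: L1N. Qed.

Lemma L1_sum I (s : seq I) (F : I -> T -> R) :
  (forall i, L1 (F i)) -> L1 (fun x => \sum_(i <- s) F i x).
Proof.
move=> h; elim: s => [|i s ih].
  apply: (eq_integrable _ (cst 0%E)) => //; last exact: integrable0.
  by move=> x _; rewrite /= big_nil.
apply: (eq_integrable _ (EFin \o (fun x => F i x + \sum_(i <- s) F i x))) => //.
  by move=> x _ /=; rewrite big_cons.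
exact: L1D.
Qed.

Lemma Rintegral_sum I (s : seq I) (F : I -> T -> R) :
  (forall i, L1 (F i)) ->
  \int[mu]_(x in D) (\sum_(i <- s) F i x) =
  \sum_(i <- s) \int[mu]_(x in D) F i x.
Proof.
move=> h; elim: s => [|i s ih].
  rewrite big_nil (@eq_Rintegral _ _ _ _ _ (cst 0)) => [|x _].
    by rewrite /Rintegral integral0.
  by rewrite /= big_nil.
rewrite big_cons -ih -RintegralD//; last exact: L1_sum.
by apply: eq_Rintegral => x _; rewrite big_cons.
Qed.

Lemma square_integrableP f : L2 f <-> measurable_fun D f /\ L1 (fun x => f x ^+ 2).
Proof.
split=> -[mf h]; split => //.
  apply/integrableP; split; first by apply/measurable_EFinP; exact: measurable_funX.
  by under eq_integral do rewrite /= ger0_norm ?sqr_ge0//.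
move/integrableP : h => [_].
by under eq_integral do rewrite /= ger0_norm ?sqr_ge0//.
Qed.

Lemma L2_measurable f : L2 f -> measurable_fun D f.
Proof. by case. Qed.

Lemma L2_sqr f : L2 f -> L1 (fun x => f x ^+ 2).
Proof. by move/square_integrableP => []. Qed.

Lemma L2_le f g : measurable_fun D f -> (forall x, D x -> `|f x| <= `|g x|) ->
  L2 g -> L2 f.
Proof.
move=> mf fg /square_integrableP[mg ig]; apply/square_integrableP; split => //.
apply: L1_le ig; first exact: measurable_funX.
move=> x Dx; rewrite ger0_norm ?sqr_ge0// -(real_normK (num_real (f x))).
by rewrite -(real_normK (num_real (g x))) lerXn2r// ?nnegrE//; exact: fg.
Qed.

Lemma L2M f g : L2 f -> L2 g -> L1 (fun x => f x * g x).
Proof.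
move=> /square_integrableP[mf i_f] /square_integrableP[mg i_g].
apply: (@L1_le _ (fun x => f x ^+ 2 + g x ^+ 2)).
- exact: measurable_funM.
- move=> x _; rewrite ler_norml.
  have h1 := sqr_ge0 (f x + g x); have h2 := sqr_ge0 (f x - g x).
  have h3 := sqr_ge0 (f x); have h4 := sqr_ge0 (g x).
  rewrite sqrrD in h1; rewrite sqrrB in h2.
  by apply/andP; split; lra.
- exact: L1D.
Qed.

Lemma L2D f g : L2 f -> L2 g -> L2 (fun x => f x + g x).
Proof.
move=> hf hg; have ifg := L2M hf hg.
move: hf hg => /square_integrableP[mf i_f] /square_integrableP[mg i_g].
apply/square_integrableP; split; first exact: measurable_funD.
apply: (@eq_integrable _ _ _ _ _ mD (EFin \o (fun x => (f x ^+ 2 + 2 * (f x * g x)) + g x ^+ 2))).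
  by move=> x _ /=; congr EFin; ring.
by apply: L1D => //; apply: L1D => //; exact: L1Z.
Qed.

Lemma L2Z (k : R) f : L2 f -> L2 (fun x => k * f x).
Proof.
move=> /square_integrableP[mf i_f]; apply/square_integrableP; split.
  exact: measurable_funM.
apply: (@eq_integrable _ _ _ _ _ mD (EFin \o (fun x => k ^+ 2 * f x ^+ 2))).
  by move=> x _ /=; rewrite exprMn.
exact: L1Z.
Qed.

Lemma L2N f : L2 f -> L2 (fun x => - f x).
Proof.
move=> h; have := L2Z (-1) h; congr square_integrable.
by apply/funext => x; rewrite mulN1r.
Qed.

Lemma L2B f g : L2 f -> L2 g -> L2 (fun x => f x - g x).
Proof. by move=> ? ?; apply: L2D => //; exact: L2N. Qed.

Lemma L2_zero : L2 (fun=> 0).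
Proof.
apply/square_integrableP; split=> //.
apply: (@eq_integrable _ _ _ _ _ mD (cst 0%E)); last exact: integrable0.
by move=> x _ /=; rewrite expr0n.
Qed.

Lemma L2_sum I (s : seq I) (F : I -> T -> R) :
  (forall i, L2 (F i)) -> L2 (fun x => \sum_(i <- s) F i x).
Proof.
move=> h; elim: s => [|i s ih].
  by under [X in L2 X]eq_fun do rewrite big_nil; exact: L2_zero.
by under [X in L2 X]eq_fun do rewrite big_cons; exact: L2D.
Qed.

Lemma L2_bounded_mul f g (C : R) : measurable_fun D f ->
  (forall x, D x -> `|f x| <= C) -> L2 g -> L2 (fun x => f x * g x).
Proof.
move=> mf fC hg; apply: (@L2_le _ (fun x => C * g x)).
- by apply: measurable_funM => //; exact: L2_measurable hg.
- move=> x Dx; rewrite !normrM ler_wpM2r//.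
  by rewrite (le_trans (fC _ Dx))// ler_norm.
- exact: L2Z.
Qed.

Lemma L2_norm0_ae f : L2 f -> \int[mu]_(x in D) (f x ^+ 2) = 0 ->
  ae_eq mu D f (fun=> 0).
Proof.
move=> Lf f0; have iF := L2_sqr Lf.
have : (\int[mu]_(x in D) `|(f x ^+ 2)%:E| = 0)%E.
  under eq_integral do rewrite abse_EFin ger0_norm ?sqr_ge0//.
  rewrite -[LHS]fineK; last exact: integrable_fin_num.
  by congr (_%:E).
move/(ae_eq_integral_abs _ mD) => /(_ (measurable_int _ iF)).
by apply: filterS => x /[apply] -[] /eqP; rewrite sqrf_eq0 => /eqP.
Qed.

Lemma L2_ae f g : measurable_fun D g -> ae_eq mu D f g -> L2 f -> L2 g.
Proof.
move=> mg fg [mf h]; split => //; move: h; congr (_ < _)%E.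
apply: ae_eq_integral => //.
- by apply/measurable_EFinP; exact: measurable_funX.
- by apply/measurable_EFinP; exact: measurable_funX.
- by apply: filterS fg => x /[apply] ->.
Qed.

(** The quantitative form of the Cauchy-Schwarz inequality that survives
    letting the second norm tend to 0 before [e]. *)
Lemma young_Rintegral f g (e : R) : 0 < e -> L2 f -> L2 g ->
  `|\int[mu]_(x in D) (f x * g x)| <=
  e * \int[mu]_(x in D) (f x ^+ 2) + e^-1 * \int[mu]_(x in D) (g x ^+ 2).
Proof.
move=> e0 hf hg; have ifg := L2M hf hg.
have hf2 := L2_sqr hf; have hg2 := L2_sqr hg.
rewrite (le_trans (le_normr_Rintegral _ ifg))//.
rewrite -!RintegralZl// -RintegralD//; [|exact: L1Z..].
apply: le_Rintegral => //; first exact: integrable_norm.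
  by apply: L1D; exact: L1Z.
move=> x _; rewrite ler_norml.
pose s := Num.sqrt e; have s0 : 0 < s by rewrite sqrtr_gt0.
have es : e = s ^+ 2 by rewrite sqr_sqrtr// ltW.
have h1 := sqr_ge0 (s * f x + s^-1 * g x).
have h2 := sqr_ge0 (s * f x - s^-1 * g x).
have h3 := sqr_ge0 (s * f x); have h4 := sqr_ge0 (s^-1 * g x).
have E : s * f x * (s^-1 * g x) = f x * g x by field; rewrite gt_eqF.
rewrite sqrrD E in h1; rewrite sqrrB E in h2.
rewrite es -exprVn -!exprMn.
by apply/andP; split; lra.
Qed.

(** Passing to the limit in a pairing is how every identity proved for simple
    integrands reaches the stochastic integrals. *)
Lemma L2_cvg_mul (f : T -> R) (s : nat -> T -> R) g :
  L2 f -> (forall n, L2 (s n)) -> L2 g -> l2_cvg mu D s g ->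
  (fun n => \int[mu]_(x in D) (f x * s n x)) @ \oo -->
  \int[mu]_(x in D) (f x * g x).
Proof.
move=> hf hs hg sg; apply/cvgrPdist_le => /= e e0.
pose A := \int[mu]_(x in D) (f x ^+ 2).
have A0 : 0 <= A by apply: Rintegral_ge0 => x _; exact: sqr_ge0.
pose h := e / (2 * (A + 1)).
have h0 : 0 < h by rewrite divr_gt0// mulr_gt0// ltr_wpDl.
have := sg => /fine_cvgP[_] /cvgrPdist_le /= /(_ (h * e / 2)).
have he0 : 0 < h * e / 2 by rewrite divr_gt0// mulr_gt0.
move=> /(_ he0); apply: filterS => n.
rewrite sub0r normrN => sn.
rewrite -RintegralB//; [|exact: L2M..].
under eq_Rintegral do rewrite -mulrBr.
apply: le_trans (young_Rintegral h0 hf (L2B hg (hs n))) _.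
have -> : e = e / 2 + h^-1 * (h * e / 2).
  by rewrite -mulrA mulKf ?gt_eqF// -splitr.
apply: lerD.
  rewrite -/A /h -ler_pdivlMl ?(lt_le_trans h0)//.
  rewrite invf_div mulrAC [leRHS](_ : _ = A + 1) ?lerDl//.
  by field; rewrite !gt_eqF// ltr_wpDl.
apply: ler_wpM2l; first by rewrite invr_ge0 ltW.
apply: le_trans sn; rewrite -/(Rintegral _ _ _).
rewrite (_ : Rintegral _ _ _ = \int[mu]_(x in D) ((s n x - g x) ^+ 2)) ?ler_norm//.
by apply: eq_Rintegral => x _; rewrite -sqrrN opprB.
Qed.

(** An L2 limit of L2 functions is in L2, being at finite distance from one. *)
Lemma l2_cvg_L2 (s : nat -> T -> R) g : measurable_fun D g ->
  (forall n, L2 (s n)) -> l2_cvg mu D s g -> L2 g.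
Proof.
move=> mg hs /fine_cvgP[[n _ /(_ n (leqnn n))/= hn] _].
have : L2 (fun x => s n x - g x).
  split; first by apply: measurable_funB => //; exact: L2_measurable.
  by move/fin_numPlt : hn => /andP[].
move=> /(L2B (hs n)); congr square_integrable.
by apply/funext => x; rewrite opprB addrC subrK.
Qed.

End square_integrable_theory.

(** * Independence *)

Section independence.
Context d (Omega : measurableType d) (R : realType) (P : probability Omega R).

Definition independent_rv (X Y : Omega -> R) : Prop :=
  forall U V : set R, measurable U -> measurable V ->
    P (X @^-1` U `&` Y @^-1` V) = (P (X @^-1` U) * P (Y @^-1` V))%E.

Lemma independent_rv_comp (X Y : Omega -> R) (f g : R -> R) :
  measurable_fun setT f -> measurable_fun setT g ->
  independent_rv X Y -> independent_rv (f \o X) (g \o Y).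
Proof.
move=> mf mg h U V mU mV; apply: (h (f @^-1` U) (g @^-1` V)).
  by rewrite -[X in measurable X]setTI; exact: mf.
by rewrite -[X in measurable X]setTI; exact: mg.
Qed.

Section product.
Variables X Y : Omega -> R.
Hypotheses (mX : measurable_fun setT X) (mY : measurable_fun setT Y).
Hypothesis XY : independent_rv X Y.
Hypotheses (iX : P.-integrable setT (EFin \o X)) (iY : P.-integrable setT (EFin \o Y)).

Let X' : {mfun Omega >-> R} := HB.pack X (isMeasurableFun.Build _ _ _ _ X mX).
Let Y' : {mfun Omega >-> R} := HB.pack Y (isMeasurableFun.Build _ _ _ _ Y mY).
Let XY0 om := (X om, Y om).
Let mXY0 : measurable_fun setT XY0.
Proof. exact: measurable_fun_pair. Qed.
Let XY' : {mfun Omega >-> (R * R)%type} :=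
  HB.pack XY0 (isMeasurableFun.Build _ _ _ _ XY0 mXY0).
Let PX := distribution P X'.
Let PY := distribution P Y'.

Let joint_law A : measurable A -> (PX \x PY)%E A = distribution P XY' A.
Proof.
apply: product_measure_unique => U V mU mV.
by rewrite /PX /PY /distribution /pushforward /= -XY.
Qed.

Let m1 : measurable_fun setT (fun z : R * R => (z.1 * z.2)%:E).
Proof. by apply/measurable_EFinP; exact: measurable_funM. Qed.

Let law_integrable (Z : {mfun Omega >-> R}) : P.-integrable setT (EFin \o Z) ->
  (distribution P Z).-integrable setT (EFin \o id).
Proof.
move=> iZ.
apply: (@integrable_pushforward _ _ _ _ _ Z _ P setT (EFin \o id)) => //.
exact/measurable_EFinP.
Qed.

Let integrable_law : (PX \x PY)%E.-integrable setT (fun z : R * R => (z.1 * z.2)%:E).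
Proof.
apply/integrable12ltyP => //=.
under eq_integral => x _.
  under eq_integral => y _ do rewrite normrM EFinM.
  rewrite ge0_integralZl//; last by do 2 apply: measurableT_comp => //.
  over.
have hX := @law_integrable X' iX; have hY := @law_integrable Y' iY.
rewrite ge0_integralZr//; last 2 first.
- by do 2 apply: measurableT_comp => //.
- exact: integral_ge0.
rewrite lte_mul_pinfty ?integral_ge0//.
- by rewrite ge0_fin_numE ?integral_ge0//; have /integrableP[] := hX.
- by have /integrableP[] := hY.
Qed.

(** The joint law of two independent variables is the product of their laws,
    by uniqueness of the product measure; Fubini then factors the
    expectation. *)
Lemma independent_integrableM :
  P.-integrable setT (EFin \o (fun om => X om * Y om)).
Proof.
apply/integrableP; split; first by apply/measurable_EFinP; exact: measurable_funM.
move/integrableP : integrable_law => [_]; congr (_ < _)%E.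
rewrite (eq_measure_integral (distribution P XY')); last first.
  by move=> A mA _; exact: joint_law.
by rewrite ge0_integral_distribution//; exact: measurableT_comp.
Qed.

Lemma independent_RintegralM :
  \int[P]_om (X om * Y om) = (\int[P]_om X om) * (\int[P]_om Y om).
Proof.
have E : (\int[P]_om (X om * Y om)%:E =
    (\int[P]_om (X om)%:E) * (\int[P]_om (Y om)%:E))%E.
  have -> : (\int[P]_om (X om * Y om)%:E =
      \int[distribution P XY']_z (z.1 * z.2)%:E)%E.
    rewrite integral_distribution//; exact: independent_integrableM.
  rewrite (eq_measure_integral (PX \x PY)%E); last first.
    by move=> A mA _; apply/esym; exact: joint_law.
  rewrite -integral12_prod_meas1// /fubini_F /=.
  have hX := @law_integrable X' iX; have hY := @law_integrable Y' iY.
  under eq_integral => x _.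
    under eq_integral => y _ do rewrite EFinM.
    rewrite integralZl//.
    over.
  have -> : (\int[P]_om (X om)%:E = \int[PX]_x x%:E)%E.
    by rewrite integral_distribution//; exact/measurable_EFinP.
  have -> : (\int[P]_om (Y om)%:E = \int[PY]_x x%:E)%E.
    by rewrite integral_distribution//; exact/measurable_EFinP.
  rewrite -(fineK (integrable_fin_num measurableT hY)).
  by rewrite integralZr.
by rewrite /Rintegral E fineM//; exact: integrable_fin_num.
Qed.

End product.

(** In contrast with general square integrable factors, whose product is only
    integrable: the squares are independent and integrable. *)
Lemma independent_L2M (X Y : Omega -> R) : independent_rv X Y ->
  square_integrable P setT X -> square_integrable P setT Y ->
  square_integrable P setT (fun om => X om * Y om).
Proof.
move=> XY /square_integrableP [mX iX].
move=> /square_integrableP [mY iY].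
apply/square_integrableP; split; first exact: measurable_funM.
have mS : measurable_fun setT (fun x : R => x ^+ 2) by exact: exprn_measurable.
have := independent_integrableM (measurable_funX 2 mX) (measurable_funX 2 mY)
  (independent_rv_comp mS mS XY) iX iY.
by apply: eq_integrable => // om _ /=; rewrite exprMn.
Qed.

End independence.

Section pi_lambda.
Context d (Omega : measurableType d) (R : realType) (P : probability Omega R).

(** Both sides are finite measures of [A], so the pi-lambda theorem extends
    their equality from the pi-system [G] to the sigma-algebra it generates. *)
Lemma independent_sigma_algebra (G : set (set Omega)) (E : set Omega) :
  G setT -> setI_closed G -> G `<=` measurable -> measurable E ->
  (forall A, G A -> P (A `&` E) = (P A * P E)%E) ->
  forall A, <<s G >> A -> P (A `&` E) = (P A * P E)%E.
Proof.
move=> GT GI Gm mE GE A sGA.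
have PE0 : 0 <= fine (P E) by apply: fine_ge0; exact: measure_ge0.
have := @g_sigma_algebra_measure_unique _ _ _ G Gm (fun=> setT) (fun=> GT)
  _ (mrestr P mE) (mscale (NngNum PE0) P) GI _ _ A sGA.
have scaleE C : measurable C -> mscale (NngNum PE0) P C = (P C * P E)%E.
  by move=> mC; rewrite /mscale/= fineK ?fin_num_measure// muleC.
rewrite -/(mrestr P mE A) => ->.
- by apply: scaleE; exact: (smallest_sub (@sigma_algebra_measurable _ Omega) Gm).
- by rewrite bigcup_const//; exists 0%N.
- move=> C GC; transitivity (P C * P E)%E; first exact: GE.
  exact/esym/scaleE/Gm.
- move=> _; have mTE := measurableI _ _ measurableT mE.
  by apply: (le_lt_trans (probability_le1 P mTE)); rewrite ltry.
Qed.

End pi_lambda.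

(** * Increments of the Brownian sheet *)
Definition good_box (R : realType) (lo hi : R * R) := ple (0, 0) lo && ple lo hi.

Section sheet_increments.
Context d (Omega : measurableType d) (R : realType) (P : probability Omega R).
Variable B : R * R -> Omega -> R.
Hypothesis hB : brownian_sheet P B.
Implicit Types lo hi z w : R * R.

Lemma good_boxP lo hi :
  reflect [/\ 0 <= lo.1, 0 <= lo.2, lo.1 <= hi.1 & lo.2 <= hi.2] (good_box lo hi).
Proof.
rewrite /good_box /ple /=; apply: (iffP andP).
  by case=> /andP[-> ->] /andP[-> ->].
by case=> -> -> -> ->.
Qed.

Lemma sheet_measurable z : ple (0, 0) z -> measurable_fun setT (B z).
Proof. by case: hB => h _ _ _ _; exact: h. Qed.

Lemma measurable_sheet_incr lo hi : good_box lo hi ->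
  measurable_fun setT (sheet_incr B lo hi).
Proof.
move=> /good_boxP[l1 l2 h1 h2].
have h1' := le_trans l1 h1; have h2' := le_trans l2 h2.
apply: measurable_funD; [apply: measurable_funB; [apply: measurable_funB|]|];
  by apply: sheet_measurable; rewrite /ple/= ?l1 ?l2 ?h1' ?h2'.
Qed.

Lemma sheet_incr_degenerate lo hi : lo.1 = hi.1 \/ lo.2 = hi.2 ->
  sheet_incr B lo hi = fun=> 0.
Proof.
case: lo hi => [a b] [c e] /= [->|->]; apply/funext => om; rewrite /sheet_incr/=;
  ring.
Qed.

Definition area lo hi := (hi.1 - lo.1) * (hi.2 - lo.2).

(** The Gaussian law of the increments is postulated for boxes with nonempty
    interior; over the remaining ones the increment vanishes identically. *)
Lemma sheet_incr_cases lo hi : good_box lo hi ->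
  sheet_incr B lo hi = (fun=> 0) /\ area lo hi = 0 \/
  0 < area lo hi /\ forall U, measurable U ->
    P (sheet_incr B lo hi @^-1` U) = normal_prob 0 (Num.sqrt (area lo hi)) U.
Proof.
move=> g; have /good_boxP[l1 l2 h1 h2] := g; have /andP[l0 _] := g.
move: h1; rewrite le_eqVlt => /predU1P[h1|h1].
  by left; rewrite sheet_incr_degenerate; [rewrite /area h1 subrr mul0r|left].
move: h2; rewrite le_eqVlt => /predU1P[h2|h2].
  by left; rewrite sheet_incr_degenerate; [rewrite /area h2 subrr mulr0|right].
right; split; first by rewrite mulr_gt0// subr_gt0.
by case: hB => _ _ _ h _; exact: h.
Qed.

Lemma sheet_incr_sqr lo hi : good_box lo hi ->
  (\int[P]_om ((sheet_incr B lo hi om) ^+ 2)%:E = (area lo hi)%:E)%E.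
Proof.
move=> g; have mD := measurable_sheet_incr g.
have [[-> ->]|[a0 law]] := sheet_incr_cases g.
  by under eq_integral do rewrite expr0n/=; rewrite integral0.
rewrite (integral_sqr_gaussian _ mD law) ?sqrtr_gt0//.
by rewrite sqr_sqrtr// ltW.
Qed.

Lemma sheet_incr_L2 lo hi : good_box lo hi ->
  square_integrable P setT (sheet_incr B lo hi).
Proof.
by move=> g; split; [exact: measurable_sheet_incr|rewrite sheet_incr_sqr// ltry].
Qed.

Lemma prob_L2_L1 (f : Omega -> R) : square_integrable P setT f ->
  P.-integrable setT (EFin \o f).
Proof.
move=> hf; have h1 : square_integrable P setT (fun=> 1 : R).
  split=> //; rewrite expr1n integral_cst// mul1e.
  by rewrite (_ : _ setT = 1%E) ?ltry//; exact: probability_setT.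
have := L2M measurableT hf h1; apply: eq_integrable => // om _ /=.
by rewrite mulr1.
Qed.

Lemma prob_L2_cst (a : R) : square_integrable P setT (fun=> a).
Proof.
split; first exact: measurable_cst.
by rewrite integral_cst// [X in (_ * X)%E](_ : _ setT = 1%E) ?mule1 ?ltry//;
  exact: probability_setT.
Qed.

Lemma sheet_incr_mean lo hi : good_box lo hi ->
  \int[P]_om (sheet_incr B lo hi om) = 0.
Proof.
move=> g; have mD := measurable_sheet_incr g.
rewrite /Rintegral; have [[-> _]|[a0 law]] := sheet_incr_cases g.
  by rewrite integral0.
by rewrite (integral_gaussian _ mD law) ?sqrtr_gt0.
Qed.

(** The product rule over the [n.+1] boxes obtained by adding [l, h] to the
    family, divided by the product rule over the family. *)
Lemma disjoint_increments_independent (n : nat) (lo hi : 'I_n -> R * R) l h :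
  good_box l h -> (forall i, good_box (lo i) (hi i)) ->
  trivIset setT (fun i => box (lo i) (hi i)) ->
  (forall i, box (lo i) (hi i) `&` box l h = set0) ->
  forall (U : 'I_n -> set R) (V : set R), (forall i, measurable (U i)) ->
  measurable V ->
  P ((\bigcap_(i in setT) (sheet_incr B (lo i) (hi i) @^-1` U i))
     `&` sheet_incr B l h @^-1` V) =
  (P (\bigcap_(i in setT) (sheet_incr B (lo i) (hi i) @^-1` U i)) *
   P (sheet_incr B l h @^-1` V))%E.
Proof.
move=> glh gi tI dj U V mU mV; have [_ _ _ _ ind] := hB.
pose lo' (i : 'I_n.+1) := if unlift ord0 i is Some j then lo j else l.
pose hi' (i : 'I_n.+1) := if unlift ord0 i is Some j then hi j else h.
pose U' (i : 'I_n.+1) := if unlift ord0 i is Some j then U j else V.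
have g' i : ple (0, 0) (lo' i) && ple (lo' i) (hi' i).
  by rewrite /lo' /hi'; case: (unlift ord0 i) => [j|]; [exact: gi|exact: glh].
have t' : trivIset setT (fun i => box (lo' i) (hi' i)).
  move=> i j _ _; rewrite /lo' /hi'.
  case: unliftP => [i' ->|->]; case: unliftP => [j' ->|->] //=.
  - by move=> /(tI _ _ I I) ->.
  - by rewrite dj => -[].
  - by rewrite setIC dj => -[].
have mU' i : measurable (U' i) by rewrite /U'; case: (unlift ord0 i).
have := ind _ _ _ g' t' U' mU'.
rewrite big_ord_recl {2}/lo' {2}/hi' {2}/U' !unlift_none.
under eq_bigr => i _ do rewrite /lo' /hi' /U' !liftK.
have -> : \bigcap_(i in setT) (sheet_incr B (lo' i) (hi' i) @^-1` U' i) =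
  (\bigcap_(i in setT) (sheet_incr B (lo i) (hi i) @^-1` U i))
     `&` sheet_incr B l h @^-1` V.
  apply/seteqP; split=> [om /= H|om /= [H1 H2] i _].
    split=> [i _|]; first by have := H (lift ord0 i) I; rewrite /lo' /hi' /U' liftK.
    by have := H ord0 I; rewrite /lo' /hi' /U' unlift_none.
  by rewrite /lo' /hi' /U'; case: unliftP => [j _|_] //; exact: H1.
move=> ->; rewrite (ind _ _ _ gi tI U mU) EFinM fineK; first by rewrite muleC.
apply: fin_num_measure; rewrite -[X in measurable X]setTI.
exact: measurable_sheet_incr.
Qed.

End sheet_increments.

Section grid_points.
Variable R : realType.
Implicit Types (s : seq R) (a b : R) (i j : nat).

(** Indices beyond the end give the last point, so that the cell
    [grid_pt s i, grid_pt s i.+1] is empty there and no bound on [i] is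
    needed. *)
Definition grid_pt s i : R := nth 0 s (minn i (size s).-1).

Lemma grid_pt_le s i j : sorted <=%R s -> (i <= j)%N ->
  grid_pt s i <= grid_pt s j.
Proof.
case: s => [|a s] srt ij; first by rewrite /grid_pt !nth_nil.
rewrite /grid_pt (sorted_leq_nth le_trans le_refl 0 srt) ?inE//=.
- by rewrite ltnS geq_minr.
- by rewrite ltnS geq_minr.
- by rewrite leq_min (leq_trans (geq_minl _ _) ij) geq_minr.
Qed.

Lemma grid_pt_ge0 s i : (forall a, a \in s -> 0 <= a) -> 0 <= grid_pt s i.
Proof.
case: s => [|a s] h; first by rewrite /grid_pt nth_nil.
by apply/h/mem_nth; rewrite /= ltnS geq_minr.
Qed.

Lemma grid_pt_index s a : a \in s -> grid_pt s (index a s) = a.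
Proof.
move=> sa; rewrite /grid_pt (minn_idPl _) ?nth_index//.
by move: sa; rewrite -index_mem; case: (size s).
Qed.

Lemma grid_pt_disjoint s i j a : sorted <=%R s ->
  grid_pt s i < a <= grid_pt s i.+1 -> grid_pt s j < a <= grid_pt s j.+1 ->
  i = j.
Proof.
move=> srt /andP[i1 i2] /andP[j1 j2]; apply/eqP; rewrite eqn_leq.
apply/andP; split; rewrite leqNgt; apply/negP => ij.
  by have := lt_le_trans (le_lt_trans (grid_pt_le srt ij) i1) j2; rewrite ltxx.
by have := lt_le_trans (le_lt_trans (grid_pt_le srt ij) j1) i2; rewrite ltxx.
Qed.

Lemma index_le s a b : sorted <=%R s -> a \in s -> b \in s -> a <= b ->
  (index a s <= index b s)%N.
Proof.
move=> srt sa sb ab; rewrite leqNgt; apply/negP => ba.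
have := grid_pt_le srt (ltnW ba); rewrite !grid_pt_index// => ba'.
by move: ba; rewrite (@le_anti _ _ a b) ?ltnn// ab.
Qed.

End grid_points.

Section increments_on_grid.
Context (R : realType) (Omega : Type) (B : R * R -> Omega -> R).

(** Additivity of the increments: the sum telescopes in each variable. *)
Lemma sheet_incr_grid (x y : nat -> R) (a b c e : nat) om :
  (a <= c)%N -> (b <= e)%N ->
  sheet_incr B (x a, y b) (x c, y e) om =
  \sum_(a <= i < c) \sum_(b <= j < e)
     sheet_incr B (x i, y j) (x i.+1, y j.+1) om.
Proof.
move=> ac be.
pose f i := B (x i, y e) om - B (x i, y b) om.
transitivity (\sum_(a <= i < c) (f i.+1 - f i)).
  by rewrite telescope_sumr// /f /sheet_incr/=; ring.
apply: eq_bigr => i _; pose g j := B (x i.+1, y j) om - B (x i, y j) om.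
rewrite (eq_bigr (fun j => g j.+1 - g j)) => [|j _].
  by rewrite telescope_sumr// /f /g; ring.
by rewrite /g /sheet_incr/=; ring.
Qed.

(** Finitely many boxes avoiding [box l h] are unions of cells of the grid
    spanned by their corners; cells that meet [box l h] are replaced by an
    empty box, so that every box of the refinement avoids it as well. *)
Lemma common_refinement (n : nat) (lo hi : 'I_n -> R * R) (l h : R * R) :
  (forall i, good_box (lo i) (hi i)) ->
  (forall i, box (lo i) (hi i) `&` box l h = set0) ->
  exists (m : nat) (lo' hi' : 'I_m -> R * R),
    [/\ forall k, good_box (lo' k) (hi' k),
        trivIset setT (fun k => box (lo' k) (hi' k)),
        forall k, box (lo' k) (hi' k) `&` box l h = set0
      & forall i, exists r : seq 'I_m, forall om,
          sheet_incr B (lo i) (hi i) om =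
          \sum_(k <- r) sheet_incr B (lo' k) (hi' k) om].
Proof.
move=> gd off.
pose xs := sort <=%R ([seq (lo i).1 | i <- enum 'I_n] ++ [seq (hi i).1 | i <- enum 'I_n]).
pose ys := sort <=%R ([seq (lo i).2 | i <- enum 'I_n] ++ [seq (hi i).2 | i <- enum 'I_n]).
have sx : sorted <=%R xs by exact: sort_le_sorted.
have sy : sorted <=%R ys by exact: sort_le_sorted.
have lox i : (lo i).1 \in xs.
  by rewrite mem_sort mem_cat; apply/orP; left; apply/mapP; exists i; rewrite ?mem_enum.
have hix i : (hi i).1 \in xs.
  by rewrite mem_sort mem_cat; apply/orP; right; apply/mapP; exists i; rewrite ?mem_enum.
have loy i : (lo i).2 \in ys.
  by rewrite mem_sort mem_cat; apply/orP; left; apply/mapP; exists i; rewrite ?mem_enum.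
have hiy i : (hi i).2 \in ys.
  by rewrite mem_sort mem_cat; apply/orP; right; apply/mapP; exists i; rewrite ?mem_enum.
have xs0 a : a \in xs -> 0 <= a.
  by rewrite mem_sort mem_cat => /orP[] /mapP[i _ ->];
    have /good_boxP[? ? ? ?] := gd i => //; apply: (@le_trans _ _ (lo i).1).
have ys0 a : a \in ys -> 0 <= a.
  by rewrite mem_sort mem_cat => /orP[] /mapP[i _ ->];
    have /good_boxP[? ? ? ?] := gd i => //; apply: (@le_trans _ _ (lo i).2).
pose x := grid_pt xs; pose y := grid_pt ys.
pose I := ('I_(size xs) * 'I_(size ys))%type.
pose clo (p : I) := (x p.1, y p.2).
pose chi (p : I) := (x p.1.+1, y p.2.+1).
pose ok (p : I) := `[< box (clo p) (chi p) `&` box l h = set0 >].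
exists #|{: I}|, (fun k => if ok (enum_val k) then clo (enum_val k) else (0, 0)),
  (fun k => if ok (enum_val k) then chi (enum_val k) else (0, 0)).
have box00 : box (0, 0) (0, 0) = set0 :> set (R * R).
  by apply/seteqP; split => // -[a b] /= /andP[/andP[/lt_le_trans/[apply]]]; rewrite ltxx.
split.
- move=> k; case: ifP => _; last by apply/good_boxP; rewrite /= lexx.
  by apply/good_boxP; split=> /=; [exact: grid_pt_ge0|exact: grid_pt_ge0|
    exact: grid_pt_le|exact: grid_pt_le].
- move=> k k' _ _; case: ifP => _; last by rewrite box00 set0I => -[].
  case: ifP => _; last by rewrite box00 setI0 => -[].
  move=> [[a b] [/= /andP[A1 A2] /andP[A3 A4]]].
  apply: enum_val_inj; apply/eqP; rewrite -pair_eqE /= /pair_eq /=.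
  by rewrite -!val_eqE /= (grid_pt_disjoint sx A1 A3) (grid_pt_disjoint sy A2 A4) !eqxx.
- by move=> k; case: ifP => [/asboolP//|_]; rewrite box00 set0I.
- move=> i; have /good_boxP[l1 l2 h1 h2] := gd i.
  pose a := index (lo i).1 xs; pose c := index (hi i).1 xs.
  pose b := index (lo i).2 ys; pose e := index (hi i).2 ys.
  have ac : (a <= c)%N by exact: index_le.
  have be : (b <= e)%N by exact: index_le.
  have cK : (c <= size xs)%N by rewrite ltnW// index_mem.
  have eK : (e <= size ys)%N by rewrite ltnW// index_mem.
  pose Q (p : I) := ((a <= p.1 < c) && (b <= p.2 < e))%N.
  exists [seq k <- index_enum 'I_#|{: I}| | Q (enum_val k)] => om.
  have loE : lo i = (x a, y b).
    by rewrite /x /y !grid_pt_index//; case: (lo i).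
  have hiE : hi i = (x c, y e).
    by rewrite /x /y !grid_pt_index//; case: (hi i).
  have okQ p : Q p -> ok p.
    move=> /andP[/andP[p1 p2] /andP[p3 p4]]; apply/asboolP.
    rewrite -subset0 -(off i); apply: setSI => -[u v] /=.
    rewrite loE hiE => /andP[/andP[/= u1 u2] /andP[/= v1 v2]].
    rewrite /box /=; apply/andP; split; apply/andP; split.
    - by apply: le_lt_trans u1; exact: grid_pt_le.
    - by apply: (le_trans u2); exact: grid_pt_le.
    - by apply: le_lt_trans v1; exact: grid_pt_le.
    - by apply: (le_trans v2); exact: grid_pt_le.
  rewrite loE hiE sheet_incr_grid// big_filter.
  rewrite (eq_bigr (fun k => sheet_incr B (clo (enum_val k)) (chi (enum_val k)) om));
    last by move=> k /okQ ->.
  rewrite -(@big_enum_val_cond _ _ _ I predT Q (fun p => sheet_incr B (clo p) (chi p) om)).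
  have widen (F : nat -> R) (k m K : nat) : (m <= K)%N ->
      \sum_(k <= j < m) F j = \sum_(j < K | (k <= j < m)%N) F j.
    by move=> mK; rewrite big_geq_mkord (big_ord_widen_cond _ (fun j => k <= j)%N F mK).
  rewrite (widen _ _ _ _ cK) (eq_bigr _ (fun j _ => widen _ b e _ eK)).
  by rewrite pair_big_dep /=; apply: eq_bigl => -[p q].
Qed.

End increments_on_grid.

(** * Independence of an increment from the rest of the sheet *)
Section measurable_wrt_theory.
Context d (Omega : measurableType d) (R : realType).
Variable G : set (set Omega).
Implicit Types X Y : Omega -> R.

Lemma measurable_wrtP X : measurable_wrt <<s G >> X <->
  measurable_fun setT (X : g_sigma_algebraType G -> R).
Proof.
split=> [h _ U mU|h U mU]; first by rewrite setTI; exact: h.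
by have := h measurableT U mU; rewrite setTI.
Qed.

Lemma measurable_wrt_cst (k : R) : measurable_wrt <<s G >> (fun=> k).
Proof. by apply/measurable_wrtP; exact: measurable_cst. Qed.

Lemma measurable_wrtM X Y : measurable_wrt <<s G >> X ->
  measurable_wrt <<s G >> Y -> measurable_wrt <<s G >> (fun om => X om * Y om).
Proof.
move=> /measurable_wrtP hX /measurable_wrtP hY; apply/measurable_wrtP.
exact: measurable_funM.
Qed.

Lemma measurable_wrtD X Y : measurable_wrt <<s G >> X ->
  measurable_wrt <<s G >> Y -> measurable_wrt <<s G >> (fun om => X om + Y om).
Proof.
move=> /measurable_wrtP hX /measurable_wrtP hY; apply/measurable_wrtP.
exact: measurable_funD.
Qed.

Lemma measurable_wrt_sum I (s : seq I) (F : I -> Omega -> R) :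
  (forall i, measurable_wrt <<s G >> (F i)) ->
  measurable_wrt <<s G >> (fun om => \sum_(i <- s) F i om).
Proof.
move=> h; apply/measurable_wrtP; apply: measurable_sum => i.
exact/measurable_wrtP.
Qed.

Lemma measurable_wrt_ambient X : G `<=` measurable ->
  measurable_wrt <<s G >> X -> measurable_fun setT X.
Proof.
move=> Gm h _ U mU; rewrite setTI; move: (h U mU).
exact: (smallest_sub (@sigma_algebra_measurable _ Omega) Gm).
Qed.

End measurable_wrt_theory.

Lemma measurable_wrt_sub (Omega : Type) (R : realType) (G H : set (set Omega))
    (X : Omega -> R) : G `<=` H -> measurable_wrt G X -> measurable_wrt H X.
Proof. by move=> GH h U mU; exact/GH/h. Qed.

(** What the sheet does outside the box [l, h]. *)
Definition off_sigma (R : realType) (Omega : Type) (B : R * R -> Omega -> R)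
    (l h : R * R) : set (set Omega) :=
  <<s [set A | exists (lo hi : R * R) (U : set R),
     [/\ good_box lo hi, box lo hi `&` box l h = set0, measurable U
       & A = sheet_incr B lo hi @^-1` U]] >>.

Section off_sigma.
Context d (Omega : measurableType d) (R : realType) (P : probability Omega R).
Variable B : R * R -> Omega -> R.
Hypothesis hB : brownian_sheet P B.
Implicit Types lo hi z w l h : R * R.

Let measurable_preimage_incr lo hi U : good_box lo hi -> measurable U ->
  measurable (sheet_incr B lo hi @^-1` U).
Proof.
move=> g mU; rewrite -[X in measurable X]setTI.
exact: (measurable_sheet_incr hB g).
Qed.

(** Two applications of the pi-lambda theorem: from disjoint boxes to the
    cylinder sets of arbitrary boxes, through a common refinement, and from
    these to the generated sigma-algebra. *)
Lemma independent_off_sigma l h : good_box l h ->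
  forall A V, off_sigma B l h A -> measurable V ->
  P (A `&` sheet_incr B l h @^-1` V) =
  (P A * P (sheet_incr B l h @^-1` V))%E.
Proof.
move=> glh A V sA mV.
set E := sheet_incr B l h @^-1` V.
have mE : measurable E by exact: measurable_preimage_incr.
pose incrI n (lo hi : 'I_n -> R * R) (U : 'I_n -> set R) : set Omega :=
  \bigcap_(i in setT) (sheet_incr B (lo i) (hi i) @^-1` U i).
pose Pi : set (set Omega) := [set A | exists (n : nat) (lo hi : 'I_n -> R * R)
    (U : 'I_n -> set R),
  [/\ forall i, good_box (lo i) (hi i),
      forall i, box (lo i) (hi i) `&` box l h = set0,
      forall i, measurable (U i) & A = @incrI n lo hi U]].
have mI n (lo hi : 'I_n -> R * R) (U : 'I_n -> set R) : (forall i, good_box (lo i) (hi i)) ->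
    (forall i, measurable (U i)) -> measurable (@incrI n lo hi U).
  move=> gd mU; apply: fin_bigcap_measurable => // i _.
  exact: measurable_preimage_incr.
apply: (@independent_sigma_algebra _ _ _ P Pi) => //.
- exists 0%N, (fun=> (0, 0)), (fun=> (0, 0)), (fun=> setT).
  split; [by case|by case|by []|].
  by apply/seteqP; split => // om _ [].
- move=> _ _ [n [lo [hi [U [g o mU ->]]]]] [n' [lo' [hi' [U' [g' o' mU' ->]]]]].
  exists (n + n')%N.
  exists (fun i => match fintype.split i with inl j => lo j | inr j => lo' j end).
  exists (fun i => match fintype.split i with inl j => hi j | inr j => hi' j end).
  exists (fun i => match fintype.split i with inl j => U j | inr j => U' j end).
  split; try by move=> i; case: (fintype.split i).
  apply/seteqP; split=> [om [/= h1 h2] i _|om /= H].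
    by case: (fintype.split i) => j; [exact: h1|exact: h2].
  split=> i _.
    by have := H (lshift _ i) I; rewrite (unsplitK (inl i)).
  by have := H (rshift _ i) I; rewrite (unsplitK (inr i)).
- by move=> _ [n [lo [hi [U [g o mU ->]]]]]; exact: mI.
- move=> _ [n [lo [hi [U [g o mU ->]]]]].
  (* the boxes may overlap: refine them to disjoint cells, whose joint cylinder
     sets form a pi-system, and recover the increments as sums over cells *)
  have [m [lo' [hi' [g' tI o' sum_of]]]] := common_refinement B g o.
  pose H : set (set Omega) := [set A | exists U' : 'I_m -> set R,
    (forall i, measurable (U' i)) /\ A = @incrI m lo' hi' U'].
  apply: (@independent_sigma_algebra _ _ _ P H) => //.
  + exists (fun=> setT); split=> //.
    by apply/seteqP; split.
  + move=> _ _ [U1 [m1 ->]] [U2 [m2 ->]]; exists (fun i => U1 i `&` U2 i).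
    split; first by move=> i; exact: measurableI.
    apply/seteqP; split=> [om [/= h1 h2] i _|om /= h1].
      by split; [exact: h1|exact: h2].
    by split=> i _; have [] := h1 i I.
  + by move=> _ [U1 [m1 ->]]; exact: mI.
  + move=> _ [U1 [m1 ->]].
    exact: (disjoint_increments_independent hB).
  + have cell k : measurable_wrt <<s H >> (sheet_incr B (lo' k) (hi' k)).
      move=> W mW; apply: sub_sigma_algebra.
      exists (fun j => if j == k then W else setT).
      split; first by move=> j; case: ifP.
      apply/seteqP; split=> [om /= omW j _|om /= /(_ k I)/=].
        by case: eqP => // ->.
      by rewrite eqxx.
    have incrH i : measurable_wrt <<s H >> (sheet_incr B (lo i) (hi i)).
      have [r rE] := sum_of i.
      have -> : sheet_incr B (lo i) (hi i) =
          fun om => \sum_(k <- r) sheet_incr B (lo' k) (hi' k) om.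
        by apply/funext => om; exact: rE.
      exact: measurable_wrt_sum.
    apply: (@fin_bigcap_measurable _ (g_sigma_algebraType H)) => // i _.
    exact: incrH.
- move: sA; rewrite /off_sigma; apply: sub_sigma_algebra2.
  move=> _ [lo [hi [U [g o mU ->]]]].
  exists 1%N, (fun=> lo), (fun=> hi), (fun=> U); split=> //.
  by apply/seteqP; split=> [om /= h1 i _|om /= /(_ ord0 I)].
Qed.

Lemma off_sigma_sub l h : off_sigma B l h `<=` measurable.
Proof.
apply: smallest_sub; first exact: sigma_algebra_measurable.
move=> _ [lo [hi [U [g _ mU ->]]]]; exact: measurable_preimage_incr.
Qed.

Lemma off_sigma_measurable l h (X : Omega -> R) :
  measurable_wrt (off_sigma B l h) X -> measurable_fun setT X.
Proof.
by move=> hX _ U mU; rewrite setTI; apply: off_sigma_sub; exact: hX.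
Qed.

Lemma independent_rv_off_sigma l h (X : Omega -> R) : good_box l h ->
  measurable_wrt (off_sigma B l h) X -> independent_rv P X (sheet_incr B l h).
Proof.
by move=> g hX U V mU mV; apply: independent_off_sigma => //; exact: hX.
Qed.

Lemma off_sigma_incr l h lo hi : good_box lo hi ->
  box lo hi `&` box l h = set0 ->
  measurable_wrt (off_sigma B l h) (sheet_incr B lo hi).
Proof. by move=> g o U mU; apply: sub_sigma_algebra; exists lo, hi, U. Qed.

Lemma sheet_as_incr z : ple (0, 0) z -> B z = sheet_incr B (0, 0) z.
Proof.
move=> z0; case: hB => _ B0 _ _ _; apply/funext => om.
have /andP[z1 z2] := z0; rewrite /= in z1 z2.
rewrite /sheet_incr /= (B0 (0, z.2)) ?(B0 (z.1, 0)) ?(B0 (0, 0)) ?subr0 ?addr0//=;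
  by rewrite ?eqxx ?orbT// /ple/= ?lexx ?z1 ?z2.
Qed.

(** [B w] is the increment over the box from the origin to [w], which lies in
    [rect z] when [w] does. *)
Lemma sheet_filtration_off z l h : box (0, 0) z `&` box l h = set0 ->
  sheet_filtration B z `<=` off_sigma B l h.
Proof.
move=> zlh; apply: sub_sigma_algebra2 => _ [w [U [/andP[w0 wz] mU ->]]].
exists (0, 0), w, U; split => //.
- by rewrite /good_box w0 /ple/= lexx.
- rewrite -subset0 -zlh; apply: setSI => -[a b] /= /andP[/andP[a0 aw] /andP[b0 bw]].
  move: wz => /andP[w1 w2].
  by rewrite /box/= a0 b0 (le_trans aw w1) (le_trans bw w2).
- by rewrite sheet_as_incr.
Qed.

(** Independence together with the zero mean of the increment. *)
Lemma incr_orthogonal l h (X : Omega -> R) : good_box l h ->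
  measurable_wrt (off_sigma B l h) X -> P.-integrable setT (EFin \o X) ->
  P.-integrable setT (EFin \o (fun om => X om * sheet_incr B l h om)) /\
  \int[P]_om (X om * sheet_incr B l h om) = 0.
Proof.
move=> g hX iX; have mX := off_sigma_measurable hX.
have mD := measurable_sheet_incr hB g.
have ind := independent_rv_off_sigma g hX.
have iD := prob_L2_L1 (sheet_incr_L2 hB g).
split; first exact: independent_integrableM.
by rewrite independent_RintegralM// sheet_incr_mean// mulr0.
Qed.

(** Needed for the double integrals, whose pieces are products of two
    increments: independence keeps such products square integrable. *)
Lemma incr_L2M l h (X : Omega -> R) : good_box l h ->
  measurable_wrt (off_sigma B l h) X -> square_integrable P setT X ->
  square_integrable P setT (fun om => X om * sheet_incr B l h om).
Proof.
move=> g hX L2X; apply: independent_L2M => //.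
  exact: independent_rv_off_sigma.
exact: sheet_incr_L2.
Qed.

End off_sigma.

(** * Stochastic integrals are square integrable martingales *)
Section martingale.
Context d (Omega : measurableType d) (R : realType) (P : probability Omega R).
Variable B : R * R -> Omega -> R.
Hypothesis hB : brownian_sheet P B.
Implicit Types lo hi z w l h : R * R.
Local Notation L1 X := (P.-integrable setT (EFin \o X)).
Local Notation L2 X := (square_integrable P setT X).

Lemma ple_trans z w l : ple z w -> ple w l -> ple z l.
Proof.
by rewrite /ple => /andP[a b] /andP[a' b']; rewrite (le_trans a a') (le_trans b b').
Qed.

Lemma pmin_idl z w : ple z w -> pmin z w = z.
Proof.
by case: z => a b /andP[/= h1 h2]; rewrite /pmin/= (min_idPl h1) (min_idPl h2).
Qed.

Lemma good_box_pmin lo hi z : ple (0, 0) z -> good_box lo hi ->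
  good_box (pmin lo z) (pmin hi z).
Proof.
move=> /andP[/= z1 z2] /good_boxP[l1 l2 h1 h2]; apply/good_boxP.
by split; rewrite /= ?le_min ?l1 ?l2 ?z1 ?z2 ?ge_min ?h1 ?h2 ?lexx ?orbT.
Qed.

Lemma box_pmin lo hi z : box (pmin lo z) (pmin hi z) `<=` box lo hi.
Proof.
move=> [a b]; rewrite /box /= => /andP[].
rewrite !le_min !gt_min => /andP[a1 /andP[a2 a3]] /andP[b1 /andP[b2 b3]].
rewrite a2 b2; move: a1 b1.
by rewrite !ltNge a3 b3 !orbF => -> ->.
Qed.

(** The part of a box outside [rect z] splits into a box to the right of [z]
    and a box to its left but above it, and increments are additive. *)
Lemma sheet_incr_outside lo hi z : ple (0, 0) z -> good_box lo hi ->
  exists D1 D2 : (R * R) * (R * R),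
    [/\ good_box D1.1 D1.2 /\ good_box D2.1 D2.2,
        box D1.1 D1.2 `<=` box lo hi `\` box (0, 0) z,
        box D2.1 D2.2 `<=` box lo hi `\` box (0, 0) z
      & forall om, sheet_incr B lo hi om =
          sheet_incr B (pmin lo z) (pmin hi z) om +
          (sheet_incr B D1.1 D1.2 om + sheet_incr B D2.1 D2.2 om)].
Proof.
move=> /andP[/= z1 z2] /good_boxP[l1 l2 h1 h2].
exists ((Num.max lo.1 z.1, lo.2), (Num.max hi.1 z.1, hi.2)).
exists ((Num.min lo.1 z.1, Num.max lo.2 z.2), (Num.min hi.1 z.1, Num.max hi.2 z.2)).
split=> /=.
- split; apply/good_boxP; split=> //=.
  + by rewrite le_max l1.
  + by rewrite ge_max !le_max h1 lexx orbT.
  + by rewrite le_min l1.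
  + by rewrite le_max l2.
  + by rewrite le_min !ge_min h1 lexx orbT.
  + by rewrite ge_max !le_max h2 lexx orbT.
- move=> [a b] /=; rewrite /box/= => /andP[].
  rewrite gt_max le_max => /andP[/andP[a1 a2] a3] /andP[b1 b2].
  rewrite a1 b1 b2 andbT; split.
    by move: a3; rewrite leNgt (leNgt a z.1) a2 orbF -leNgt => ->.
  by rewrite (leNgt a) a2 andbF.
- move=> [a b] /=; rewrite /box/= => /andP[].
  rewrite gt_max gt_min !le_max !le_min.
  move=> /andP[a1 /andP[a2 a3]] /andP[/andP[b1 b2] b3].
  rewrite a2 b1 andbT; split.
    move: a1 b3; rewrite (leNgt b z.2) b2 orbF => a1 ->.
    by move: a1; rewrite (ltNge z.1) a3 orbF => ->.
  by rewrite (leNgt b) b2 !andbF.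
- move=> om; rewrite /sheet_incr /pmin/= [hi in B hi]surjective_pairing.
  rewrite [lo in _ + B lo om = _]surjective_pairing.
  by case: (leP lo.1 z.1) => _; case: (leP hi.1 z.1) => _;
     case: (leP lo.2 z.2) => _; case: (leP hi.2 z.2) => _; ring.
Qed.

(** The common source of all martingale properties: only the part of the box
    inside [rect z] correlates with what is independent of the two boxes that
    make up the part outside. *)
Lemma outside_orthogonal lo hi z (X : Omega -> R) :
  ple (0, 0) z -> good_box lo hi -> L1 X ->
  (forall l h, box l h `<=` box lo hi `\` box (0, 0) z ->
     measurable_wrt (off_sigma B l h) X) ->
  L1 (fun om => X om * sheet_incr B (pmin lo z) (pmin hi z) om) ->
  \int[P]_om (X om * sheet_incr B lo hi om) =
  \int[P]_om (X om * sheet_incr B (pmin lo z) (pmin hi z) om).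
Proof.
move=> z0 g iX offX i0.
have [[l1 h1] [[l2 h2] [/= [g1 g2] s1 s2 E]]] := sheet_incr_outside z0 g.
have [i1 e1] := incr_orthogonal hB g1 (offX _ _ s1) iX.
have [i2 e2] := incr_orthogonal hB g2 (offX _ _ s2) iX.
rewrite (@eq_Rintegral _ _ _ _ _ (fun om =>
  X om * sheet_incr B (pmin lo z) (pmin hi z) om +
  (X om * sheet_incr B l1 h1 om + X om * sheet_incr B l2 h2 om))).
  by rewrite RintegralD//; [rewrite RintegralD// e1 e2 !addr0|exact: L1D].
by move=> om _; rewrite E !mulrDr.
Qed.

Lemma sheet_filtration_measurable z (X : Omega -> R) :
  measurable_wrt (sheet_filtration B z) X -> measurable_fun setT X.
Proof.
move=> h; apply: (measurable_wrt_ambient _ h).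
move=> _ [w [U [/andP[w0 _] mU ->]]].
by rewrite -[X in measurable X]setTI; exact: (sheet_measurable hB w0).
Qed.

Lemma off_of_filtration lo hi z l h (X : Omega -> R) :
  box l h `<=` box lo hi `\` box (0, 0) z ->
  measurable_wrt (sheet_filtration B z) X -> measurable_wrt (off_sigma B l h) X.
Proof.
move=> s; apply: measurable_wrt_sub; apply: (sheet_filtration_off hB).
by rewrite -subset0 => w [w0 /s []].
Qed.

Variables (Z : R * R).
Hypothesis Z0 : ple (0, 0) Z.

Section sheet_integral.

Lemma sheet_piece_L2 (e : sheet_piece R Omega) z : ple (0, 0) z ->
  sheet_piece_ok B Z e ->
  L2 (fun om => sp_coef e om * sheet_incr B (pmin (sp_lo e) z) (pmin (sp_hi e) z) om).
Proof.
move=> z0 [/and3P[l0 lh hZ] mc [C cC]].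
apply: (@L2_bounded_mul _ _ _ _ _ measurableT _ _ C).
- exact: (sheet_filtration_measurable mc).
- by [].
- by apply: (sheet_incr_L2 hB); apply: good_box_pmin => //; rewrite /good_box l0.
Qed.

(** The coefficient, known at [sp_lo e], and [phi], known at [z], are both
    independent of the increments over boxes inside the piece and outside
    [rect z]. *)
Lemma sheet_piece_martingale (e : sheet_piece R Omega) z (phi : Omega -> R) :
  ple (0, 0) z ->
  sheet_piece_ok B Z e -> measurable_wrt (sheet_filtration B z) phi -> L2 phi ->
  \int[P]_om (phi om * (sp_coef e om *
    sheet_incr B (pmin (sp_lo e) Z) (pmin (sp_hi e) Z) om)) =
  \int[P]_om (phi om * (sp_coef e om *
    sheet_incr B (pmin (sp_lo e) z) (pmin (sp_hi e) z) om)).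
Proof.
move=> z0 eok mphi L2phi; have [/and3P[l0 lh hZ] mc [C cC]] := eok.
rewrite (pmin_idl hZ) (pmin_idl (ple_trans lh hZ)).
have g : good_box (sp_lo e) (sp_hi e) by rewrite /good_box l0.
have L2X : L2 (fun om => sp_coef e om * phi om).
  by apply: (L2_bounded_mul measurableT _ _ L2phi) => //;
    exact: (sheet_filtration_measurable mc).
under eq_Rintegral do rewrite mulrCA mulrA.
under [RHS]eq_Rintegral do rewrite mulrCA mulrA.
apply: outside_orthogonal => //.
- exact: prob_L2_L1.
- move=> l h s; apply: measurable_wrtM; last exact: (off_of_filtration s).
  apply: measurable_wrt_sub mc; apply: (sheet_filtration_off hB).
  rewrite -subset0 => -[a b] [] /andP[/andP[_ a2] _] /s [/andP[/andP[a3 _] _] _].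
  by move: (lt_le_trans a3 a2); rewrite ltxx.
- apply: L2M => //.
  by apply: (sheet_incr_L2 hB); exact: good_box_pmin.
Qed.

Lemma sheet_integral_L2 q I z : is_sheet_integral P B Z q I -> rect Z z -> L2 (I z).
Proof.
move=> [s [sok _ lim]] rz; have [mI cI] := lim z rz; have /andP[z0 _] := rz.
apply: (l2_cvg_L2 measurableT mI _ cI) => n; rewrite /sheet_simple_int.
under [X in L2 X]eq_fun do rewrite big_tnth.
by apply: L2_sum => // i; apply: sheet_piece_L2 => //; exact: sok.
Qed.

Lemma rect_refl : rect Z Z.
Proof. by rewrite /rect /= Z0 /ple !lexx. Qed.

Lemma sheet_integral_martingale q I z (phi : Omega -> R) :
  is_sheet_integral P B Z q I -> rect Z z ->
  measurable_wrt (sheet_filtration B z) phi -> L2 phi ->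
  \int[P]_om (phi om * I Z om) = \int[P]_om (phi om * I z om).
Proof.
move=> hI rz mphi L2phi; have := hI => -[s [sok _ lim]].
have /andP[z0 _] := rz.
have L2s w n : rect Z w -> L2 (sheet_simple_int B (s n) w).
  move=> /andP[w0 _]; rewrite /sheet_simple_int.
  under [X in L2 X]eq_fun do rewrite big_tnth.
  by apply: L2_sum => // i; apply: sheet_piece_L2 => //; exact: sok.
have cv w : rect Z w ->
    (fun n => \int[P]_om (phi om * sheet_simple_int B (s n) w om)) @ \oo -->
    \int[P]_om (phi om * I w om).
  move=> rw; apply: L2_cvg_mul => //.
  - by move=> n; exact: L2s.
  - exact: (sheet_integral_L2 hI).
  - by have [] := lim w rw.
have cZ := cv _ rect_refl; have cz := cv _ rz.
suff eqn : (fun n => \int[P]_om (phi om * sheet_simple_int B (s n) Z om)) =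
    (fun n => \int[P]_om (phi om * sheet_simple_int B (s n) z om)).
  by rewrite eqn in cZ; exact: (cvg_unique _ cZ cz).
apply/funext => n; rewrite /sheet_simple_int.
have E w : rect Z w -> \int[P]_om (phi om * \sum_(e <- s n) sp_coef e om *
     sheet_incr B (pmin (sp_lo e) w) (pmin (sp_hi e) w) om) =
  \sum_(i < size (s n)) \int[P]_om (phi om *
     (let e := tnth (in_tuple (s n)) i in sp_coef e om *
     sheet_incr B (pmin (sp_lo e) w) (pmin (sp_hi e) w) om)).
  move=> /andP[w0 _]; under eq_Rintegral do rewrite big_tnth mulr_sumr.
  rewrite Rintegral_sum// => i; apply: L2M => //.
  by apply: sheet_piece_L2 => //; exact: sok.
rewrite !E//; last exact: rect_refl.
by apply: eq_bigr => i _; apply: sheet_piece_martingale => //; exact: sok.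
Qed.

End sheet_integral.

Section wz_integral.

(** The two boxes of a piece of a double integral are separated by the
    relation they must satisfy, so their increments are independent. *)
Lemma wz_boxes_disjoint (e : wz_piece R Omega) : wz_piece_ok B Z e ->
  box (wp_lo e) (wp_hi e) `&` box (wp_lo' e) (wp_hi' e) = set0.
Proof.
move=> [_ _ /andP[h1 _] _ _]; rewrite -subset0.
move=> [a b] [] /andP[/andP[_ a1] _] /andP[/andP[a2 _] _].
by have := lt_le_trans a2 (le_trans a1 h1); rewrite ltxx.
Qed.

Lemma wz_piece_L2 (e : wz_piece R Omega) z : ple (0, 0) z ->
  wz_piece_ok B Z e ->
  L2 (fun om => wp_coef e om * sheet_incr B (pmin (wp_lo e) z) (pmin (wp_hi e) z) om
       * sheet_incr B (pmin (wp_lo' e) z) (pmin (wp_hi' e) z) om).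
Proof.
move=> z0 eok; have dj := wz_boxes_disjoint eok.
have := eok => -[/and3P[l0 lh hZ] /and3P[l0' lh' hZ'] _ mc [C cC]].
have g : good_box (pmin (wp_lo e) z) (pmin (wp_hi e) z).
  by apply: good_box_pmin => //; rewrite /good_box l0.
have g' : good_box (pmin (wp_lo' e) z) (pmin (wp_hi' e) z).
  by apply: good_box_pmin => //; rewrite /good_box l0'.
under [X in L2 X]eq_fun do rewrite -mulrA.
apply: (@L2_bounded_mul _ _ _ _ _ measurableT _ _ C) => //.
  exact: (sheet_filtration_measurable mc).
apply: (incr_L2M hB g'); last exact: (sheet_incr_L2 hB).
apply: off_sigma_incr => //; rewrite -subset0 -dj.
by apply: setISS; exact: box_pmin.
Qed.

(** The orthogonality is applied to one increment at a time, the other one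
    being part of the factor that is independent of it. *)
Lemma wz_piece_martingale (e : wz_piece R Omega) z (phi : Omega -> R) :
  ple (0, 0) z ->
  wz_piece_ok B Z e -> measurable_wrt (sheet_filtration B z) phi -> L2 phi ->
  \int[P]_om (phi om * (wp_coef e om *
     sheet_incr B (pmin (wp_lo e) Z) (pmin (wp_hi e) Z) om *
     sheet_incr B (pmin (wp_lo' e) Z) (pmin (wp_hi' e) Z) om)) =
  \int[P]_om (phi om * (wp_coef e om *
     sheet_incr B (pmin (wp_lo e) z) (pmin (wp_hi e) z) om *
     sheet_incr B (pmin (wp_lo' e) z) (pmin (wp_hi' e) z) om)).
Proof.
move=> z0 eok mphi L2phi; have dj := wz_boxes_disjoint eok.
have := eok => -[/and3P[l0 lh hZ] /and3P[l0' lh' hZ'] /andP[h1 h2] mc [C cC]].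
rewrite (pmin_idl hZ) (pmin_idl (ple_trans lh hZ)).
rewrite (pmin_idl hZ') (pmin_idl (ple_trans lh' hZ')).
have g : good_box (wp_lo e) (wp_hi e) by rewrite /good_box l0.
have g' : good_box (wp_lo' e) (wp_hi' e) by rewrite /good_box l0'.
have gz := good_box_pmin z0 g; have gz' := good_box_pmin z0 g'.
have L2X : L2 (fun om => wp_coef e om * phi om).
  by apply: (L2_bounded_mul measurableT _ _ L2phi) => //;
    exact: (sheet_filtration_measurable mc).
have offX l h : (box l h `<=` box (wp_lo e) (wp_hi e) `\` box (0, 0) z) \/
    (box l h `<=` box (wp_lo' e) (wp_hi' e) `\` box (0, 0) z) ->
    measurable_wrt (off_sigma B l h) (fun om => wp_coef e om * phi om).
  move=> s; apply: measurable_wrtM; last first.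
    by case: s => s; exact: (off_of_filtration s).
  apply: measurable_wrt_sub mc; apply: (sheet_filtration_off hB).
  rewrite -subset0 => -[a b] [] /andP[/andP[_ a2] /andP[_ b2]].
  move: a2 b2; rewrite /pmax /= !le_max => a2 b2.
  have /andP[/= k1 k2] := lh; have /andP[/= k1' k2'] := lh'.
  case: s => s /s [/andP[/= /andP[a3 a4] /andP[b3 b4]] _].
    move: b2; rewrite !leNgt b3/= (le_lt_trans (le_trans k2' h2) b3)//.
  by move: a2; rewrite !leNgt a3/= (le_lt_trans (le_trans k1 h1) a3).
transitivity (\int[P]_om (wp_coef e om * phi om *
    sheet_incr B (wp_lo' e) (wp_hi' e) om *
    sheet_incr B (pmin (wp_lo e) z) (pmin (wp_hi e) z) om)).
  rewrite (@eq_Rintegral _ _ _ _ _ (fun om => wp_coef e om * phi om *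
    sheet_incr B (wp_lo' e) (wp_hi' e) om * sheet_incr B (wp_lo e) (wp_hi e) om));
    last by move=> om _; ring.
  apply: outside_orthogonal => //.
  - by apply: L2M => //; exact: (sheet_incr_L2 hB).
  - move=> l h s; apply: measurable_wrtM; first by apply: offX; left.
    apply: off_sigma_incr => //; rewrite -subset0 setIC -dj.
    by apply: setSI => w /s [].
  - under [X in L1 X]eq_fun do rewrite -mulrA.
    apply: L2M => //.
    apply: (incr_L2M hB gz); last exact: (sheet_incr_L2 hB).
    apply: off_sigma_incr => //; rewrite -subset0 setIC -dj.
    by apply: setSI; exact: box_pmin.
rewrite (@eq_Rintegral _ _ _ _ _ (fun om => wp_coef e om * phi om *
  sheet_incr B (pmin (wp_lo e) z) (pmin (wp_hi e) z) om *
  sheet_incr B (wp_lo' e) (wp_hi' e) om)); last by move=> om _; ring.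
rewrite [RHS](@eq_Rintegral _ _ _ _ _ (fun om => wp_coef e om * phi om *
  sheet_incr B (pmin (wp_lo e) z) (pmin (wp_hi e) z) om *
  sheet_incr B (pmin (wp_lo' e) z) (pmin (wp_hi' e) z) om));
  last by move=> om _; ring.
apply: outside_orthogonal => //.
- by apply: L2M => //; exact: (sheet_incr_L2 hB).
- move=> l h s; apply: measurable_wrtM; first by apply: offX; right.
  apply: off_sigma_incr => //; rewrite -subset0 -dj.
  by apply: setISS; [exact: box_pmin|move=> w /s []].
- under [X in L1 X]eq_fun do rewrite -mulrA.
  apply: L2M => //.
  apply: (incr_L2M hB gz'); last exact: (sheet_incr_L2 hB).
  apply: off_sigma_incr => //; rewrite -subset0 -dj.
  by apply: setISS; exact: box_pmin.
Qed.

Lemma wz_simple_L2 (s : nat -> seq (wz_piece R Omega)) n z :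
  (forall n (i : 'I_(size (s n))), wz_piece_ok B Z (tnth (in_tuple (s n)) i)) ->
  ple (0, 0) z -> L2 (wz_simple_int B (s n) z).
Proof.
move=> sok z0; rewrite /wz_simple_int.
under [X in L2 X]eq_fun do rewrite big_tnth.
by apply: L2_sum => // i; apply: wz_piece_L2 => //; exact: sok.
Qed.

Lemma wz_integral_L2 r M z : is_wz_integral P B Z r M -> rect Z z -> L2 (M z).
Proof.
move=> [s [sok _ lim]] rz; have [mI cI] := lim z rz; have /andP[z0 _] := rz.
by apply: (l2_cvg_L2 measurableT mI _ cI) => n; exact: wz_simple_L2.
Qed.

Lemma wz_integral_martingale r M z (phi : Omega -> R) :
  is_wz_integral P B Z r M -> rect Z z ->
  measurable_wrt (sheet_filtration B z) phi -> L2 phi ->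
  \int[P]_om (phi om * M Z om) = \int[P]_om (phi om * M z om).
Proof.
move=> hM rz mphi L2phi; have := hM => -[s [sok _ lim]].
have /andP[z0 _] := rz.
have cv w : rect Z w ->
    (fun n => \int[P]_om (phi om * wz_simple_int B (s n) w om)) @ \oo -->
    \int[P]_om (phi om * M w om).
  move=> rw; have /andP[w0 _] := rw; apply: L2_cvg_mul => //.
  - by move=> n; exact: wz_simple_L2.
  - exact: (wz_integral_L2 hM).
  - by have [] := lim w rw.
have cZ := cv _ rect_refl; have cz := cv _ rz.
suff eqn : (fun n => \int[P]_om (phi om * wz_simple_int B (s n) Z om)) =
    (fun n => \int[P]_om (phi om * wz_simple_int B (s n) z om)).
  by rewrite eqn in cZ; exact: (cvg_unique _ cZ cz).
apply/funext => n; rewrite /wz_simple_int.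
have E w : ple (0, 0) w -> \int[P]_om (phi om * \sum_(e <- s n) wp_coef e om *
     sheet_incr B (pmin (wp_lo e) w) (pmin (wp_hi e) w) om *
     sheet_incr B (pmin (wp_lo' e) w) (pmin (wp_hi' e) w) om) =
  \sum_(i < size (s n)) \int[P]_om (phi om *
     (let e := tnth (in_tuple (s n)) i in wp_coef e om *
     sheet_incr B (pmin (wp_lo e) w) (pmin (wp_hi e) w) om *
     sheet_incr B (pmin (wp_lo' e) w) (pmin (wp_hi' e) w) om)).
  move=> w0; under eq_Rintegral do rewrite big_tnth mulr_sumr.
  rewrite Rintegral_sum// => i; apply: L2M => //.
  by apply: wz_piece_L2 => //; exact: sok.
rewrite !E//.
by apply: eq_bigr => i _; apply: wz_piece_martingale => //; exact: sok.
Qed.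

End wz_integral.

End martingale.

(** * Fubini on A x Omega *)
(* The fields of interest are defined on the product of a set with all of
   Omega, whereas the product measure theorems are about whole spaces; extending
   by zero reduces the former to the latter. *)
Section fubini_on_cylinder.
Context d1 d2 (T1 : measurableType d1) (T2 : measurableType d2) (R : realType).
Variables (m1 : {sigma_finite_measure set T1 -> \bar R})
  (m2 : {sigma_finite_measure set T2 -> \bar R}).
Variables (A : set T1).
Hypothesis mA : measurable A.
Implicit Types f g : T1 -> T2 -> R.
Local Notation D := (A `*` @setT T2).
Local Notation mu := (sfprod m1 m2).
Local Notation unc f := (fun w : T1 * T2 => f w.1 w.2).

Lemma measurable_cylinder : measurable D.
Proof. exact: measurableX. Qed.

Let patch f : (T1 * T2)%type -> \bar R :=
  (fun w : T1 * T2 => (f w.1 w.2)%:E : \bar R) \_ D.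

Let patchE' f x y : patch f (x, y) = ((fun x => (f x y)%:E : \bar R) \_ A) x.
Proof.
rewrite /patch !patchE; congr (if _ then _ else _).
by apply/idP/idP; rewrite !inE => //; case.
Qed.

Let patchA f x y : x \in A -> patch f (x, y) = (f x y)%:E.
Proof. by move=> xA; rewrite patchE' patchE xA. Qed.

Let patchNA f x y : x \notin A -> patch f (x, y) = 0%E.
Proof. by move=> /negbTE xA; rewrite patchE' patchE xA. Qed.

Let measurable_patch f : measurable_fun D (unc f) ->
  measurable_fun setT (patch f).
Proof.
move=> mf; apply/(measurable_restrictT _ measurable_cylinder).
exact/measurable_EFinP.
Qed.

Lemma measurable_cylinder2 f y : measurable_fun D (unc f) ->
  measurable_fun A (fun x => f x y).
Proof.
move=> mf; apply: (measurable_comp measurable_cylinder _ mf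
  (f := fun w => f w.1 w.2) (g := fun x => (x, y))).
  by move=> _ [x Ax <-].
by apply: measurable_funTS; exact: pair2_measurable.
Qed.

Lemma measurable_cylinder1 f x : A x -> measurable_fun D (unc f) ->
  measurable_fun setT (f x).
Proof.
move=> Ax mf; apply: (measurable_comp measurable_cylinder _ mf
  (f := fun w => f w.1 w.2) (g := fun y => (x, y))).
  by move=> _ [y _ <-].
exact: pair1_measurable.
Qed.

Lemma tonelli_cylinder2 f : measurable_fun D (unc f) ->
  (forall x y, 0 <= f x y) ->
  (\int[mu]_(w in D) (f w.1 w.2)%:E =
   \int[m2]_y \int[m1]_(x in A) (f x y)%:E)%E.
Proof.
move=> mf f0; rewrite integral_mkcond.
have p0 w : (0 <= patch f w)%E by rewrite /patch patchE; case: ifP; rewrite ?lee_fin.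
rewrite (fubini_tonelli2 (patch f) (measurable_patch mf) p0).
apply: eq_integral => y _; rewrite /fubini_G [RHS]integral_mkcond.
by apply: eq_integral => x _; rewrite patchE'.
Qed.

Lemma measurable_tonelli_cylinder2 f : measurable_fun D (unc f) ->
  (forall x y, 0 <= f x y) ->
  measurable_fun setT (fun y => \int[m1]_(x in A) (f x y)%:E)%E.
Proof.
move=> mf f0.
have p0 w : (0 <= patch f w)%E by rewrite /patch patchE; case: ifP; rewrite ?lee_fin.
have := measurable_fun_fubini_tonelli_G (m1 := m1) (patch f) (measurable_patch mf) p0.
apply: eq_measurable_fun => y _; rewrite /fubini_G [RHS]integral_mkcond.
by apply: eq_integral => x _; rewrite patchE'.
Qed.

Lemma tonelli_cylinder1 f : measurable_fun D (unc f) ->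
  (forall x y, 0 <= f x y) ->
  (\int[mu]_(w in D) (f w.1 w.2)%:E =
   \int[m1]_(x in A) \int[m2]_y (f x y)%:E)%E.
Proof.
move=> mf f0; rewrite integral_mkcond.
have p0 w : (0 <= patch f w)%E by rewrite /patch patchE; case: ifP; rewrite ?lee_fin.
rewrite (fubini_tonelli1 (patch f) (measurable_patch mf) p0).
rewrite [RHS]integral_mkcond; apply: eq_integral => x _.
rewrite /fubini_F patchE; case: ifPn => xA.
  by apply: eq_integral => y _; rewrite patchA.
by rewrite integral0_eq// => y _; rewrite patchNA.
Qed.

Lemma measurable_tonelli_cylinder1 f : measurable_fun D (unc f) ->
  (forall x y, 0 <= f x y) ->
  measurable_fun A (fun x => \int[m2]_y (f x y)%:E)%E.
Proof.
move=> mf f0.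
have p0 w : (0 <= patch f w)%E by rewrite /patch patchE; case: ifP; rewrite ?lee_fin.
have := measurable_fun_fubini_tonelli_F (m2 := m2) (patch f) (measurable_patch mf) p0.
move=> /(measurable_funTS (D := A)).
apply: eq_measurable_fun => x xA; rewrite /fubini_F.
by apply: eq_integral => y _; rewrite patchA.
Qed.

Let integrable_patch f : mu.-integrable D (EFin \o unc f) ->
  (m1 \x m2)%E.-integrable setT (patch f).
Proof. by move=> /(integrable_mkcond _ measurable_cylinder). Qed.

Lemma ae_integrable_cylinder2 f : mu.-integrable D (EFin \o unc f) ->
  {ae m2, forall y, m1.-integrable A (EFin \o (f^~ y))}.
Proof.
move=> /integrable_patch /ae_integrable2; apply: filterS => y.
move=> h; apply/(integrable_mkcond _ mA); apply: eq_integrable h => // x _.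
Qed.

Lemma ae_integrable_cylinder1 f : mu.-integrable D (EFin \o unc f) ->
  {ae m1, forall x, A x -> m2.-integrable setT (EFin \o (f x))}.
Proof.
move=> /integrable_patch /ae_integrable1; apply: filterS => x h Ax.
by apply: eq_integrable h => // y _; rewrite patchA ?inE.
Qed.

Lemma fubini_cylinder2 f : mu.-integrable D (EFin \o unc f) ->
  m2.-integrable setT (EFin \o (fun y => \int[m1]_(x in A) f x y)) /\
  \int[mu]_(w in D) (f w.1 w.2) = \int[m2]_y \int[m1]_(x in A) f x y.
Proof.
move=> fi; have fip := integrable_patch fi.
have E y : fubini_G m1 (patch f) y = (\int[m1]_(x in A) (f x y)%:E)%E.
  rewrite /fubini_G [RHS]integral_mkcond.
  by apply: eq_integral => x _; rewrite patchE'.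
have aefin : {ae m2, forall y, setT y ->
    fubini_G m1 (patch f) y = (\int[m1]_(x in A) f x y)%:E}.
  move: (ae_integrable_cylinder2 fi); apply: filterS => y iy _.
  by rewrite E /Rintegral fineK//; apply: integrable_fin_num.
have mp : measurable_fun setT (patch f) := measurable_int _ fip.
have iG : m2.-integrable setT (fubini_G m1 (patch f)).
  apply/integrableP; split; first exact: (measurable_fubini_G fip).
  have := (integrable21ltyP m1 m2 mp).1 fip; apply: le_lt_trans.
  apply: ge0_le_integral => //.
  - by apply: measurableT_comp => //; exact: (measurable_fubini_G fip).
  - apply: (measurable_fun_fubini_tonelli_G (m1 := m1) (abse \o patch f)) => //=.
    exact: measurableT_comp.
  - by move=> y _; apply: le_abse_integral => //; exact: measurableT_comp.
have mG : measurable_fun setT (fun y => \int[m1]_(x in A) f x y).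
  rewrite /Rintegral; apply: measurableT_comp => //.
  apply: eq_measurable_fun (measurable_int _ iG) => y _.
  exact: E.
have iR : m2.-integrable setT (EFin \o (fun y => \int[m1]_(x in A) f x y)).
  apply/integrableP; split; first exact/measurable_EFinP.
  have /integrableP[_] := iG; congr (_ < _)%E.
  apply: ae_eq_integral => //.
  - by apply: measurableT_comp => //; exact: measurable_int iG.
  - by do 2 apply: measurableT_comp => //; exact/measurable_EFinP.
  - by apply: filterS aefin => y h /h /= ->.
split=> //; rewrite /Rintegral; congr fine.
rewrite integral_mkcond -/(patch f).
transitivity (\int[m2]_y fubini_G m1 (patch f) y)%E.
  by rewrite /fubini_G -(integral21_prod_meas1 fip).
apply: ae_eq_integral => //; first exact: measurable_int iG.
exact/measurable_EFinP.
Qed.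

Lemma fubini_cylinder1 f : mu.-integrable D (EFin \o unc f) ->
  m1.-integrable A (EFin \o (fun x => \int[m2]_y f x y)) /\
  \int[mu]_(w in D) (f w.1 w.2) = \int[m1]_(x in A) \int[m2]_y f x y.
Proof.
move=> fi; have fip := integrable_patch fi.
have E x : x \in A -> fubini_F m2 (patch f) x = (\int[m2]_y (f x y)%:E)%E.
  by move=> xA; apply: eq_integral => y _; rewrite patchA.
have aefin : {ae m1, forall x, A x ->
    fubini_F m2 (patch f) x = (\int[m2]_y f x y)%:E}.
  move: (ae_integrable_cylinder1 fi); apply: filterS => x iy Ax.
  by rewrite E ?inE// /Rintegral fineK//; apply: integrable_fin_num => //; exact: iy.
have iF : m1.-integrable A (fubini_F m2 (patch f)).
  by apply: (integrableS measurableT mA) => //; exact: integrable_fubini_F.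
have mF : measurable_fun A (fun x => \int[m2]_y f x y).
  rewrite /Rintegral; apply: (@measurableT_comp _ _ _ _ _ _ fine) => //.
  by apply: eq_measurable_fun (measurable_int _ iF) => x; exact: E.
have iR : m1.-integrable A (EFin \o (fun x => \int[m2]_y f x y)).
  apply/integrableP; split; first exact/measurable_EFinP.
  have /integrableP[_] := iF; congr (_ < _)%E.
  apply: ae_eq_integral => //.
  - by apply: measurableT_comp => //; exact: measurable_int iF.
  - by do 2 apply: measurableT_comp => //; exact/measurable_EFinP.
  - by apply: filterS aefin => y h /h /= ->.
split=> //; rewrite /Rintegral; congr fine.
rewrite integral_mkcond -/(patch f).
transitivity (\int[m1]_x fubini_F m2 (patch f) x)%E.
  by rewrite -(integral12_prod_meas1 fip).
transitivity (\int[m1]_(x in A) fubini_F m2 (patch f) x)%E.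
  rewrite [RHS]integral_mkcond; apply: eq_integral => x _.
  rewrite [RHS]patchE; case: ifPn => // xA.
  by rewrite /fubini_F integral0_eq// => y _; rewrite patchNA.
apply: ae_eq_integral => //; first exact: measurable_int iF.
exact/measurable_EFinP.
Qed.

(** Tonelli applied to the modulus of the difference. *)
Lemma ae_cylinder f g : measurable_fun D (unc f) -> measurable_fun D (unc g) ->
  (forall x, A x -> {ae m2, forall y, f x y = g x y}) ->
  {ae mu, forall w, A w.1 -> f w.1 w.2 = g w.1 w.2}.
Proof.
move=> mf mg h.
have mh : measurable_fun D (unc (fun x y => `|f x y - g x y|)).
  by apply: measurableT_comp => //; exact: measurable_funB.
have : (\int[mu]_(w in D) `| (f w.1 w.2 - g w.1 w.2)%:E | = 0)%E.
  rewrite [LHS](@tonelli_cylinder1 (fun x y => `|f x y - g x y|))//.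
  rewrite integral0_eq// => x Ax.
  rewrite (@ae_eq_integral _ _ _ _ _ (cst 0%E))//; first by rewrite integral0.
  - apply/measurable_EFinP; apply: (measurable_cylinder1 Ax (f := fun x y => `|f x y - g x y|)).
    exact: mh.
  - by apply: filterS (h x Ax) => y -> _; rewrite subrr normr0.
move/(ae_eq_integral_abs _ measurable_cylinder).
have mfg : measurable_fun D (fun w : T1 * T2 => (f w.1 w.2 - g w.1 w.2)%:E).
  by apply/measurable_EFinP; exact: measurable_funB.
move=> /(_ mfg); apply: filterS => w /= H Aw.
by have [/eqP] := H (conj Aw I); rewrite subr_eq0 => /eqP.
Qed.

(** Almost every section of a null set is null. *)
Lemma ae_cylinder_section (Q : T1 -> T2 -> Prop) :
  {ae mu, forall w, A w.1 -> Q w.1 w.2} ->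
  {ae m2, forall y, {ae m1, forall x, A x -> Q x y}}.
Proof.
move=> [N [mN N0 sN]].
have : (\int[m2]_y `|m1 (ysection N y)| = 0)%E.
  under eq_integral do rewrite gee0_abs ?measure_ge0//.
  rewrite -[RHS]N0; apply/esym.
  apply: (@product_measure_unique _ _ _ _ _ m1 m2 (m1 \x^ m2)%E) => // C E mC mE.
  exact: product_measure2E.
move/(ae_eq_integral_abs _ measurableT) => /(_ (measurable_fun_ysection m1 mN)).
apply: filterS => y /(_ I) H; exists (ysection N y); split => //.
  exact: measurable_ysection.
move=> x /= nQ; rewrite /ysection /= inE.
by apply: (sN (x, y)) => /= h; apply: nQ.
Qed.

End fubini_on_cylinder.

(** * Wiener isometry for step functions *)
Section isometry.
Context d (Omega : measurableType d) (R : realType) (P : probability Omega R).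
Variable B : R * R -> Omega -> R.
Hypothesis hB : brownian_sheet P B.
Implicit Types lo hi z w : R * R.
Local Notation L2 X := (square_integrable P setT X).

Lemma good_box0 z : ple (0, 0) z -> good_box (0, 0) z.
Proof. by move=> z0; rewrite /good_box z0 /ple/= lexx. Qed.

Lemma sheet_L2 z : ple (0, 0) z -> L2 (B z).
Proof.
move=> z0; rewrite (sheet_as_incr hB z0).
by apply: (sheet_incr_L2 hB); exact: good_box0.
Qed.

Lemma pmin_ge0 z w : ple (0, 0) z -> ple (0, 0) w -> ple (0, 0) (pmin z w).
Proof.
by rewrite /ple/= => /andP[a b] /andP[c e]; rewrite !le_min a b c e.
Qed.

Let covariance_pmin z w : ple (0, 0) z -> ple (0, 0) w ->
  \int[P]_om (B z om * B w om) = \int[P]_om (B z om * B (pmin w z) om).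
Proof.
move=> z0 w0; have g0 := good_box0 w0.
have z00 : pmin (0, 0) z = (0, 0) by exact: pmin_idl.
have m0 := pmin_ge0 w0 z0.
rewrite (sheet_as_incr hB w0) (sheet_as_incr hB m0) -{2}z00.
apply: (outside_orthogonal hB) => //.
- exact/prob_L2_L1/sheet_L2.
- move=> l h s; rewrite (sheet_as_incr hB z0).
  apply: off_sigma_incr; first exact: good_box0.
  by rewrite -subset0 => v [v0 /s []].
- rewrite z00 -(sheet_as_incr hB m0); apply: L2M => //; exact: sheet_L2.
Qed.

(** The sheet is a martingale, so [B w] may be replaced by its value at the
    infimum of [z] and [w], and then [B z] likewise. *)
Lemma sheet_covariance z w : ple (0, 0) z -> ple (0, 0) w ->
  \int[P]_om (B z om * B w om) = Num.min z.1 w.1 * Num.min z.2 w.2.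
Proof.
move=> z0 w0; rewrite covariance_pmin//.
set m := pmin w z; have m0 : ple (0, 0) m by exact: pmin_ge0.
have mz : pmin z m = m.
  by rewrite /m /pmin/=; congr pair; apply/min_idPr; rewrite ge_min lexx orbT.
under eq_Rintegral do rewrite mulrC.
rewrite covariance_pmin// mz.
under eq_Rintegral do rewrite -expr2.
rewrite (sheet_as_incr hB m0) /Rintegral (sheet_incr_sqr hB (good_box0 m0)).
by rewrite /area /= !subr0 (minC w.1) (minC w.2).
Qed.

Definition corners lo hi : seq (R * (R * R)) :=
  [:: (1, hi); (- 1, (lo.1, hi.2)); (- 1, (hi.1, lo.2)); (1, lo)].

Lemma sheet_incr_corners lo hi om :
  sheet_incr B lo hi om = \sum_(p <- corners lo hi) p.1 * B p.2 om.
Proof. by rewrite !big_cons big_nil /sheet_incr/=; ring. Qed.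

Lemma covariance_sums (s s' : seq (R * (R * R))) :
  all (fun p => ple (0, 0) p.2) s -> all (fun p => ple (0, 0) p.2) s' ->
  \int[P]_om ((\sum_(p <- s) p.1 * B p.2 om) * (\sum_(p <- s') p.1 * B p.2 om)) =
  \sum_(p <- s) \sum_(p' <- s')
    p.1 * p'.1 * (Num.min p.2.1 p'.2.1 * Num.min p.2.2 p'.2.2).
Proof.
move=> h h'.
have gn (t : seq (R * (R * R))) (i : 'I_(size t)) : all (fun p => ple (0, 0) p.2) t ->
    ple (0, 0) (tnth (in_tuple t) i).2.
  by move=> /allP; apply; exact: mem_tnth.
rewrite big_tnth; under [RHS]eq_bigr do rewrite big_tnth.
under eq_Rintegral.
  move=> om _; rewrite big_tnth [in X in _ * X]big_tnth mulr_suml.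
  under eq_bigr do rewrite mulr_sumr.
  over.
have i1 (i : 'I_(size s)) (j : 'I_(size s')) : P.-integrable setT (EFin \o (fun om =>
    (tnth (in_tuple s) i).1 * B (tnth (in_tuple s) i).2 om *
    ((tnth (in_tuple s') j).1 * B (tnth (in_tuple s') j).2 om))).
  by apply: L2M => //; apply: L2Z => //; apply: sheet_L2; exact: gn.
rewrite Rintegral_sum//; last by move=> i; apply: L1_sum => // j; exact: i1.
apply: eq_bigr => i _; rewrite Rintegral_sum//.
apply: eq_bigr => j _.
rewrite -sheet_covariance; [|exact: gn|exact: gn].
rewrite -RintegralZl//; last by apply: L2M => //; apply: sheet_L2; exact: gn.
by apply: eq_Rintegral => om _; ring.
Qed.

(** For a <= b and c <= e, the length of the intersection of the intervals
    (a, b] and (c, e], in the form in which the covariances of the corners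
    produce it. *)
Definition overlap (a b c e : R) :=
  Num.min b e - Num.min a e - Num.min b c + Num.min a c.

Lemma overlapE (a b c e : R) : a <= b -> c <= e ->
  overlap a b c e = Num.max 0 (Num.min b e - Num.max a c).
Proof.
move=> ab ce; rewrite /overlap.
by case: (leP b e) => h1; case: (leP a e) => h2; case: (leP b c) => h3;
   case: (leP a c) => h4; rewrite maxElt; case: ifP => h5; lra.
Qed.

(** Bilinearity over the four corners of each box; the sixteen covariances
    factor into the two overlaps. *)
Lemma sheet_incr_covariance lo hi lo' hi' :
  good_box lo hi -> good_box lo' hi' ->
  \int[P]_om (sheet_incr B lo hi om * sheet_incr B lo' hi' om) =
  overlap lo.1 hi.1 lo'.1 hi'.1 * overlap lo.2 hi.2 lo'.2 hi'.2.
Proof.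
move=> g g'.
have gc l h : good_box l h -> all (fun p => ple (0, 0) p.2) (corners l h).
  move=> /good_boxP[l1 l2 h1 h2]; have h1' := le_trans l1 h1.
  by have h2' := le_trans l2 h2; rewrite /= /ple/= l1 l2 h1' h2'.
under eq_Rintegral do rewrite !sheet_incr_corners.
rewrite covariance_sums ?gc// /corners !big_cons !big_nil /overlap/=.
ring.
Qed.

End isometry.

Section box_measure.
Variable R : realType.
Implicit Types lo hi : R * R.

Lemma boxE lo hi : box lo hi = `]lo.1, hi.1]%classic `*` `]lo.2, hi.2]%classic.
Proof.
by apply/seteqP; split=> -[a b]; rewrite /box /= !in_itv/= => /andP.
Qed.

Lemma measurable_box lo hi : measurable (box lo hi).
Proof. by rewrite boxE; exact: measurableX. Qed.

Lemma leb1_itv (a b : R) : leb1 `]a, b]%classic = (Num.max 0 (b - a))%:E.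
Proof.
rewrite /leb1 lebesgue_measure_itv/= lte_fin.
case: ltP => h; first by rewrite -EFinD max_r// subr_ge0 ltW.
by rewrite max_l// subr_le0.
Qed.

Lemma leb2_box lo hi :
  leb2 R (box lo hi) = (Num.max 0 (hi.1 - lo.1) * Num.max 0 (hi.2 - lo.2))%:E.
Proof.
rewrite boxE.
transitivity (leb1 `]lo.1, hi.1]%classic * leb1 `]lo.2, hi.2]%classic)%E.
  exact: product_measure1E.
by rewrite !leb1_itv -EFinM.
Qed.

Lemma box_setI lo hi lo' hi' :
  box lo hi `&` box lo' hi' = box (pmax lo lo') (pmin hi hi').
Proof.
apply/seteqP; split=> -[a b]; rewrite /box /pmax /pmin/= !gt_max !le_min.
  by move=> [/andP[/andP[-> ->] /andP[-> ->]] /andP[/andP[-> ->] /andP[-> ->]]].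
by move=> /andP[/andP[/andP[-> ->] /andP[-> ->]] /andP[/andP[-> ->] /andP[-> ->]]].
Qed.

Lemma leb2_box_setI lo hi lo' hi' : good_box lo hi -> good_box lo' hi' ->
  leb2 R (box lo hi `&` box lo' hi') =
  (overlap lo.1 hi.1 lo'.1 hi'.1 * overlap lo.2 hi.2 lo'.2 hi'.2)%:E.
Proof.
move=> /good_boxP[_ _ h1 h2] /good_boxP[_ _ h1' h2'].
by rewrite box_setI leb2_box !overlapE.
Qed.

End box_measure.

(** An entry [(a, (lo, hi))] stands for [a] times the indicator of the box
    from [lo] to [hi]. The boxes may overlap, so that differences of step
    functions are obtained by concatenation. *)
Definition step_fun (R : realType) (s : seq (R * ((R * R) * (R * R)))) (z : R * R) : R :=
  \sum_(e <- s) e.1 * \1_(box e.2.1 e.2.2) z.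

Definition step_int (R : realType) (Omega : Type) (B : R * R -> Omega -> R)
    (s : seq (R * ((R * R) * (R * R)))) (om : Omega) : R :=
  \sum_(e <- s) e.1 * sheet_incr B e.2.1 e.2.2 om.

Section step_isometry.
Context d (Omega : measurableType d) (R : realType) (P : probability Omega R).
Variable B : R * R -> Omega -> R.
Hypothesis hB : brownian_sheet P B.
Implicit Types s : seq (R * ((R * R) * (R * R))).

Definition good_step s := all (fun e => good_box e.2.1 e.2.2) s.

Let good_nth s (i : 'I_(size s)) : good_step s ->
  good_box (tnth (in_tuple s) i).2.1 (tnth (in_tuple s) i).2.2.
Proof. by move=> /allP; apply; exact: mem_tnth. Qed.

Lemma step_int_L2 s : good_step s -> square_integrable P setT (step_int B s).
Proof.
move=> g; rewrite /step_int; under [X in square_integrable _ _ X]eq_fun do rewrite big_tnth.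
apply: L2_sum => // i; apply: L2Z => //.
by apply: (sheet_incr_L2 hB); exact: good_nth.
Qed.

(** Both sides expand into the same double sum, because the covariance of two
    increments is the area of the intersection of their boxes. *)
Theorem step_isometry s : good_step s ->
  \int[P]_om (step_int B s om ^+ 2) = \int[leb2 R]_z (step_fun s z ^+ 2).
Proof.
move=> g.
have ind (i j : 'I_(size s)) : (leb2 R).-integrable setT (EFin \o (fun z =>
   (tnth (in_tuple s) i).1 * \1_(box (tnth (in_tuple s) i).2.1 (tnth (in_tuple s) i).2.2) z *
   ((tnth (in_tuple s) j).1 * \1_(box (tnth (in_tuple s) j).2.1 (tnth (in_tuple s) j).2.2) z))) /\
   \int[leb2 R]_z (
   (tnth (in_tuple s) i).1 * \1_(box (tnth (in_tuple s) i).2.1 (tnth (in_tuple s) i).2.2) z *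
   ((tnth (in_tuple s) j).1 * \1_(box (tnth (in_tuple s) j).2.1 (tnth (in_tuple s) j).2.2) z)) =
   (tnth (in_tuple s) i).1 * (tnth (in_tuple s) j).1 *
   (overlap (tnth (in_tuple s) i).2.1.1 (tnth (in_tuple s) i).2.2.1
            (tnth (in_tuple s) j).2.1.1 (tnth (in_tuple s) j).2.2.1 *
    overlap (tnth (in_tuple s) i).2.1.2 (tnth (in_tuple s) i).2.2.2
            (tnth (in_tuple s) j).2.1.2 (tnth (in_tuple s) j).2.2.2).
  have gi := good_nth i g; have gj := good_nth j g.
  move: (tnth _ i) (tnth _ j) gi gj => -[c [l h]] [c' [l' h']] /= gi gj.
  have E z : c * \1_(box l h) z * (c' * \1_(box l' h') z) =
     c * c' * \1_(box l h `&` box l' h') z :> R.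
    by rewrite !indicE in_setI -mulnb natrM; ring.
  have mI : measurable (box l h `&` box l' h').
    by apply: measurableI; exact: measurable_box.
  have lI := leb2_box_setI gi gj.
  have II : (\int[leb2 R]_z (\1_(box l h `&` box l' h') z)%:E =
     (overlap l.1 h.1 l'.1 h'.1 * overlap l.2 h.2 l'.2 h'.2)%:E)%E.
    by rewrite integral_indic// setIT; exact: lI.
  have i1 : (leb2 R).-integrable setT (EFin \o \1_(box l h `&` box l' h')).
    apply/integrableP; split; first exact/measurable_EFinP.
    under eq_integral do rewrite /= ger0_norm//.
    by rewrite [X in (X < _)%E]II ltry.
  split.
    apply: (eq_integrable _ (EFin \o (fun z => c * c' * \1_(box l h `&` box l' h') z))) => //.
      by move=> z _ /=; rewrite E.
    exact: L1Z.
  under eq_Rintegral do rewrite E.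
  rewrite RintegralZl//; congr (_ * _).
  by rewrite /Rintegral [X in fine X]II.
rewrite /step_int /step_fun.
transitivity (\sum_(i < size s) \sum_(j < size s)
   (tnth (in_tuple s) i).1 * (tnth (in_tuple s) j).1 *
   (overlap (tnth (in_tuple s) i).2.1.1 (tnth (in_tuple s) i).2.2.1
            (tnth (in_tuple s) j).2.1.1 (tnth (in_tuple s) j).2.2.1 *
    overlap (tnth (in_tuple s) i).2.1.2 (tnth (in_tuple s) i).2.2.2
            (tnth (in_tuple s) j).2.1.2 (tnth (in_tuple s) j).2.2.2)); last first.
  apply/esym; under eq_Rintegral.
    move=> z _; rewrite big_tnth expr2 mulr_suml.
    under eq_bigr do rewrite mulr_sumr.
    over.
  rewrite Rintegral_sum//; last by move=> i; apply: L1_sum => // j; have [] := ind i j.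
  apply: eq_bigr => i _; rewrite Rintegral_sum//; last by move=> j; have [] := ind i j.
  by apply: eq_bigr => j _; have [] := ind i j.
under eq_Rintegral.
  move=> om _; rewrite big_tnth expr2 mulr_suml.
  under eq_bigr do rewrite mulr_sumr.
  over.
have i1 (i j : 'I_(size s)) : P.-integrable setT (EFin \o (fun om =>
   (tnth (in_tuple s) i).1 * sheet_incr B (tnth (in_tuple s) i).2.1 (tnth (in_tuple s) i).2.2 om *
   ((tnth (in_tuple s) j).1 * sheet_incr B (tnth (in_tuple s) j).2.1 (tnth (in_tuple s) j).2.2 om))).
  by apply: L2M => //; apply: L2Z => //; apply: (sheet_incr_L2 hB); exact: good_nth.
rewrite Rintegral_sum//; last by move=> i; apply: L1_sum => // j; exact: i1.
apply: eq_bigr => i _; rewrite Rintegral_sum//.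
apply: eq_bigr => j _.
rewrite -(sheet_incr_covariance hB); [|exact: good_nth|exact: good_nth].
rewrite -RintegralZl//.
  by apply: eq_Rintegral => om _; ring.
by apply: L2M => //; apply: (sheet_incr_L2 hB); exact: good_nth.
Qed.

End step_isometry.

(** * Step approximation of a Lipschitz integrand *)
Section cells.
Variable R : realType.
Implicit Types (T a : R) (N i j : nat).

Definition cell_pt T N i : R := T * i%:R / N%:R.

Lemma cell_pt_le T N i j : 0 < T -> (i <= j)%N -> cell_pt T N i <= cell_pt T N j.
Proof.
move=> T0 ij; rewrite /cell_pt ler_wpM2r ?invr_ge0// ler_wpM2l ?ler_nat//.
exact: ltW.
Qed.

Lemma cell_ptS T N i : cell_pt T N i.+1 = cell_pt T N i + T / N%:R.
Proof. by rewrite /cell_pt -natr1 mulrDr mulr1 mulrDl. Qed.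

Lemma cell_pt0 T N : cell_pt T N 0 = 0.
Proof. by rewrite /cell_pt mulr0 mul0r. Qed.

Lemma cell_ptN T N : (0 < N)%N -> cell_pt T N N = T.
Proof. by move=> N0; rewrite /cell_pt mulfK// pnatr_eq0 -lt0n. Qed.

Lemma cell_pt_ge0 T N i : 0 < T -> 0 <= cell_pt T N i.
Proof. by move=> T0; rewrite -(cell_pt0 T N) cell_pt_le. Qed.

Lemma cell_exists T N a : 0 < T -> (0 < N)%N -> 0 < a <= T ->
  exists2 i, (i < N)%N & cell_pt T N i < a <= cell_pt T N i.+1.
Proof.
move=> T0 N0 /andP[a0 aT].
have ex : exists i, a <= cell_pt T N i by exists N; rewrite cell_ptN.
case: (ex_minnP ex) => -[|i] ai mn; first by move: ai; rewrite cell_pt0 leNgt a0.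
exists i; first by apply: mn; rewrite cell_ptN.
rewrite ai andbT ltNge; apply/negP => /mn.
by rewrite ltnn.
Qed.

Lemma cell_unique T N a i j : 0 < T ->
  cell_pt T N i < a <= cell_pt T N i.+1 ->
  cell_pt T N j < a <= cell_pt T N j.+1 -> i = j.
Proof.
move=> T0 /andP[i1 i2] /andP[j1 j2]; apply/eqP; rewrite eqn_leq.
apply/andP; split; rewrite leqNgt; apply/negP => ij.
  by have := lt_le_trans (le_lt_trans (cell_pt_le N T0 ij) i1) j2; rewrite ltxx.
by have := lt_le_trans (le_lt_trans (cell_pt_le N T0 ij) j1) i2; rewrite ltxx.
Qed.

Lemma sum_nat_single (N i : nat) (F : nat -> R) : (i < N)%N ->
  (forall j, (j < N)%N -> j != i -> F j = 0) -> \sum_(0 <= j < N) F j = F i.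
Proof.
move=> iN F0; rewrite big_mkord (bigD1 (Ordinal iN))//= big1 ?addr0// => j ji.
by apply: F0.
Qed.

End cells.

(** The value of [f] at the upper right corner is used on the whole cell. It is
    this corner that decides whether the cell lies in [rect z]; the discrete
    identity [gain_approx_identity] depends on this choice. *)
Section grid_step.
Variables (R : realType) (T X : R).
Hypotheses (T0 : 0 < T) (X0 : 0 < X).
Local Notation Z := (T, X).
Implicit Types (f : R * R -> R) (z w : R * R) (N i j : nat).

Definition corner N i j : R * R := (cell_pt T N i, cell_pt X N j).

Definition grid_step N f : seq (R * ((R * R) * (R * R))) :=
  [seq (f (corner N i.+1 j.+1), (corner N i j, corner N i.+1 j.+1)) |
     i <- index_iota 0 N, j <- index_iota 0 N].

Lemma big_grid_step N f (F : R * ((R * R) * (R * R)) -> R) :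
  \sum_(e <- grid_step N f) F e =
  \sum_(0 <= i < N) \sum_(0 <= j < N)
    F (f (corner N i.+1 j.+1), (corner N i j, corner N i.+1 j.+1)).
Proof. by rewrite /grid_step big_allpairs_dep. Qed.

Lemma corner_good N i j : good_box (corner N i j) (corner N i.+1 j.+1).
Proof. by apply/good_boxP; split => /=; rewrite ?cell_pt_ge0 ?cell_pt_le. Qed.

Lemma good_grid_step N f : good_step (grid_step N f).
Proof. by apply/allP => e /allpairsP[[i j] [_ _ ->]]; exact: corner_good. Qed.

Lemma corner_rect N i j : (0 < N)%N -> (i <= N)%N -> (j <= N)%N ->
  rect Z (corner N i j).
Proof.
move=> N0 iN jN; rewrite /rect/= /ple/= !cell_pt_ge0//=.
have h1 := cell_pt_le N T0 iN; have h2 := cell_pt_le N X0 jN.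
by rewrite cell_ptN// in h1; rewrite cell_ptN// in h2; rewrite h1.
Qed.

Lemma step_fun_grid N f z : (0 < N)%N -> box (0, 0) Z z ->
  exists i j, [/\ (i < N)%N, (j < N)%N,
    box (corner N i j) (corner N i.+1 j.+1) z
    & step_fun (grid_step N f) z = f (corner N i.+1 j.+1)].
Proof.
move=> N0 /andP[z1 z2].
have [i iN hi] := cell_exists T0 N0 z1; have [j jN hj] := cell_exists X0 N0 z2.
exists i, j; split => //; first by rewrite /box/= hi hj.
rewrite /step_fun big_grid_step (sum_nat_single iN) => [|i' i'N ne].
  rewrite (sum_nat_single jN) => [|j' j'N ne].
    by rewrite /= indicE mem_set ?mulr1// /box/= hi hj.
  rewrite /= indicE memNset ?mulr0// /box/= => /andP[_ hj'].
  by move: ne; rewrite (cell_unique X0 hj hj') eqxx.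
rewrite big1// => j' _ /=.
rewrite indicE memNset ?mulr0// /box/= => /andP[hi' _].
by move: ne; rewrite (cell_unique T0 hi hi') eqxx.
Qed.

Lemma step_fun_grid_out N f z : ~ box (0, 0) Z z -> step_fun (grid_step N f) z = 0.
Proof.
case: N => [|N] nz; first by rewrite /step_fun big_grid_step big_geq.
rewrite /step_fun big_grid_step big_nat big1// => i /andP[_ iN].
rewrite big_nat big1// => j /andP[_ jN] /=.
rewrite indicE memNset ?mulr0// => /andP[/andP[/= a1 a2] /andP[b1 b2]]; apply: nz.
have /andP[_ /andP[/= p1 p2]] := @corner_rect N.+1 i.+1 j.+1 isT iN jN.
rewrite /box/= (le_lt_trans _ a1) ?cell_pt_ge0//= (le_trans a2 p1)/=.
by rewrite (le_lt_trans _ b1) ?cell_pt_ge0//= (le_trans b2 p2).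
Qed.

Variables (h : R * R -> R) (C L : R).
Hypothesis hC : forall z, rect Z z -> `|h z| <= C.
Hypothesis hL : forall (N : nat) z w, rect Z z -> rect Z w ->
  `|z.1 - w.1| <= T / N%:R -> `|z.2 - w.2| <= X / N%:R ->
  `|h z - h w| <= L / N%:R.

(** [inner_step N z] keeps the cells inside [rect z], so that its integral is
    a finite sum, jointly measurable in [z]; [cut_step N z] intersects all
    cells with [rect z]. *)
Definition inner_step N z := grid_step N (fun p => h p * (ple p z)%:R).

Definition cut_step N z : seq (R * ((R * R) * (R * R))) :=
  [seq (e.1, (pmin e.2.1 z, pmin e.2.2 z)) | e <- grid_step N h].

Definition restrict_rect z w : R := h w * \1_(box (0, 0) z) w.

(** The first term is the oscillation of [h] within a cell; the other two cover
    the strips of cells that the boundary of [rect z] cuts, where the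
    approximation may miss the whole value of [h]. *)
Definition error_bound N z w : R :=
  (L / N%:R) ^+ 2 * \1_(box (0, 0) Z) w +
  (C ^+ 2 * \1_(box (z.1 - T / N%:R, 0) (z.1, X)) w +
   C ^+ 2 * \1_(box (0, z.2 - X / N%:R) (T, z.2)) w).

Lemma good_inner_step N z : good_step (inner_step N z).
Proof. exact: good_grid_step. Qed.

Lemma good_cut_step N z : ple (0, 0) z -> good_step (cut_step N z).
Proof.
move=> z0; apply/allP => _ /mapP[e /(allP (good_grid_step N h)) g ->] /=.
exact: good_box_pmin.
Qed.

Lemma box_rect z w : box (0, 0) z w -> rect z w.
Proof.
move=> /andP[/andP[/= a1 a2] /andP[b1 b2]].
by rewrite /rect/= /ple/= (ltW a1) (ltW b1) a2 b2.
Qed.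

Lemma box_corner_rect N i j w : (i < N)%N -> (j < N)%N ->
  box (corner N i j) (corner N i.+1 j.+1) w ->
  [/\ rect Z (corner N i.+1 j.+1), ple w (corner N i.+1 j.+1),
      w.1 > (corner N i.+1 j.+1).1 - T / N%:R,
      w.2 > (corner N i.+1 j.+1).2 - X / N%:R
    & `|h (corner N i.+1 j.+1) - h w| <= L / N%:R].
Proof.
move=> iN jN /andP[/andP[/= a1 a2] /andP[b1 b2]].
have N0 : (0 < N)%N by exact: leq_ltn_trans iN.
have r := corner_rect N0 iN jN; have /andP[_ /andP[/= p1 p2]] := r.
have bw : box (0, 0) Z w.
  rewrite /box/= (le_lt_trans _ a1) ?cell_pt_ge0//= (le_trans a2 p1)/=.
  by rewrite (le_lt_trans _ b1) ?cell_pt_ge0//= (le_trans b2 p2).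
have e1 : w.1 > (corner N i.+1 j.+1).1 - T / N%:R by rewrite /= cell_ptS addrK.
have e2 : w.2 > (corner N i.+1 j.+1).2 - X / N%:R by rewrite /= cell_ptS addrK.
split=> //; first by rewrite /ple/= a2 b2.
apply: hL => //; first exact: box_rect.
  rewrite /= cell_ptS ger0_norm ?subr_ge0 -?cell_ptS// cell_ptS.
  by rewrite lerBlDr addrC lerD2l ltW.
rewrite /= cell_ptS ger0_norm ?subr_ge0 -?cell_ptS// cell_ptS.
by rewrite lerBlDr addrC lerD2l ltW.
Qed.

Lemma sqr_le_norm (a b : R) : `|a| <= b -> a ^+ 2 <= b ^+ 2.
Proof.
move=> ab; rewrite -(real_normK (num_real a)) lerXn2r// nnegrE.
exact: le_trans ab.
Qed.

Lemma error_bound_ge0 N z w : 0 <= error_bound N z w.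
Proof.
by rewrite /error_bound !addr_ge0// mulr_ge0 ?sqr_ge0.
Qed.

Lemma error_bound_cell N z w : box (0, 0) Z w -> (L / N%:R) ^+ 2 <= error_bound N z w.
Proof.
move=> bw; rewrite /error_bound [\1_(box (0, 0) Z) w]indicE mem_set// mulr1.
by rewrite lerDl addr_ge0// mulr_ge0 ?sqr_ge0.
Qed.

Lemma inner_step_error N z w : (0 < N)%N -> rect Z z ->
  (step_fun (inner_step N z) w - restrict_rect z w) ^+ 2 <= error_bound N z w.
Proof.
move=> N0 /andP[z0 zZ]; rewrite /restrict_rect.
have [bw|nbw] := pselect (box (0, 0) Z w); last first.
  rewrite step_fun_grid_out// indicE memNset ?mulr0 ?subr0 ?expr0n ?error_bound_ge0//.
  move=> /andP[/andP[/= a1 a2] /andP[b1 b2]]; apply: nbw.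
  by move: zZ => /andP[/= c1 c2]; rewrite /box/= a1 b1 (le_trans a2 c1) (le_trans b2 c2).
have [i [j [iN jN bc ->]]] := step_fun_grid (fun p => h p * (ple p z)%:R) N0 bw.
have [rp wp e1 e2 hh] := box_corner_rect iN jN bc.
set p := corner N i.+1 j.+1 in rp wp e1 e2 hh *.
have wz : box (0, 0) z w = (ple w z) :> Prop.
  move: bw => /andP[/andP[/= a1 _] /andP[b1 _]].
  by rewrite /box/= a1 b1.
have [pz|npz] := boolP (ple p z).
  rewrite indicE mem_set ?wz; last exact: ple_trans pz.
  rewrite !mulr1; apply: le_trans (error_bound_cell _ _ bw).
  exact: sqr_le_norm.
rewrite mulr0 sub0r sqrrN indicE.
have [pw|npw] := boolP (ple w z); last first.
  by rewrite memNset ?mulr0 ?expr0n ?error_bound_ge0// wz; exact/negP.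
rewrite mem_set ?wz// mulr1.
have hw : h w ^+ 2 <= C ^+ 2 by apply/sqr_le_norm/hC/box_rect.
apply: (le_trans hw); rewrite /error_bound.
move: (bw) => /andP[/andP[/= a1 a2] /andP[b1 b2]].
move: (pw) => /andP[c1 c2].
apply: le_trans (_ : C ^+ 2 * \1_(box (z.1 - T / N%:R, 0) (z.1, X)) w +
  C ^+ 2 * \1_(box (0, z.2 - X / N%:R) (T, z.2)) w <= _); last first.
  by rewrite lerDr mulr_ge0 ?sqr_ge0.
have C2 := sqr_ge0 C.
move: npz; rewrite /ple negb_and -!ltNge => /orP[zp|zp].
  rewrite [\1_(box (z.1 - _, 0) _) w]indicE mem_set; last first.
    rewrite /box/= c1 b1 b2 !andbT; apply: le_lt_trans e1.
    by rewrite lerD2r ltW.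
  by rewrite mulr1 lerDl; exact: mulr_ge0 C2 _.
rewrite [\1_(box (0, z.2 - _) _) w]indicE mem_set; last first.
  rewrite /box/= a1 a2 c2 !andbT; apply: le_lt_trans e2.
  by rewrite lerD2r ltW.
by rewrite mulr1 lerDr; exact: mulr_ge0 C2 _.
Qed.

Lemma step_fun_cut N z w :
  step_fun (cut_step N z) w = step_fun (grid_step N h) w * (ple w z)%:R.
Proof.
rewrite /step_fun /cut_step big_map mulr_suml; apply: eq_bigr => e _ /=.
rewrite -mulrA; congr (_ * _).
rewrite !indicE -natrM mulnb; congr (nat_of_bool _)%:R.
have E : box (pmin e.2.1 z) (pmin e.2.2 z) w <-> box e.2.1 e.2.2 w /\ ple w z.
  split=> [b|[]].
    split; first exact: box_pmin b.
    move: b; rewrite /box/= !le_min => /andP[/andP[_ /andP[_ a]] /andP[_ /andP[_ b]]].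
    by rewrite /ple a b.
  rewrite /box /ple /pmin/= => /andP[/andP[a1 a2] /andP[b1 b2]] /andP[c1 c2].
  by rewrite !le_min !gt_min a1 a2 b1 b2 c1 c2.
apply/idP/idP; rewrite !inE.
  by move=> /E [b c]; apply/andP; rewrite c mem_set.
by move=> /andP[/set_mem b c]; apply/E.
Qed.

Lemma cut_step_error N z w : (0 < N)%N -> rect Z z ->
  (step_fun (cut_step N z) w - restrict_rect z w) ^+ 2 <= error_bound N z w.
Proof.
move=> N0 /andP[z0 zZ]; rewrite /restrict_rect step_fun_cut.
have [bw|nbw] := pselect (box (0, 0) Z w); last first.
  rewrite step_fun_grid_out// mul0r indicE memNset ?mulr0 ?subr0 ?expr0n ?error_bound_ge0//.
  move=> /andP[/andP[/= a1 a2] /andP[b1 b2]]; apply: nbw.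
  by move: zZ => /andP[/= c1 c2]; rewrite /box/= a1 b1 (le_trans a2 c1) (le_trans b2 c2).
have [i [j [iN jN bc ->]]] := step_fun_grid h N0 bw.
have [rp wp e1 e2 hh] := box_corner_rect iN jN bc.
have -> : \1_(box (0, 0) z) w = (ple w z)%:R :> R.
  rewrite indicE; congr (nat_of_bool _)%:R; apply/idP/idP; rewrite inE.
    by move=> /andP[/andP[/= _ a] /andP[_ b]]; rewrite /ple a b.
  move: bw => /andP[/andP[/= a1 _] /andP[b1 _]] /andP[a b].
  by rewrite /box/= a1 b1 a b.
rewrite -mulrBl exprMn; apply: le_trans (error_bound_cell _ _ bw).
apply: (@le_trans _ _ ((h (corner N i.+1 j.+1) - h w) ^+ 2)).
  by rewrite ler_piMr ?sqr_ge0//; case: (ple w z); rewrite ?expr1n ?expr0n.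
exact: sqr_le_norm.
Qed.

End grid_step.

(** * Limits of fast Cauchy sequences in L2 *)
Section fast_cauchy.
Context d (Omega : measurableType d) (R : realType) (P : probability Omega R).
Variables (V : nat -> Omega -> R) (K : R).
Local Notation L2 X := (square_integrable P setT X).
Hypothesis L2V : forall n, L2 (V n).
Hypothesis cauchyV : forall n m, (n <= m)%N ->
  \int[P]_om ((V n om - V m om) ^+ 2) <= K / 4 ^+ n.

(** A pointwise upper limit instead of a limit in L2: taken in [om] for each
    [z], it keeps joint measurability in [(z, om)] and measurability with
    respect to a sigma-algebra that need not contain the null sets. *)
Definition fast_limit om : R := fine (limn_esup (fun n => (V n om)%:E)).

Let K0 : 0 <= K.
Proof.
have := cauchyV (leqnn 0); rewrite expr0 divr1; apply: le_trans.
by apply: Rintegral_ge0 => om _; exact: sqr_ge0.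
Qed.

Lemma Rintegral_EFin dT (T : measurableType dT) (mu : {measure set T -> \bar R})
    (D : set T) (f : T -> R) :
  measurable D -> mu.-integrable D (EFin \o f) ->
  (\int[mu]_(x in D) (f x)%:E = (\int[mu]_(x in D) f x)%:E)%E.
Proof. by move=> mD fi; rewrite /Rintegral fineK//; exact: integrable_fin_num. Qed.

Let mV n : measurable_fun setT (V n).
Proof. exact: L2_measurable (L2V n). Qed.

Let L2d n m : L2 (fun om => V n om - V m om).
Proof. exact: L2B. Qed.

Lemma fast_cauchy_step n :
  (\int[P]_om `|V n.+1 om - V n om|%:E <= ((1 + K) / (2 ^ n.+1)%:R)%:E)%E.
Proof.
have i2 := L2_sqr (L2d n n.+1).
have i1 : P.-integrable setT (EFin \o (fun=> (2 ^ n.+1)%:R^-1 : R)).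
  exact: finite_measure_integrable_cst.
have := L1D measurableT i1 (L1Z measurableT (2 ^+ n / 2) i2) => i3.
apply: (@le_trans _ _ (\int[P]_om
   ((2 ^ n.+1)%:R^-1 + 2 ^+ n / 2 * (V n om - V n.+1 om) ^+ 2)%:E)%E).
  apply: ge0_le_integral => //.
  - by apply/measurable_EFinP; apply: measurableT_comp => //; exact: measurable_funB.
  - exact: measurable_int i3.
  - move=> om _; rewrite lee_fin distrC; set x := V n om - V n.+1 om.
    have c0 : 0 < 2 ^+ n :> R by rewrite exprn_gt0.
    have -> : (2 ^ n.+1)%:R^-1 = (2 ^+ n)^-1 / 2 :> R.
      by rewrite natrX exprSr invfM.
    have -> : (2 ^+ n)^-1 / 2 + 2 ^+ n / 2 * x ^+ 2 =
       `|x| + (2 ^+ n) / 2 * (`|x| - (2 ^+ n)^-1) ^+ 2.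
      rewrite -[x ^+ 2](real_normK (num_real x)); move: `|x| => b.
      by move: (2 ^+ n) c0 => c c0; field; rewrite gt_eqF.
    by rewrite lerDl mulr_ge0 ?sqr_ge0// divr_ge0// ltW.
rewrite Rintegral_EFin// lee_fin RintegralD//; last exact: L1Z.
rewrite RintegralZl// Rintegral_cst// (_ : fine _ = 1) ?mulr1; last first.
  by rewrite (_ : _ setT = 1%E)//; exact: probability_setT.
rewrite mulrDl mul1r lerD2l.
apply: (@le_trans _ _ (2 ^+ n / 2 * (K / 4 ^+ n))).
  by rewrite ler_wpM2l ?divr_ge0 ?exprn_ge0//; exact: cauchyV.
rewrite natrX exprSr (_ : 4 = 2 * 2 :> R) ?exprMn; last by rewrite -natrM.
rewrite le_eqVlt; apply/orP; left; apply/eqP.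
have : 2 ^+ n != 0 :> R by rewrite expf_neq0.
by move: (2 ^+ n) => c c0; field.
Qed.

(** The increments of the sequence are summable in L1, hence almost surely. *)
Lemma fast_limit_cvg : {ae P, forall om, (fun n => V n om) @ \oo --> fast_limit om}.
Proof.
pose dV n om := `|V n.+1 om - V n om|%:E : \bar R.
have mdV n : measurable_fun setT (dV n).
  by apply/measurable_EFinP; apply: measurableT_comp => //; exact: measurable_funB.
have dV0 n om : (0 <= dV n om)%E by rewrite lee_fin.
have S : (\int[P]_om \sum_(n <oo) dV n om < +oo)%E.
  rewrite integral_nneseries//.
  apply: (@le_lt_trans _ _ (\sum_(n <oo) ((1 + K) / (2 ^ n.+1)%:R)%:E)%E).
    apply: lee_nneseries => n _; first by move=> _; apply: integral_ge0.
    exact: fast_cauchy_step.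
  have K1 : 0 <= 1 + K by rewrite addr_ge0.
  have := @epsilon_trick R (fun=> 0%E) _ xpredT (fun _ => lexx _) K1.
  rewrite [X in (_ <= X + _)%E -> _]eseries0// add0e.
  under eq_eseriesr do rewrite add0e.
  by move=> h; apply: (le_lt_trans h); rewrite ltry.
have : P.-integrable setT (fun om => \sum_(n <oo) dV n om)%E.
  apply/integrableP; split.
    by apply: ge0_emeasurable_sum => // n om _ _; rewrite lee_fin.
  by under eq_integral do rewrite gee0_abs ?nneseries_ge0//.
move/(integrable_ae measurableT); apply: filterS => om /(_ I) fin.
have cS : cvgn (series (fun n => V n.+1 om - V n om)).
  apply: normed_cvg; apply: nondecreasing_is_cvgn.
    apply: nondecreasing_series => n _ _; exact: normr_ge0.
  exists (fine (\sum_(n <oo) dV n om)%E) => _ [n _ <-].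
  rewrite -lee_fin fineK//.
  have := @nneseries_lim_ge R (fun k => dV k om) xpredT 0%N n (fun k _ _ => dV0 k om).
  by apply: le_trans; rewrite /series /= -sumEFin.
have cV : cvgn (fun n => V n om).
  have -> : (fun n => V n om) = (fun n => series (fun n => V n.+1 om - V n om) n + V 0%N om).
    apply/funext => n; rewrite /series /= (telescope_sumr (fun k => V k om))//.
    by rewrite subrK.
  by apply: is_cvgD => //; exact: is_cvg_cst.
have cE : (fun n => (V n om)%:E) @ \oo --> (limn (fun n => V n om))%:E.
  by apply: cvg_EFin => //; exact: nearW.
rewrite /fast_limit; have [_ ->] := cvg_limn_einf_sup cE.
exact: cV.
Qed.

Lemma measurable_fast_limit : measurable_fun setT fast_limit.
Proof.
apply: (@measurableT_comp _ _ _ _ _ _ fine) => //.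
by apply: measurable_fun_limn_esup => n; exact/measurable_EFinP.
Qed.

(** Fatou's lemma along the almost sure convergence. *)
Lemma fast_limit_error n : L2 fast_limit /\
  \int[P]_om ((V n om - fast_limit om) ^+ 2) <= K / 4 ^+ n.
Proof.
have B : (\int[P]_om ((V n om - fast_limit om) ^+ 2)%:E <= (K / 4 ^+ n)%:E)%E.
  pose f m om := ((V n om - V (n + m)%N om) ^+ 2)%:E : \bar R.
  have mf m : measurable_fun setT (f m).
    by apply/measurable_EFinP; apply: measurable_funX; exact: measurable_funB.
  have f0 m om : setT om -> (0 <= f m om)%E by rewrite lee_fin sqr_ge0.
  have fK m : (\int[P]_om f m om <= (K / 4 ^+ n)%:E)%E.
    rewrite Rintegral_EFin//; last exact: L2_sqr.
    by rewrite lee_fin; apply: cauchyV; rewrite leq_addr.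
  apply: (@le_trans _ _ (\int[P]_om limn_einf (f^~ om))%E).
    rewrite le_eqVlt; apply/orP; left; apply/eqP.
    apply: ae_eq_integral => //.
    - apply/measurable_EFinP; apply: measurable_funX; apply: measurable_funB => //.
      exact: measurable_fast_limit.
    - apply: (eq_measurable_fun (fun om => - limn_esup (-%E \o f^~ om))%E).
        by move=> om _; rewrite limn_esupN oppeK.
      apply: measurableT_comp => //.
      apply: (@measurable_fun_limn_esup _ _ _ _ (fun m om => (- f m om)%E)) => m.
      exact: measurableT_comp.
    - apply: filterS fast_limit_cvg => om cV _.
      suff h : (fun m => f m om) @ \oo --> ((V n om - fast_limit om) ^+ 2)%:E.
        by have [-> _] := cvg_limn_einf_sup h.
      apply: cvg_EFin; first exact: nearW.
      have h1 : (fun m => V n om - V (n + m)%N om) @ \oo --> V n om - fast_limit om.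
        apply: cvgB; first exact: cvg_cst.
        under eq_fun do rewrite addnC.
        by move: cV; rewrite -(cvg_shiftn n).
      by rewrite /comp /=; under eq_fun do rewrite expr2; rewrite expr2; exact: cvgM.
  apply: (le_trans (fatou _ measurableT mf f0)).
  apply: (le_trans (limn_einf_sup _)).
  rewrite limn_esup_lim; apply: lime_le; first exact: is_cvg_esups.
  by apply: nearW => m; apply: ge_ereal_sup => _ [k _ <-]; exact: fK.
have L2e : L2 (fun om => V n om - fast_limit om).
  split; last by apply: (le_lt_trans B); rewrite ltry.
  by apply: measurable_funB => //; exact: measurable_fast_limit.
split; last by rewrite -lee_fin -Rintegral_EFin//; exact: L2_sqr.
have := L2B measurableT (L2V n) L2e; congr square_integrable.
by apply/funext => om; rewrite opprB addrC subrK.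
Qed.

End fast_cauchy.

(** * The Wiener integral of a Lipschitz function *)
Lemma cvg_geometric_bound (R : realType) (c : R) (u : nat -> \bar R) :
  (forall n, (0 <= u n)%E) -> (forall n, (u n <= (c / 4 ^+ n)%:E)%E) ->
  u @ \oo --> 0%E.
Proof.
move=> u0 uc; apply: (@squeeze_cvge _ _ _ _ (fun=> 0%E) _ (fun n => (c / 4 ^+ n)%:E)).
- by apply: nearW => n; rewrite u0 uc.
- exact: cvg_cst.
apply: cvg_EFin; first exact: nearW.
rewrite /comp /= -[X in _ --> X](mulr0 c); apply: cvgM; first exact: cvg_cst.
under eq_fun do rewrite -exprVn.
by apply: cvg_expr; rewrite ger0_norm// invf_lt1// ltr1n.
Qed.

Section wiener_integral.
Context d (Omega : measurableType d) (R : realType) (P : probability Omega R).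
Variable B : R * R -> Omega -> R.
Hypothesis hB : brownian_sheet P B.
Variables (T X : R).
Hypotheses (T0 : 0 < T) (X0 : 0 < X).
Local Notation Z := (T, X).
Variables (h : R * R -> R) (C L : R).
Hypothesis hC : forall z, rect Z z -> `|h z| <= C.
Hypothesis hL : forall (N : nat) z w, rect Z z -> rect Z w ->
  `|z.1 - w.1| <= T / N%:R -> `|z.2 - w.2| <= X / N%:R ->
  `|h z - h w| <= L / N%:R.
Hypothesis mh : measurable_fun (rect Z) h.
Local Notation L2 f := (square_integrable P setT f).

Let K0 := T * X * (L ^+ 2 + 2 * C ^+ 2).

Let indic_box lo hi :
  (leb2 R).-integrable setT (EFin \o (\1_(box lo hi) : R * R -> R)) /\
  \int[leb2 R]_z (\1_(box lo hi) z) =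
    Num.max 0 (hi.1 - lo.1) * Num.max 0 (hi.2 - lo.2).
Proof.
have mb : measurable (box lo hi) by exact: measurable_box.
have II : (\int[leb2 R]_z (\1_(box lo hi) z)%:E =
   (Num.max 0 (hi.1 - lo.1) * Num.max 0 (hi.2 - lo.2))%:E)%E.
  by rewrite integral_indic// setIT; exact: leb2_box.
split; last by rewrite /Rintegral [X in fine X]II.
apply/integrableP; split; first exact/measurable_EFinP.
under eq_integral do rewrite /= ger0_norm//.
by rewrite [X in (X < _)%E]II ltry.
Qed.

Lemma error_bound_L1 N z :
  (leb2 R).-integrable setT (EFin \o error_bound T X C L N z).
Proof.
have [i1 _] := indic_box (0, 0) Z.
have [i2 _] := indic_box (z.1 - T / N%:R, 0) (z.1, X).
have [i3 _] := indic_box (0, z.2 - X / N%:R) (T, z.2).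
by apply: L1D => //; [exact: L1Z|apply: L1D => //; exact: L1Z].
Qed.

Lemma Rintegral_error_bound N z : (0 < N)%N ->
  \int[leb2 R]_w error_bound T X C L N z w <= K0 / N%:R.
Proof.
move=> N0.
have [i1 e1] := indic_box (0, 0) Z.
have [i2 e2] := indic_box (z.1 - T / N%:R, 0) (z.1, X).
have [i3 e3] := indic_box (0, z.2 - X / N%:R) (T, z.2).
rewrite RintegralD//; [|exact: L1Z|by apply: L1D => //; exact: L1Z].
rewrite RintegralD//; [|exact: L1Z|exact: L1Z].
rewrite !RintegralZl// e1 e2 e3 /= !subr0 !subKr.
have N1 : 1 <= N%:R :> R by rewrite ler1n.
have NR : 0 < N%:R :> R by exact: lt_le_trans N1.
rewrite !max_r ?divr_ge0 ?(ltW T0) ?(ltW X0) ?(ltW NR)// /K0.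
have -> : (L / N%:R) ^+ 2 * (T * X) +
  (C ^+ 2 * (T / N%:R * X) + C ^+ 2 * (T * (X / N%:R))) =
  T * X * (L ^+ 2 / N%:R + 2 * C ^+ 2) / N%:R by field; rewrite gt_eqF.
rewrite ler_pM2r ?invr_gt0// ler_pM2l ?mulr_gt0// lerD2r.
by rewrite ler_pdivrMr// ler_peMr// sqr_ge0.
Qed.

Let K0_ge0 : 0 <= K0.
Proof.
by rewrite /K0 mulr_ge0 ?mulr_ge0 ?(ltW T0) ?(ltW X0)// addr_ge0 ?sqr_ge0// mulr_ge0// sqr_ge0.
Qed.

(** Isometry and the triangle inequality through [g]. *)
Lemma step_int_diff (a b : seq (R * ((R * R) * (R * R)))) (g ea eb : R * R -> R) :
  good_step a -> good_step b ->
  (leb2 R).-integrable setT (EFin \o ea) -> (leb2 R).-integrable setT (EFin \o eb) ->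
  (forall w, (step_fun a w - g w) ^+ 2 <= ea w) ->
  (forall w, (step_fun b w - g w) ^+ 2 <= eb w) ->
  \int[P]_om ((step_int B a om - step_int B b om) ^+ 2) <=
  2 * \int[leb2 R]_w ea w + 2 * \int[leb2 R]_w eb w.
Proof.
move=> ga gb iea ieb hea heb.
pose b' := [seq (- e.1, e.2) | e <- b].
have gc : good_step (a ++ b').
  rewrite /good_step all_cat; apply/andP; split; first exact: ga.
  by rewrite all_map; apply: sub_all gb => e.
have E om : step_int B a om - step_int B b om = step_int B (a ++ b') om.
  rewrite /step_int big_cat /= big_map; congr (_ + _).
  by rewrite -sumrN; apply: eq_bigr => e _ /=; rewrite mulNr.
have F w : step_fun (a ++ b') w = step_fun a w - step_fun b w.
  rewrite /step_fun big_cat /= big_map; congr (_ + _).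
  by rewrite -sumrN; apply: eq_bigr => e _ /=; rewrite mulNr.
under eq_Rintegral do rewrite E.
rewrite (step_isometry hB)// -!RintegralZl// -RintegralD//; [|exact: L1Z..].
have i2 : (leb2 R).-integrable setT (EFin \o (fun w => 2 * ea w + 2 * eb w)).
  by apply: L1D => //; exact: L1Z.
have le w : step_fun (a ++ b') w ^+ 2 <= 2 * ea w + 2 * eb w.
  rewrite F; apply: le_trans (lerD (ler_wpM2l _ (hea w)) (ler_wpM2l _ (heb w))) => //.
  have := sqr_ge0 ((step_fun a w - g w) + (step_fun b w - g w)).
  by nra.
apply: le_Rintegral => //.
apply: (L1_le measurableT _ _ i2) => [|w _]; last by rewrite ger0_norm ?sqr_ge0.
apply: measurable_funX; apply: measurable_sum => e.
by apply: measurable_funM => //; apply: measurable_indic; exact: measurable_box.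
Qed.

(** The number of cells per side is [4 ^ n], because the squared L2 error is of
    the order of the mesh and [fast_limit] asks for [4 ^- n]. *)
Definition wiener_approx n z om := step_int B (inner_step T X h (4 ^ n) z) om.

Definition wiener z om := fast_limit (fun n => wiener_approx n z) om.

Let pow4_gt0 n : (0 < 4 ^ n)%N.
Proof. by rewrite expn_gt0. Qed.

Lemma wiener_approx_L2 n z : L2 (wiener_approx n z).
Proof. by apply: (step_int_L2 hB); exact: good_inner_step. Qed.

Lemma wiener_approx_cauchy z n m : rect Z z -> (n <= m)%N ->
  \int[P]_om ((wiener_approx n z om - wiener_approx m z om) ^+ 2) <=
  (4 * K0) / 4 ^+ n.
Proof.
move=> rz nm.
apply: le_trans (step_int_diff (good_inner_step T0 X0 h _ z) (good_inner_step T0 X0 h _ z)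
  (error_bound_L1 (4 ^ n) z) (error_bound_L1 (4 ^ m) z)
  (fun w => inner_step_error T0 X0 hC hL w (pow4_gt0 n) rz)
  (fun w => inner_step_error T0 X0 hC hL w (pow4_gt0 m) rz)) _.
have e1 := Rintegral_error_bound z (pow4_gt0 n).
have e2 := Rintegral_error_bound z (pow4_gt0 m).
have e3 : K0 / (4 ^ m)%:R <= K0 / (4 ^ n)%:R.
  by rewrite ler_wpM2l// lef_pV2 ?posrE ?ltr0n// ler_nat leq_exp2l.
have -> : 4 * K0 / 4 ^+ n = 2 * (K0 / (4 ^ n)%:R) + 2 * (K0 / (4 ^ n)%:R).
  rewrite natrX; move: (4 ^+ n)^-1 => c; ring.
by apply: lerD; rewrite ler_pM2l// (le_trans e2).
Qed.

Lemma wiener_cut_error z n : rect Z z ->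
  \int[P]_om ((step_int B (cut_step T X h (4 ^ n) z) om - wiener_approx n z om) ^+ 2) <=
  (4 * K0) / 4 ^+ n.
Proof.
move=> rz; have /andP[z0 _] := rz.
apply: le_trans (step_int_diff (good_cut_step T0 X0 h _ z0) (good_inner_step T0 X0 h _ z)
  (error_bound_L1 (4 ^ n) z) (error_bound_L1 (4 ^ n) z)
  (fun w => cut_step_error T0 X0 C hL w (pow4_gt0 n) rz)
  (fun w => inner_step_error T0 X0 hC hL w (pow4_gt0 n) rz)) _.
have e1 := Rintegral_error_bound z (pow4_gt0 n).
have -> : 4 * K0 / 4 ^+ n = 2 * (K0 / (4 ^ n)%:R) + 2 * (K0 / (4 ^ n)%:R).
  rewrite natrX; move: (4 ^+ n)^-1 => c; ring.
by apply: lerD; rewrite ler_pM2l.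
Qed.

Lemma wiener_error z n : rect Z z -> L2 (wiener z) /\
  \int[P]_om ((wiener_approx n z om - wiener z om) ^+ 2) <= (4 * K0) / 4 ^+ n.
Proof.
move=> rz; apply: fast_limit_error => [k|k m km]; first exact: wiener_approx_L2.
exact: wiener_approx_cauchy.
Qed.

Lemma measurable_wiener_approx n :
  measurable_fun setT (fun w : (R * R) * Omega => wiener_approx n w.1 w.2).
Proof.
rewrite /wiener_approx /step_int /inner_step.
under eq_fun do rewrite big_grid_step /=.
apply: measurable_sum => i; apply: measurable_sum => j.
apply: measurable_funM; last first.
  apply: (measurableT_comp _ measurable_snd).
  by apply: (measurable_sheet_incr hB); exact: corner_good.
apply: measurable_funM => //.
set p := corner _ _ _ _ _.
have -> : (fun w : (R * R) * Omega => (ple p w.1)%:R : R) =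
    (\1_(`[p.1, +oo[%classic `*` `[p.2, +oo[%classic) \o fst).
  apply/funext => -[[a b] om] /=; rewrite indicE; congr (nat_of_bool _)%:R.
  rewrite /ple /=; apply/idP/idP.
    by move=> /andP[h1 h2]; rewrite inE; split; rewrite /= in_itv/= andbT.
  by rewrite inE => -[/=]; rewrite !in_itv/= !andbT => -> ->.
apply: (measurableT_comp _ measurable_fst).
by apply: measurable_indic; exact: measurableX.
Qed.

Lemma measurable_wiener :
  measurable_fun setT (fun w : (R * R) * Omega => wiener w.1 w.2).
Proof.
rewrite /wiener /fast_limit.
apply: (@measurableT_comp _ _ _ _ _ _ fine) => //.
apply: (@measurable_fun_limn_esup _ _ _ _
  (fun n (w : (R * R) * Omega) => (wiener_approx n w.1 w.2)%:E)) => n.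
by apply/measurable_EFinP; exact: measurable_wiener_approx.
Qed.

(** Cells that are not inside [rect z] carry the coefficient 0, and the
    increments over the others are known at [z]. *)
Lemma wiener_approx_filtration n z : rect Z z ->
  measurable_wrt (sheet_filtration B z) (wiener_approx n z).
Proof.
move=> /andP[z0 zZ]; rewrite /wiener_approx /step_int /inner_step.
under eq_fun do rewrite big_grid_step /=.
apply: measurable_wrt_sum => i; apply: measurable_wrt_sum => j.
set p' := corner _ _ _ i.+1 _; set p := corner _ _ _ _ _.
have [pz|_] := boolP (ple p' z); last first.
  under [X in measurable_wrt _ X]eq_fun do rewrite mulr0 mul0r; exact: measurable_wrt_cst.
apply: measurable_wrtM; first exact: measurable_wrt_cst.
have /good_boxP[q1 q2 q3 q4] := corner_good T0 X0 (4 ^ n) i j.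
have mB w : ple (0, 0) w -> ple w p' -> measurable_wrt (sheet_filtration B z) (B w).
  move=> w0 wp U mU; apply: sub_sigma_algebra; exists w, U; split => //.
  by rewrite /rect/= w0 (ple_trans wp pz).
rewrite /sheet_incr.
have N1 (Y : Omega -> R) : measurable_wrt (sheet_filtration B z) Y ->
    measurable_wrt (sheet_filtration B z) (fun om => - Y om).
  move=> mY; under eq_fun do rewrite -mulN1r.
  by apply: measurable_wrtM => //; exact: measurable_wrt_cst.
have q5 := le_trans q1 q3; have q6 := le_trans q2 q4.
apply: measurable_wrtD; first apply: measurable_wrtD; first apply: measurable_wrtD.
- by apply: mB; rewrite /ple/= ?q5 ?q6 ?lexx.
- by apply: N1; apply: mB; rewrite /ple/= ?q1 ?q6 ?q3 ?lexx.
- by apply: N1; apply: mB; rewrite /ple/= ?q2 ?q5 ?q4 ?lexx.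
- by apply: mB; rewrite /ple/= ?q1 ?q2 ?q3 ?q4.
Qed.

Lemma wiener_adapted : adapted B Z wiener.
Proof.
split; first by apply: measurable_funTS; exact: measurable_wiener.
move=> z rz; apply/measurable_wrtP.
apply: (@measurableT_comp _ _ _ _ _ _ fine) => //.
apply: (@measurable_fun_limn_esup _ (g_sigma_algebraType _) R setT
  (fun n om => (wiener_approx n z om)%:E)) => n.
apply/measurable_EFinP; apply/measurable_wrtP.
exact: wiener_approx_filtration.
Qed.

Lemma leb2_rect : leb2 R (rect Z) = (T * X)%:E.
Proof.
have -> : rect Z = `[0, T]%classic `*` `[0, X]%classic.
  apply/seteqP; split=> [[a b]|[a b]]; rewrite /rect /ple /= !in_itv /=.
    by case/andP => /andP[-> ->] /andP[-> ->].
  by case=> /andP[-> ->] /andP[-> ->].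
transitivity (leb1 `[0%R, T]%classic * leb1 `[0%R, X]%classic)%E.
  exact: product_measure1E.
by rewrite /leb1 !lebesgue_measure_itv/= !lte_fin T0 X0 oppr0 !adde0 -EFinM.
Qed.

Lemma leb2_rect_cylinder : sfprod (leb2 R) P (rect Z `*` setT) = (T * X)%:E.
Proof.
rewrite -leb2_rect -[RHS]mule1.
have -> : 1%E = P setT :> \bar R by exact/esym/probability_setT.
by apply: product_measure1E => //; exact: measurable_rect.
Qed.

Lemma grid_step_error N w : (0 < N)%N ->
  (step_fun (grid_step T X N h) w - restrict_rect h Z w) ^+ 2 <= (L / N%:R) ^+ 2.
Proof.
move=> N0; rewrite /restrict_rect.
have [bw|nbw] := pselect (box (0, 0) Z w); last first.
  by rewrite step_fun_grid_out// indicE memNset// mulr0 subr0 expr0n sqr_ge0.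
have [i [j [iN jN bc ->]]] := step_fun_grid T0 X0 h N0 bw.
have [rp wp e1 e2 hh] := box_corner_rect T0 X0 hL iN jN bc.
by rewrite indicE mem_set// mulr1; exact: sqr_le_norm.
Qed.

Let mindic lo hi : measurable_fun setT
  (fun w : (R * R) * Omega => \1_(box lo hi) w.1 : R).
Proof.
apply: (measurableT_comp (f := \1_(box lo hi) : R * R -> R) _ measurable_fst).
by apply: measurable_indic; exact: measurable_box.
Qed.

Lemma measurable_restrict_rect : measurable_fun (rect Z `*` setT)
  (fun w : (R * R) * Omega => restrict_rect h Z w.1).
Proof.
rewrite /restrict_rect; apply: measurable_funM.
  apply: (measurable_comp (F := rect Z) (measurable_rect Z) _ mh) => //.
    by move=> _ [w [rw _] <-].
  exact: measurable_funTS.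
by apply: measurable_funTS; exact: mindic.
Qed.

(** The simple integrands are the step functions on the whole grid; their
    integrals over [rect z] are those of [cut_step], which are as close to
    [wiener] as those of [inner_step]. *)
Theorem wiener_sheet_integral :
  is_sheet_integral P B Z (fun z _ => restrict_rect h Z z) wiener.
Proof.
exists (fun n => [seq SheetPiece e.2.1 e.2.2 (fun=> e.1) | e <- grid_step T X (4 ^ n) h]).
split.
- move=> n i; set s := [seq _ | _ <- _] in i *.
  have si : (i < size (grid_step T X (4 ^ n) h))%N.
    by rewrite -(size_map (fun e => SheetPiece e.2.1 e.2.2 (fun=> e.1) : sheet_piece R Omega)).
  rewrite (tnth_nth (SheetPiece (0, 0) (0, 0) (fun=> 0))) /= /s (nth_map (0, ((0, 0), (0, 0))))//.
  set e := nth _ _ _; have he : e \in grid_step T X (4 ^ n) h by exact: mem_nth.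
  have /allpairsP[[a b] [/= ha hb eE]] := he.
  rewrite !mem_index_iota /= in ha hb.
  have g := corner_good T0 X0 (4 ^ n) a b.
  have /andP[_ r] := corner_rect T0 X0 (pow4_gt0 n) ha hb.
  have /andP[g0 g1] := g.
  split; rewrite ?eE /=.
  + by rewrite g0 g1 r.
  + exact: measurable_wrt_cst.
  + by exists `|h (corner T X (4 ^ n) a.+1 b.+1)|.
- apply: (@cvg_geometric_bound _ (L ^+ 2 * (T * X))) => n.
    by apply: integral_ge0 => w _; rewrite lee_fin sqr_ge0.
  have mD := measurable_cylinder (T2 := Omega) (measurable_rect Z).
  apply: (@le_trans _ _ (\int[sfprod (leb2 R) P]_(w in rect Z `*` setT)
      ((L / (4 ^ n)%:R) ^+ 2)%:E)%E).
    apply: ge0_le_integral => //.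
    + by move=> w _; rewrite lee_fin sqr_ge0.
    + apply/measurable_EFinP; apply: measurable_funX; apply: measurable_funB.
        apply: measurable_funTS; rewrite /sheet_simple_eval.
        under eq_fun do rewrite big_map.
        by apply: measurable_sum => e; apply: measurable_funM.
      exact: measurable_restrict_rect.
    + move=> w _; rewrite lee_fin /sheet_simple_eval big_map /=.
      exact: grid_step_error.
  rewrite integral_cst//.
  rewrite [X in (_ * X)%E](leb2_rect_cylinder).
  rewrite -EFinM lee_fin natrX.
  have e1 : 1 <= 4 ^+ n :> R by rewrite exprn_ege1// ler1n.
  have e0 : 0 < 4 ^+ n :> R by exact: lt_le_trans e1.
  have LT : 0 <= L ^+ 2 * (T * X) by rewrite mulr_ge0 ?sqr_ge0// mulr_ge0// ltW.
  rewrite expr_div_n mulrAC ler_wpM2l//.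
  by rewrite lef_pV2 ?posrE ?exprn_gt0// expr2 ler_peMr// ltW.
- move=> z rz; have [L2W _] := wiener_error 0 rz.
  split; first exact: L2_measurable L2W.
  apply: (@cvg_geometric_bound _ (16 * K0)) => n.
    by apply: integral_ge0 => w _; rewrite lee_fin sqr_ge0.
  have [_ e1] := wiener_error n rz; have e2 := wiener_cut_error n rz.
  have /andP[z0 _] := rz.
  have L2c : L2 (step_int B (cut_step T X h (4 ^ n) z)).
    by apply: (step_int_L2 hB); exact: good_cut_step.
  have E om : sheet_simple_int B
     [seq SheetPiece e.2.1 e.2.2 (fun=> e.1) | e <- grid_step T X (4 ^ n) h] z om =
     step_int B (cut_step T X h (4 ^ n) z) om.
    by rewrite /sheet_simple_int /step_int /cut_step !big_map.
  under eq_integral do rewrite E.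
  have L2V := wiener_approx_L2 n z.
  rewrite Rintegral_EFin//; last by apply: L2_sqr => //; exact: L2B.
  rewrite lee_fin.
  have i1 := L2_sqr (L2B measurableT L2c L2V).
  have i2 := L2_sqr (L2B measurableT L2V L2W).
  have -> : 16 * K0 / 4 ^+ n = 2 * (4 * K0 / 4 ^+ n) + 2 * (4 * K0 / 4 ^+ n) by ring.
  apply: le_trans (lerD (ler_wpM2l _ e2) (ler_wpM2l _ e1)) => //.
  rewrite -!RintegralZl// -RintegralD//; [|exact: L1Z..].
  apply: le_Rintegral => //.
  + by apply: L2_sqr => //; exact: L2B.
  + by apply: L1D => //; exact: L1Z.
  + move=> om _; set a := step_int _ _ _; set b := wiener_approx _ _ _.
    set c := wiener _ _.
    by have := sqr_ge0 ((a - b) - (b - c)); nra.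
Qed.

End wiener_integral.

(** * Solutions of the backward equation *)
Section adjoint_process.
Context d (Omega : measurableType d) (R : realType) (P : probability Omega R).
Variable B : R * R -> Omega -> R.
Hypothesis hB : brownian_sheet P B.
Variables (T X : R).
Hypotheses (T0 : 0 < T) (X0 : 0 < X).
Local Notation Z := (T, X).
Local Notation L1 f := (P.-integrable setT (EFin \o f)).
Local Notation L2 f := (square_integrable P setT f).
Local Notation D := (rect Z `*` @setT Omega).
Local Notation mu := (sfprod (leb2 R) P).
Local Notation L2F f := (square_integrable mu D (fun w => f w.1 w.2)).

Let Z0 : ple (0, 0) Z. Proof. by rewrite /ple/= !ltW. Qed.

Let rect0 : rect Z (0, 0). Proof. by rewrite /rect/= Z0 /ple/= lexx. Qed.

Let mD : measurable D.
Proof. exact: (measurable_cylinder (T2 := Omega) (measurable_rect Z)). Qed.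

(** The only generator, [B (0, 0)], is identically zero, so its preimages are
    empty or full. *)
Lemma filtration0_trivial (A : set Omega) :
  sheet_filtration B (0, 0) A -> A = set0 \/ A = setT.
Proof.
pose G : set (set Omega) := [set A | A = set0 \/ A = setT].
suff : sheet_filtration B (0, 0) `<=` G by exact.
apply: smallest_sub.
  split; first by left.
    by move=> C [->|->]; [right|left]; rewrite ?setD0 ?setDT ?setDv.
  move=> F hF; have [[n Fn]|nF] := pselect (exists n, F n = setT).
    by right; apply/seteqP; split => // om _; exists n => //; rewrite Fn.
  left; apply/seteqP; split => // om [n _]; have [->//|Fn] := hF n.
  by exfalso; apply: nF; exists n.
move=> _ [w [U [/andP[/andP[/= a b] /andP[/= a' b']] mU ->]]].
case: w a b a' b' => s t /= a b a' b'.
have -> : s = 0 by apply/le_anti; rewrite a a'.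
have -> : t = 0 by apply/le_anti; rewrite b b'.
have B0 om : B (0, 0) om = 0.
  by case: hB => _ + _ _ _; apply; rewrite /ple/= ?eqxx ?lexx.
have [U0|U0] := pselect (U 0); [right|left]; apply/seteqP; split => om //=.
  by rewrite B0.
by rewrite B0.
Qed.

Lemma filtration0_cst (Y : Omega -> R) :
  measurable_wrt (sheet_filtration B (0, 0)) Y -> exists m, forall om, Y om = m.
Proof.
move=> mY; have [[om _]|no] := pselect (exists om : Omega, True); last first.
  by exists 0 => om; exfalso; apply: no; exists om.
exists (Y om) => om'.
have /filtration0_trivial[E|E] := mY [set Y om] (measurable_set1 _).
  by have : set0 om by rewrite -E.
by have : [set: Omega] om' by []; rewrite -E.
Qed.

(** Lets the terminal value [p Z] be paired with a field. *)
Lemma cylinder_L2_cst (Y : Omega -> R) : L2 Y ->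
  square_integrable mu D (fun w : (R * R) * Omega => Y w.2).
Proof.
move=> L2Y; have mY := L2_measurable L2Y.
have mYD : measurable_fun D (fun w : (R * R) * Omega => Y w.2).
  by apply: measurable_funTS; apply: (measurableT_comp mY measurable_snd).
split => //.
have mY2 : measurable_fun D (fun w : (R * R) * Omega => Y w.2 ^+ 2) by exact: measurable_funX.
rewrite [X in (X < _)%E](tonelli_cylinder1 (leb2 R) P (measurable_rect Z)
  (f := fun _ om => Y om ^+ 2) mY2 (fun _ om => sqr_ge0 _)).
rewrite Rintegral_EFin//; last exact: L2_sqr.
rewrite integral_cst ?[X in (_ * X)%E](leb2_rect T0 X0); last exact: measurable_rect.
by rewrite -EFinM ltry.
Qed.

(** Tonelli: a bound on the second moment at each point bounds the norm. *)
Lemma field_L2_bound (f : R * R -> Omega -> R) (a : R) :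
  measurable_fun D (fun w => f w.1 w.2) ->
  (forall z, rect Z z -> L2 (f z)) ->
  (forall z, rect Z z -> \int[P]_om (f z om ^+ 2) <= a) ->
  L2F f /\ \int[mu]_(w in D) (f w.1 w.2 ^+ 2) <= T * X * a.
Proof.
move=> mf Lf fa.
have mf2 : measurable_fun D (fun w => f w.1 w.2 ^+ 2) by exact: measurable_funX.
have f20 z om : 0 <= f z om ^+ 2 by exact: sqr_ge0.
have le : (\int[mu]_(w in D) (f w.1 w.2 ^+ 2)%:E <= (T * X * a)%:E)%E.
  rewrite [X in (X <= _)%E](tonelli_cylinder1 (leb2 R) P (measurable_rect Z)
    (f := fun z om => f z om ^+ 2) mf2 f20).
  have mI := measurable_tonelli_cylinder1 P (measurable_rect Z)
    (f := fun z om => f z om ^+ 2) mf2 f20.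
  apply: (@le_trans _ _ (\int[leb2 R]_(z in rect Z) a%:E)%E).
    apply: ge0_le_integral => //.
    - exact: measurable_rect.
    - by move=> z _; apply: integral_ge0 => om _; rewrite lee_fin.
    - move=> z rz; rewrite Rintegral_EFin//; last exact: L2_sqr (Lf z rz).
      by rewrite lee_fin; exact: fa.
  rewrite integral_cst ?[X in (_ * X)%E](leb2_rect T0 X0); last exact: measurable_rect.
  by rewrite -EFinM mulrC.
have L2f : L2F f by split => //; apply: (le_lt_trans le); rewrite ltry.
by split => //; rewrite -lee_fin -Rintegral_EFin//; exact: L2_sqr.
Qed.

Variables (xi : Omega -> R) (p q : R * R -> Omega -> R)
  (r : R * R -> R * R -> Omega -> R).
Hypothesis sol : bspde_solution P B Z xi p q r.

Lemma adjoint_adapted : adapted B Z p. Proof. by case: sol. Qed.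

Lemma adjoint_measurable z : rect Z z -> measurable_fun setT (p z).
Proof.
move=> rz; apply: (sheet_filtration_measurable hB (z := z)).
by have [_] := adjoint_adapted; apply.
Qed.

(** [p (0, 0)] is deterministic because [B] vanishes on the axes, so [p Z] is
    an increment of the square integrable stochastic integrals. *)
Lemma adjoint_L2 z : rect Z z -> L2 (p z).
Proof.
have [_ _ _ _ [I [M [hI hM eqn]]]] := sol.
have [m p0] := filtration0_cst (adjoint_adapted.2 _ rect0).
have rZ := rect_refl Z0.
have LIM w : rect Z w -> L2 (fun om => (I Z om - I w om) + (M Z om - M w om)).
  move=> rw; have LI := sheet_integral_L2 hB hI; have LM := wz_integral_L2 hB hM.
  by apply: L2D => //; apply: L2B => //; [exact: LI|exact: LI|exact: LM|exact: LM].
have LZ : L2 (p Z).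
  apply: (L2_ae measurableT (adjoint_measurable rZ) _
    (L2D measurableT (prob_L2_cst P m) (LIM _ rect0))).
  by apply: filterS (eqn _ rect0) => om + _; rewrite p0 => ->; ring.
move=> rz; apply: (L2_ae measurableT (adjoint_measurable rz) _ (L2B measurableT LZ (LIM _ rz))).
by apply: filterS (eqn _ rz) => om -> _; ring.
Qed.

(** Both stochastic integrals are martingales, and the backward equation
    expresses [p Z - p z] through their increments. *)
Lemma adjoint_martingale z (phi : Omega -> R) : rect Z z ->
  measurable_wrt (sheet_filtration B z) phi -> L2 phi ->
  \int[P]_om (phi om * p Z om) = \int[P]_om (phi om * p z om).
Proof.
move=> rz mphi Lphi; have rZ := rect_refl Z0.
have [_ _ _ _ [I [M [hI hM eqn]]]] := sol.
have LI w : rect Z w -> L2 (I w) by exact: (sheet_integral_L2 hB hI).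
have LM w : rect Z w -> L2 (M w) by exact: (wz_integral_L2 hB hM).
have Lp := adjoint_L2.
have -> : \int[P]_om (phi om * p z om) =
    \int[P]_om (phi om * p Z om - ((phi om * I Z om - phi om * I z om) +
      (phi om * M Z om - phi om * M z om))).
  rewrite /Rintegral; congr fine; apply: ae_eq_integral => //.
  - apply/measurable_EFinP; apply: measurable_funM; last exact: adjoint_measurable.
    exact: L2_measurable Lphi.
  - have mphi' := L2_measurable Lphi.
    have mI w : rect Z w -> measurable_fun setT (I w) by move=> /LI /L2_measurable.
    have mM w : rect Z w -> measurable_fun setT (M w) by move=> /LM /L2_measurable.
    have mp := adjoint_measurable.
    apply/measurable_EFinP; apply: measurable_funB; first by apply: measurable_funM => //; exact: mp.
    by apply: measurable_funD; apply: measurable_funB; apply: measurable_funM => //;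
      solve [exact: mI|exact: mM].
  - by apply: filterS (eqn _ rz) => om -> _; congr EFin; ring.
have iI w : rect Z w -> L1 (fun om => phi om * I w om) by move=> rw; apply: L2M => //; exact: LI.
have iM w : rect Z w -> L1 (fun om => phi om * M w om) by move=> rw; apply: L2M => //; exact: LM.
have ip w : rect Z w -> L1 (fun om => phi om * p w om) by move=> rw; apply: L2M => //; exact: Lp.
rewrite RintegralB//; [|exact: ip|by apply: L1D => //; apply: L1B => //; solve [exact: iI|exact: iM]].
rewrite RintegralD//; [|by apply: L1B => //; exact: iI|by apply: L1B => //; exact: iM].
rewrite RintegralB//; [|exact: iI|exact: iI].
rewrite RintegralB//; [|exact: iM|exact: iM].
rewrite (sheet_integral_martingale hB Z0 hI rz mphi Lphi).
by rewrite (wz_integral_martingale hB Z0 hM rz mphi Lphi) !subrr addr0 subr0.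
Qed.

(** By the martingale property tested with [p z], the difference of the two
    sides is the second moment of [p Z - p z]. *)
Lemma adjoint_contraction z : rect Z z ->
  \int[P]_om (p z om ^+ 2) <= \int[P]_om (p Z om ^+ 2).
Proof.
move=> rz; have Lz := adjoint_L2 rz; have LZ := adjoint_L2 (rect_refl Z0).
have := adjoint_martingale rz (adjoint_adapted.2 _ rz) Lz => E.
rewrite -subr_ge0.
have -> : \int[P]_om (p Z om ^+ 2) - \int[P]_om (p z om ^+ 2) =
    \int[P]_om ((p Z om - p z om) ^+ 2).
  have iz := L2_sqr Lz; have iZ := L2_sqr LZ; have iM := L2M measurableT Lz LZ.
  under [RHS]eq_Rintegral do rewrite sqrrB -mulr_natl [_ * p z _]mulrC.
  rewrite RintegralD//; last by apply: L1B => //; exact: L1Z.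
  rewrite RintegralB//; last exact: L1Z.
  rewrite RintegralZl// E; under [X in _ - 2 * X]eq_Rintegral do rewrite -expr2.
  by ring.
by apply: Rintegral_ge0 => om _; exact: sqr_ge0.
Qed.

Lemma adjoint_field_L2 : L2F p.
Proof.
have [mp _] := adjoint_adapted.
by have [] := field_L2_bound mp adjoint_L2 adjoint_contraction.
Qed.

End adjoint_process.

(** * The quadratic cost *)
Section quadratic_cost.
Context d (Omega : measurableType d) (R : realType) (P : probability Omega R).
Variable B : R * R -> Omega -> R.
Hypothesis hB : brownian_sheet P B.
Variables (T X : R).
Hypotheses (T0 : 0 < T) (X0 : 0 < X).
Local Notation Z := (T, X).
Local Notation L2 f := (square_integrable P setT f).
Local Notation D := (rect Z `*` @setT Omega).
Local Notation mu := (sfprod (leb2 R) P).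
Local Notation L2F f := (square_integrable mu D (fun w => f w.1 w.2)).
Implicit Types (u v : R * R -> Omega -> R).

Let Z0 : ple (0, 0) Z. Proof. by rewrite /ple/= !ltW. Qed.

Let mZ : measurable (rect Z). Proof. exact: measurable_rect. Qed.

Let mD : measurable D.
Proof. exact: (measurable_cylinder (T2 := Omega) mZ). Qed.

Let cst_L1 a : (leb2 R).-integrable (rect Z) (EFin \o (fun=> a : R)).
Proof.
apply/integrableP; split; first exact/measurable_EFinP.
under eq_integral do rewrite /=.
by rewrite integral_cst// [X in (_ * X)%E](leb2_rect T0 X0) -EFinM ltry.
Qed.

Let Rintegral_leb2_cst a : \int[leb2 R]_(z in rect Z) (fun=> a : R) z = T * X * a.
Proof.
by rewrite /Rintegral integral_cst// [X in (_ * X)%E](leb2_rect T0 X0)/= mulrC.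
Qed.

(** Cauchy-Schwarz against the constant 1: the variance of [f] under the
    uniform law is nonnegative. In extended reals it also holds when [f] is
    not square integrable. *)
Lemma sqr_Rintegral_le (f : R * R -> R) : measurable_fun (rect Z) f ->
  (((\int[leb2 R]_(z in rect Z) f z) ^+ 2)%:E <=
   (T * X)%:E * \int[leb2 R]_(z in rect Z) (f z ^+ 2)%:E)%E.
Proof.
move=> mf; have TX0 : 0 < T * X by exact: mulr_gt0.
have [fin|] := ltP (\int[leb2 R]_(z in rect Z) (f z ^+ 2)%:E)%E +oo%E; last first.
  by rewrite leye_eq => /eqP ->; rewrite mulry gtr0_sg// mul1e leey.
have L2f : square_integrable (leb2 R) (rect Z) f by [].
have L21 : square_integrable (leb2 R) (rect Z) (fun=> 1).
  by apply/square_integrableP => //; split => //; exact: cst_L1.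
have i1 : (leb2 R).-integrable (rect Z) (EFin \o f).
  apply: (eq_integrable mZ (EFin \o (fun z => f z * 1))); last exact: L2M.
  by move=> z _ /=; rewrite mulr1.
have i2 := L2_sqr L2f.
rewrite Rintegral_EFin// -EFinM lee_fin.
set a := Rintegral _ _ _; set s := Rintegral _ _ _.
have : 0 <= \int[leb2 R]_(z in rect Z) ((T * X * f z - a) ^+ 2).
  by apply: Rintegral_ge0 => z _; exact: sqr_ge0.
have -> : \int[leb2 R]_(z in rect Z) ((T * X * f z - a) ^+ 2) =
    T * X * (T * X * s - a ^+ 2).
  have E z : (T * X * f z - a) ^+ 2 =
      (T * X) ^+ 2 * f z ^+ 2 + ((- 2 * T * X * a) * f z + a ^+ 2) by ring.
  under eq_Rintegral do rewrite E.
  rewrite RintegralD//; [|exact: L1Z|by apply: L1D => //; [exact: L1Z|exact: cst_L1]].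
  rewrite RintegralD//; [|exact: L1Z|exact: cst_L1].
  rewrite [X in X + _]RintegralZl// [X in _ + (X + _)]RintegralZl//.
  by rewrite [X in _ + (_ + X)](Rintegral_leb2_cst (a ^+ 2)) -/s -/a; ring.
by rewrite pmulr_rge0// subr_ge0.
Qed.

Lemma field_L1 v : L2F v -> mu.-integrable D (EFin \o (fun w => v w.1 w.2)).
Proof.
move=> Lv; have := L2M mD Lv (cylinder_L2_cst T0 X0 (prob_L2_cst P 1)).
by apply: eq_integrable => // w _ /=; rewrite mulr1.
Qed.

Let measurable_drift v : L2F v ->
  measurable_fun setT (fun om => \int[leb2 R]_(z in rect Z) v z om).
Proof.
by move=> Lv; have [/L1_measurable mI _] := fubini_cylinder2 mZ (field_L1 Lv).
Qed.

Lemma drift_sqr_le v : L2F v ->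
  (\int[P]_om ((\int[leb2 R]_(z in rect Z) v z om) ^+ 2)%:E <=
   (T * X * \int[mu]_(w in D) (v w.1 w.2 ^+ 2))%:E)%E.
Proof.
move=> Lv; have [mv _] := Lv; have mI := measurable_drift Lv.
have mv2 : measurable_fun D (fun w => v w.1 w.2 ^+ 2) by exact: measurable_funX.
have v20 z om : 0 <= v z om ^+ 2 by exact: sqr_ge0.
have mI2 := measurable_tonelli_cylinder2 (leb2 R) mZ (f := fun z om => v z om ^+ 2) mv2 v20.
have I20 om : (0 <= \int[leb2 R]_(z in rect Z) (v z om ^+ 2)%:E)%E.
  by apply: integral_ge0 => z _; rewrite lee_fin.
apply: (@le_trans _ _ (\int[P]_om ((T * X)%:E *
    \int[leb2 R]_(z in rect Z) (v z om ^+ 2)%:E))%E).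
  apply: ge0_le_integral => //.
  - by move=> om _; rewrite lee_fin sqr_ge0.
  - by apply/measurable_EFinP; exact: measurable_funX.
  - exact: measurable_funeM.
  - move=> om _; apply: sqr_Rintegral_le.
    exact: (measurable_cylinder2 mZ (f := v)).
rewrite ge0_integralZl_EFin//; last by rewrite mulr_ge0// ltW.
rewrite -(tonelli_cylinder2 (leb2 R) P mZ (f := fun z om => v z om ^+ 2) mv2 v20).
by rewrite Rintegral_EFin//; exact: L2_sqr Lv.
Qed.

Lemma drift_L2 v : L2F v -> L2 (fun om => \int[leb2 R]_(z in rect Z) v z om).
Proof.
move=> Lv; split; first exact: measurable_drift.
by apply: le_lt_trans (drift_sqr_le Lv) _; rewrite ltry.
Qed.

Variables (b k c y sigma : R).
Hypotheses (b0 : 0 < b) (c0 : 0 <= c).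

Local Notation Y v := (state B y sigma (fun z om => k * v z om) Z).
Local Notation cost v :=
  (quadratic_cost P Z b c v (state B y sigma (fun z om => k * v z om))).

Lemma state_drift v om :
  (leb2 R).-integrable (rect Z) (EFin \o (v^~ om)) ->
  Y v om = y + k * \int[leb2 R]_(z in rect Z) v z om + sigma * sheet_incr B (0, 0) Z om.
Proof. by move=> i; rewrite /state RintegralZl. Qed.

Let ae_drift v : L2F v ->
  {ae P, forall om, (leb2 R).-integrable (rect Z) (EFin \o (v^~ om))}.
Proof. by move=> Lv; apply: ae_integrable_cylinder2 => //; exact: field_L1. Qed.

Let mY v : measurable_fun D (fun w => v w.1 w.2) -> measurable_fun setT (Y v).
Proof.
by move=> mv; apply: (measurable_state _ _ hB Z0); exact: measurable_funM.
Qed.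

Lemma state_L2 v : L2F v -> L2 (Y v).
Proof.
move=> Lv; have [mv _] := Lv.
have Ly := prob_L2_cst P y.
have LB : L2 (sheet_incr B (0, 0) Z).
  by apply: (sheet_incr_L2 hB); rewrite /good_box Z0/= /ple/= lexx.
have := L2D measurableT (L2D measurableT Ly (L2Z measurableT k (drift_L2 Lv)))
  (L2Z measurableT sigma LB).
apply: L2_ae => //; first exact: mY.
by apply: filterS (ae_drift Lv) => om i _; rewrite state_drift.
Qed.

Lemma cost_split v : measurable_fun D (fun w => v w.1 w.2) ->
  cost v = (\int[mu]_(w in D) (b * v w.1 w.2 ^+ 2)%:E +
            \int[P]_om (c * Y v om ^+ 2)%:E)%E.
Proof.
move=> mv; rewrite /quadratic_cost.
have mv2 : measurable_fun D (fun w => b * v w.1 w.2 ^+ 2).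
  by apply: measurable_funM => //; exact: measurable_funX.
have v20 z om : 0 <= b * v z om ^+ 2 by rewrite mulr_ge0 ?sqr_ge0// ltW.
rewrite ge0_integralD//.
- by rewrite (tonelli_cylinder2 (leb2 R) P mZ (f := fun z om => b * v z om ^+ 2) mv2 v20).
- by move=> om _; apply: integral_ge0 => z _; rewrite lee_fin.
- exact: (measurable_tonelli_cylinder2 (leb2 R) mZ (f := fun z om => b * v z om ^+ 2) mv2 v20).
- by move=> om _; rewrite lee_fin mulr_ge0 ?sqr_ge0.
- apply/measurable_EFinP; apply: measurable_funM => //; apply: measurable_funX.
  exact: mY.
Qed.

Lemma cost_fin v : L2F v ->
  cost v = (\int[mu]_(w in D) (b * v w.1 w.2 ^+ 2) + \int[P]_om (c * Y v om ^+ 2))%:E.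
Proof.
move=> Lv; have [mv _] := Lv; rewrite cost_split// EFinD.
by congr (_ + _)%E; apply: Rintegral_EFin => //; apply: L1Z => //; apply: L2_sqr => //;
  exact: state_L2.
Qed.

(** Controls of infinite energy have infinite cost, so that all comparisons of
    costs reduce to square integrable controls. *)
Lemma cost_infty v : measurable_fun D (fun w => v w.1 w.2) -> ~ L2F v -> cost v = +oo%E.
Proof.
move=> mv nL; rewrite cost_split//.
have v2 : measurable_fun D (fun w => v w.1 w.2 ^+ 2) by exact: measurable_funX.
have -> : (\int[mu]_(w in D) (b * v w.1 w.2 ^+ 2)%:E = +oo)%E.
  under eq_integral do rewrite EFinM.
  rewrite ge0_integralZl_EFin//; last by rewrite ltW.
  + have [fin|] := ltP (\int[mu]_(w in D) (v w.1 w.2 ^+ 2)%:E)%E +oo%E.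
      by exfalso; apply: nL.
    by rewrite leye_eq => /eqP ->; rewrite mulry gtr0_sg// mul1e.
  + by move=> w _; rewrite lee_fin sqr_ge0.
  + exact/measurable_EFinP.
rewrite addye// gt_eqF// (lt_le_trans (ltNyr 0))//.
by apply: integral_ge0 => om _; rewrite lee_fin mulr_ge0 ?sqr_ge0.
Qed.

End quadratic_cost.

(** * Verification and uniqueness *)
Section verification.
Context d (Omega : measurableType d) (R : realType) (P : probability Omega R).
Variable B : R * R -> Omega -> R.
Hypothesis hB : brownian_sheet P B.
Variables (T X : R).
Hypotheses (T0 : 0 < T) (X0 : 0 < X).
Local Notation Z := (T, X).
Local Notation L2 f := (square_integrable P setT f).
Local Notation D := (rect Z `*` @setT Omega).
Local Notation mu := (sfprod (leb2 R) P).
Local Notation L2F f := (square_integrable mu D (fun w => f w.1 w.2)).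
Implicit Types (u v f g : R * R -> Omega -> R).

Let Z0 : ple (0, 0) Z. Proof. by rewrite /ple/= !ltW. Qed.

Let mZ : measurable (rect Z). Proof. exact: measurable_rect. Qed.

Let mD : measurable D.
Proof. exact: (measurable_cylinder (T2 := Omega) mZ). Qed.

Lemma field_eqP f g : field_eq P Z f g <->
  ae_eq mu D (fun w => f w.1 w.2) (fun w => g w.1 w.2).
Proof.
by split; apply: filterS => w h; [case=> /h|move=> rw; apply: h].
Qed.

Lemma field_eq_L2 f g : measurable_fun D (fun w => g w.1 w.2) ->
  field_eq P Z f g -> L2F f -> L2F g.
Proof. by move=> mg /field_eqP; exact: L2_ae. Qed.

Lemma field_eq_state y sigma f g :
  measurable_fun D (fun w => f w.1 w.2) -> measurable_fun D (fun w => g w.1 w.2) ->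
  field_eq P Z f g ->
  {ae P, forall om, state B y sigma f Z om = state B y sigma g Z om}.
Proof.
move=> mf mg /(ae_cylinder_section (Q := fun z om => f z om = g z om)).
apply: filterS => om fg; rewrite /state /Rintegral; congr (_ + fine _ + _).
apply: ae_eq_integral => //.
- by apply/measurable_EFinP; exact: (measurable_cylinder2 mZ (f := f)).
- by apply/measurable_EFinP; exact: (measurable_cylinder2 mZ (f := g)).
- by apply: filterS fg => z h rz; rewrite h.
Qed.

Lemma adaptedB f g : adapted B Z f -> adapted B Z g ->
  adapted B Z (fun z om => f z om - g z om).
Proof.
move=> [mf af] [mg ag]; split; first exact: measurable_funB.
move=> z rz; under [X in measurable_wrt _ X]eq_fun do rewrite -mulN1r.
apply: measurable_wrtD; first exact: af.
by apply: measurable_wrtM; [exact: measurable_wrt_cst|exact: ag].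
Qed.

Variables (b k c y sigma : R).
Hypotheses (b0 : 0 < b) (c0 : 0 <= c).
Local Notation Y v := (state B y sigma (fun z om => k * v z om) Z).
Local Notation cost v :=
  (quadratic_cost P Z b c v (state B y sigma (fun z om => k * v z om))).

Variables (xi : Omega -> R) (p q : R * R -> Omega -> R)
  (r : R * R -> R * R -> Omega -> R) (u : R * R -> Omega -> R).
Hypotheses (sol : bspde_solution P B Z xi p q r) (au : adapted B Z u).
Hypothesis xiE : {ae P, forall om, xi om = 2 * c * Y u om}.
Hypothesis uE : field_eq P Z u (fun z om => - (k / (2 * b)) * p z om).

(** The adjoint process is square integrable, and [u] is a multiple of it. *)
Lemma control_L2 : L2F u.
Proof.
have Lp := adjoint_field_L2 hB T0 X0 sol.
apply: (field_eq_L2 au.1 (f := fun z om => - (k / (2 * b)) * p z om)).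
  by move: uE; apply: filterS => w h rw; rewrite h.
exact: L2Z.
Qed.

(** By Fubini it suffices to compare the expectations for almost every [z],
    where the martingale property applies because [f z] is known at [z]. *)
Lemma adjoint_pairing f : adapted B Z f -> L2F f ->
  \int[mu]_(w in D) (p Z w.2 * f w.1 w.2) = \int[mu]_(w in D) (p w.1 w.2 * f w.1 w.2).
Proof.
move=> af Lf; have rZ := rect_refl Z0.
have Lp := adjoint_field_L2 hB T0 X0 sol.
have LpZ := cylinder_L2_cst T0 X0 (adjoint_L2 hB T0 X0 sol rZ).
have i1 := L2M mD LpZ Lf; have i2 := L2M mD Lp Lf.
have [j1 ->] := fubini_cylinder1 mZ (f := fun z om => p Z om * f z om) i1.
have [j2 ->] := fubini_cylinder1 mZ (f := fun z om => p z om * f z om) i2.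
rewrite /Rintegral; congr fine; apply: ae_eq_integral => //.
- exact: measurable_int j1.
- exact: measurable_int j2.
have := ae_integrable_cylinder1 mZ (f := fun z om => f z om ^+ 2) (L2_sqr Lf).
apply: filterS => z h rz; congr EFin.
have Lfz : L2 (f z).
  apply/square_integrableP; split; last exact: h.
  by apply: (measurable_cylinder1 mZ rz (f := f)); case: Lf.
rewrite -[LHS]/(Rintegral _ _ _) -[RHS]/(Rintegral _ _ _).
under eq_Rintegral do rewrite mulrC; under [RHS]eq_Rintegral do rewrite mulrC.
exact: (adjoint_martingale hB T0 X0 sol rz (af.2 z rz) Lfz).
Qed.

(** The cost is a convex quadratic functional, and the derivative at [u] in the
    direction [v - u] is the integral of [2 b u + k (p Z)] times [v - u]. By
    [adjoint_pairing] the terminal value [p Z] may be replaced by [p], and then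
    the integrand vanishes by the relation between [u] and [p]. What remains is
    the second order part, at least [b] times the squared norm of [v - u]. *)
Theorem verification v : adapted B Z v ->
  (cost u + (b * \int[mu]_(w in D) ((v w.1 w.2 - u w.1 w.2) ^+ 2))%:E <= cost v)%E.
Proof.
move=> av; have Lu := control_L2.
have [Lv|nL] := pselect (L2F v); last first.
  by rewrite (cost_infty hB T0 X0 k y sigma b0 c0 av.1 nL) leey.
rewrite (cost_fin hB T0 X0 k y sigma b0 c0 Lu) (cost_fin hB T0 X0 k y sigma b0 c0 Lv).
rewrite -EFinD lee_fin.
pose f z om := v z om - u z om.
have af : adapted B Z f by exact: adaptedB.
have Lf : L2F f by exact: (L2B mD Lv Lu).
have LYu := state_L2 hB T0 X0 k y sigma Lu; have LYv := state_L2 hB T0 X0 k y sigma Lv.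
have rZ := rect_refl Z0.
have Lp := adjoint_field_L2 hB T0 X0 sol; have LpZ := adjoint_L2 hB T0 X0 sol rZ.
have LpZ' := cylinder_L2_cst T0 X0 LpZ.
(* expansion around [u], where [2 b u = - k p] turns the linear term into the
   pairing of [p] with [f] *)
have E1 : \int[mu]_(w in D) (b * v w.1 w.2 ^+ 2) =
    \int[mu]_(w in D) (b * u w.1 w.2 ^+ 2) + b * \int[mu]_(w in D) (f w.1 w.2 ^+ 2) -
    k * \int[mu]_(w in D) (p w.1 w.2 * f w.1 w.2).
  have iu := L2_sqr Lu; have iff := L2_sqr Lf; have ipf := L2M mD Lp Lf.
  rewrite -!RintegralZl// -RintegralD//; [|exact: L1Z..].
  rewrite -RintegralB//; [|by apply: L1D => //; exact: L1Z|exact: L1Z].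
  rewrite /Rintegral; congr fine; apply: ae_eq_integral => //.
  - by apply: measurable_int (L1Z mD _ (L2_sqr Lv)).
  - apply: measurable_int (L1B mD (L1D mD (L1Z mD b iu) (L1Z mD b iff)) (L1Z mD k ipf)).
  - move/field_eqP : uE; apply: filterS => w h /h {}h; congr EFin.
    have -> : v w.1 w.2 = u w.1 w.2 + f w.1 w.2 by rewrite addrC subrK.
    have -> : k * (p w.1 w.2 * f w.1 w.2) = - (2 * b * u w.1 w.2) * f w.1 w.2.
      by rewrite h; field; rewrite gt_eqF.
    by ring.
(* tangent line inequality for the square at [Y u], with slope [2 c (Y u) = p Z] *)
have E2 : \int[P]_om (c * Y u om ^+ 2) + k * \int[mu]_(w in D) (p w.1 w.2 * f w.1 w.2)
    <= \int[P]_om (c * Y v om ^+ 2).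
  rewrite -(adjoint_pairing af Lf).
  have ipf := L2M mD LpZ' Lf.
  have [j1 ->] := fubini_cylinder2 mZ (f := fun z om => p Z om * f z om) ipf.
  have iu := L1Z measurableT c (L2_sqr LYu); have iv := L1Z measurableT c (L2_sqr LYv).
  have iuv := L2M measurableT LYu (L2B measurableT LYv LYu).
  apply: (@le_trans _ _ (\int[P]_om (c * Y u om ^+ 2 + 2 * c * (Y u om * (Y v om - Y u om))))).
    rewrite -RintegralZl// -RintegralD//; last exact: L1Z.
    rewrite le_eqVlt; apply/orP; left; apply/eqP.
    rewrite /Rintegral; congr fine; apply: ae_eq_integral => //.
    - exact: measurable_int (L1D measurableT iu (L1Z measurableT k j1)).
    - exact: measurable_int (L1D measurableT iu (L1Z measurableT (2 * c) iuv)).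
    have h1 := ae_integrable_cylinder2 mZ (f := u) (field_L1 T0 X0 Lu).
    have h2 := ae_integrable_cylinder2 mZ (f := v) (field_L1 T0 X0 Lv).
    have [_ _ _ pZ _] := sol.
    move: xiE; apply: filter_app; move: pZ; apply: filter_app.
    move: h2; apply: filter_app; move: h1; apply: filterS => om k1 k2 k3 k4 _.
    congr EFin; congr (_ + _).
    rewrite (state_drift B k y sigma k1) (state_drift B k y sigma k2).
    rewrite -[X in k * X]/(Rintegral _ _ _) RintegralZl//; last exact: L1B.
    rewrite RintegralB// k3 k4 (state_drift B k y sigma k1); ring.
  apply: le_Rintegral => //.
    by apply: L1D => //; exact: L1Z.
  move=> om _; move: (Y u om) (Y v om) => a a'.
  have -> : c * a' ^+ 2 = c * a ^+ 2 + 2 * c * (a * (a' - a)) + c * (a' - a) ^+ 2 by ring.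
  by rewrite lerDl mulr_ge0 ?sqr_ge0.
rewrite E1 -[X in _ + b * X <= _]/(\int[mu]_(w in D) (f w.1 w.2 ^+ 2)); move: E2.
move: (\int[P]_om (c * Y u om ^+ 2)) (\int[P]_om (c * Y v om ^+ 2)) => A A'.
move: (\int[mu]_(w in D) (p w.1 w.2 * f w.1 w.2)) => e.
move: (\int[mu]_(w in D) (f w.1 w.2 ^+ 2)) (\int[mu]_(w in D) (b * u w.1 w.2 ^+ 2)) => F U.
have -> : U + A + b * F = U + b * F - k * e + (A + k * e) by ring.
by rewrite lerD2l.
Qed.

End verification.

Section adjoint_uniqueness.
Context d (Omega : measurableType d) (R : realType) (P : probability Omega R).
Variable B : R * R -> Omega -> R.
Hypothesis hB : brownian_sheet P B.
Variables (T X : R).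
Hypotheses (T0 : 0 < T) (X0 : 0 < X).
Local Notation Z := (T, X).

Let Z0 : ple (0, 0) Z. Proof. by rewrite /ple/= !ltW. Qed.

(** Both processes are martingales, hence so is their difference, and the
    second moment of a martingale is largest at the terminal point, where
    this difference vanishes. *)
Lemma adjoint_unique xi xi' (p p' q q' : R * R -> Omega -> R)
    (r r' : R * R -> R * R -> Omega -> R) :
  bspde_solution P B Z xi p q r -> bspde_solution P B Z xi' p' q' r' ->
  {ae P, forall om, xi om = xi' om} -> field_eq P Z p p'.
Proof.
move=> sol sol' xiE.
apply: (ae_cylinder (leb2 R) (measurable_rect Z) (adjoint_adapted sol).1
  (adjoint_adapted sol').1) => z rz.
have rZ := rect_refl Z0.
have Lz := adjoint_L2 hB T0 X0 sol rz; have Lz' := adjoint_L2 hB T0 X0 sol' rz.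
have LZ := adjoint_L2 hB T0 X0 sol rZ; have LZ' := adjoint_L2 hB T0 X0 sol' rZ.
have pE : {ae P, forall om, p Z om = p' Z om}.
  have [_ _ _ e _] := sol; have [_ _ _ e' _] := sol'.
  move: xiE; apply: filter_app; move: e'; apply: filter_app; move: e.
  by apply: filterS => om -> -> ->.
pose f om := p z om - p' z om.
have Lf : square_integrable P setT f by exact: L2B.
have af := (adaptedB (adjoint_adapted sol) (adjoint_adapted sol')).2 z rz.
have m1 := adjoint_martingale hB T0 X0 sol rz af Lf.
have m2 := adjoint_martingale hB T0 X0 sol' rz af Lf.
have f0 : \int[P]_om (f om ^+ 2) = 0.
  transitivity (\int[P]_om (f om * p z om) - \int[P]_om (f om * p' z om)).
    rewrite -RintegralB//; [|exact: L2M..].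
    by apply: eq_Rintegral => om _; rewrite /f; ring.
  rewrite -m1 -m2 -RintegralB//; [|exact: L2M..].
  rewrite -[RHS](_ : \int[P]_om (fun=> 0) om = _); last first.
    by rewrite /Rintegral integral0.
  rewrite /Rintegral; congr fine; apply: ae_eq_integral => //.
  - by apply: measurable_int (L1B measurableT (L2M measurableT Lf LZ) (L2M measurableT Lf LZ')).
  - by apply: filterS pE => om -> _; rewrite subrr.
apply: filterS (L2_norm0_ae measurableT Lf f0) => om /(_ I) /eqP.
by rewrite subr_eq0 => /eqP.
Qed.

End adjoint_uniqueness.

(** * An explicit solution *)
Section explicit_integrand.
Variables (R : realType) (T X : R).
Hypotheses (T0 : 0 < T) (X0 : 0 < X).
Local Notation Z := (T, X).
Variables (s K : R).
Hypothesis K0 : 0 <= K.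
Implicit Types z w : R * R.

(** The area of the part of [rect Z] above [z]. *)
Definition upper_area z : R := (T - z.1) * (X - z.2).

(** The integrand that makes the Wiener integral [W] satisfy
    [s B(Z) = W Z + K * \int W]: a unit of noise at [w] enters [W z] for all
    [z] above [w], hence the right-hand side with weight
    [gain w * (1 + K * upper_area w)]. *)
Definition gain z : R := s / (1 + K * upper_area z).

Lemma upper_area_ge0 z : rect Z z -> 0 <= upper_area z.
Proof.
by move=> /andP[_ /andP[/= h1 h2]]; rewrite mulr_ge0// subr_ge0.
Qed.

Let den_ge1 z : rect Z z -> 1 <= 1 + K * upper_area z.
Proof. by move=> rz; rewrite lerDl mulr_ge0// upper_area_ge0. Qed.

Let den_gt0 z : rect Z z -> 0 < 1 + K * upper_area z.
Proof. by move=> rz; apply: lt_le_trans (den_ge1 rz). Qed.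

Lemma gainE z : rect Z z -> gain z * (1 + K * upper_area z) = s.
Proof. by move=> rz; rewrite divfK// gt_eqF// den_gt0. Qed.

Lemma gain_bounded z : rect Z z -> `|gain z| <= `|s|.
Proof.
move=> rz; rewrite normrM normfV [`|1 + _|]gtr0_norm ?den_gt0//.
by rewrite ler_pdivrMr ?den_gt0// ler_peMr// den_ge1.
Qed.

(** The denominators are at least 1, so [gain] varies at most [`|s| * K] times
    as much as [upper_area]. *)
Lemma gain_lipschitz (N : nat) z w : rect Z z -> rect Z w ->
  `|z.1 - w.1| <= T / N%:R -> `|z.2 - w.2| <= X / N%:R ->
  `|gain z - gain w| <= `|s| * K * (2 * (T * X)) / N%:R.
Proof.
move=> rz rw h1 h2.
have -> : gain z - gain w = s * K * (upper_area w - upper_area z) *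
    ((1 + K * upper_area z)^-1 * (1 + K * upper_area w)^-1).
  have := den_gt0 rz; have := den_gt0 rw; rewrite /gain.
  move: (upper_area z) (upper_area w) => a a' /lt0r_neq0 n1 /lt0r_neq0 n2.
  by field; rewrite n1.
have le1 a : rect Z a -> (1 + K * upper_area a)^-1 <= 1.
  by move=> ra; rewrite invf_le1 ?den_gt0// den_ge1.
have ge0 a : rect Z a -> 0 <= (1 + K * upper_area a)^-1.
  by move=> ra; rewrite invr_ge0 ltW// den_gt0.
rewrite normrM [X in _ * X]ger0_norm ?mulr_ge0 ?ge0//.
apply: (@le_trans _ _ `|s * K * (upper_area w - upper_area z)|).
  by rewrite ler_piMr// mulr_ile1 ?ge0 ?le1.
rewrite !normrM (ger0_norm K0) -mulrA -[leRHS]mulrA -[leRHS]mulrA.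
rewrite ler_wpM2l// ler_wpM2l//.
have -> : upper_area w - upper_area z =
    (z.1 - w.1) * (X - w.2) + (T - z.1) * (z.2 - w.2) by rewrite /upper_area; ring.
apply: le_trans (ler_normD _ _) _.
have -> : 2 * (T * X) / N%:R = T / N%:R * X + T * (X / N%:R) by ring.
move: rz rw => /andP[/andP[/= z1 z2] /andP[/= z3 z4]] /andP[/andP[/= w1 w2] /andP[/= w3 w4]].
rewrite !normrM; apply: lerD; apply: ler_pM => //.
  by rewrite ger0_norm ?subr_ge0// gerBl.
by rewrite ger0_norm ?subr_ge0// gerBl.
Qed.

Lemma measurable_upper_area : measurable_fun setT upper_area.
Proof.
by apply: measurable_funM; apply: measurable_funB.
Qed.

(** On [rect Z] the inverse of the denominator is exp (- ln x). *)
Lemma measurable_gain : measurable_fun (rect Z) gain.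
Proof.
apply: (eq_measurable_fun (fun z => s * expR (- ln (1 + K * upper_area z)))).
  by move=> z; rewrite inE => rz; rewrite expRN lnK// posrE den_gt0.
apply: measurable_funTS; apply: measurable_funM => //.
apply: measurableT_comp => //; apply: measurableT_comp => //.
apply: (measurableT_comp (@measurable_ln R)).
apply: measurable_funD => //; apply: measurable_funM => //.
exact: measurable_upper_area.
Qed.

Lemma integral_ple z : rect Z z ->
  (leb2 R).-integrable (rect Z) (EFin \o (fun w => (ple z w)%:R)) /\
  \int[leb2 R]_(w in rect Z) (ple z w)%:R = upper_area z.
Proof.
move=> rz; have /andP[/andP[/= z1 z2] /andP[/= z3 z4]] := rz.
have mr := measurable_rect Z.
pose A : set (R * R) := `[z.1, T]%classic `*` `[z.2, X]%classic.
have mA : measurable A by exact: measurableX.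
have AZ : A `<=` rect Z.
  move=> [a b] [/=]; rewrite !in_itv/= => /andP[a1 a2] /andP[b1 b2].
  by rewrite /rect/= /ple/= a2 b2 (le_trans z1)// (le_trans z2).
have E w : rect Z w -> (ple z w)%:R = \1_A w :> R.
  case: w => a b /andP[/andP[/= w1 w2] /andP[/= w3 w4]]; rewrite indicE /ple /=.
  congr (nat_of_bool _)%:R; apply/idP/idP; first by move=> /andP[h1 h2];
    rewrite inE; split; rewrite /= in_itv/= ?h1 ?h2.
  by rewrite inE => -[/=]; rewrite !in_itv/= => /andP[-> _] /andP[-> _].
have lA : leb2 R A = (upper_area z)%:E.
  transitivity (leb1 `[z.1, T]%classic * leb1 `[z.2, X]%classic)%E.
    exact: product_measure1E.
  have itv (a b : R) : a <= b -> leb1 `[a, b]%classic = (b - a)%:E.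
    rewrite le_eqVlt /leb1 lebesgue_measure_itv/= lte_fin => /orP[/eqP ->|->].
      by rewrite ltxx subrr.
    by rewrite EFinB.
  by rewrite !itv// -EFinM.
have II : (\int[leb2 R]_(w in rect Z) (\1_A w)%:E = (upper_area z)%:E)%E.
  by rewrite integral_indic// setIidl// lA.
split.
  apply: (eq_integrable mr (EFin \o \1_A)); first by move=> w; rewrite inE => rw; rewrite /= E.
  apply/integrableP; split; first by apply/measurable_EFinP; exact: measurable_indic.
  under eq_integral do rewrite /= ger0_norm//.
  by rewrite [X in (X < _)%E]II ltry.
transitivity (\int[leb2 R]_(w in rect Z) (\1_A w)).
  by apply: eq_Rintegral => w; rewrite inE => rw; rewrite E.
by rewrite /Rintegral [X in fine X]II.
Qed.

End explicit_integrand.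

Section explicit_martingale.
Context d (Omega : measurableType d) (R : realType) (P : probability Omega R).
Variable B : R * R -> Omega -> R.
Hypothesis hB : brownian_sheet P B.
Variables (T X : R).
Hypotheses (T0 : 0 < T) (X0 : 0 < X).
Local Notation Z := (T, X).
Variables (s K : R).
Hypothesis K0 : 0 <= K.
Local Notation L2 f := (square_integrable P setT f).
Local Notation D := (rect Z `*` @setT Omega).
Local Notation mu := (sfprod (leb2 R) P).
Local Notation L2F f := (square_integrable mu D (fun w => f w.1 w.2)).
Local Notation h := (gain T X s K).
Local Notation W := (wiener B T X h).
Local Notation V := (wiener_approx B T X h).

Let Z0 : ple (0, 0) Z. Proof. by rewrite /ple/= !ltW. Qed.

Let mZ : measurable (rect Z). Proof. exact: measurable_rect. Qed.

Let mD : measurable D.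
Proof. exact: (measurable_cylinder (T2 := Omega) mZ). Qed.

Let hC := gain_bounded s K0 (T := T) (X := X).
Let hL := gain_lipschitz s K0 (T := T) (X := X).

(** A stochastic Fubini identity that is exact before passing to the limit. The
    increment over a cell with upper corner [w] has the coefficient [gain w] in
    [V n Z], and [gain w * upper_area w] in the integral of [V n]; with the
    factor [K] the coefficients add up to [s] by [gainE]. *)
Lemma gain_approx_identity n om :
  s * sheet_incr B (0, 0) Z om =
  V n Z om + K * \int[leb2 R]_(z in rect Z) V n z om.
Proof.
have N0 : (0 < 4 ^ n)%N by rewrite expn_gt0.
pose cr := corner T X (4 ^ n).
have rcr i j : (i < 4 ^ n)%N -> (j < 4 ^ n)%N -> rect Z (cr i.+1 j.+1).
  by move=> iN jN; apply: corner_rect.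
have E z : V n z om = \sum_(0 <= i < 4 ^ n) \sum_(0 <= j < 4 ^ n)
    h (cr i.+1 j.+1) * sheet_incr B (cr i j) (cr i.+1 j.+1) om * (ple (cr i.+1 j.+1) z)%:R.
  rewrite /wiener_approx /step_int big_grid_step; apply: eq_bigr => i _.
  by apply: eq_bigr => j _ /=; rewrite mulrAC.
have iple i j : (i < 4 ^ n)%N -> (j < 4 ^ n)%N ->
   (leb2 R).-integrable (rect Z) (EFin \o (fun z =>
      h (cr i.+1 j.+1) * sheet_incr B (cr i j) (cr i.+1 j.+1) om * (ple (cr i.+1 j.+1) z)%:R)).
  by move=> iN jN; apply: L1Z => //; have [] := integral_ple (rcr i j iN jN).
under eq_Rintegral do rewrite E.
have -> : sheet_incr B (0, 0) Z om = \sum_(0 <= i < 4 ^ n) \sum_(0 <= j < 4 ^ n)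
    sheet_incr B (cr i j) (cr i.+1 j.+1) om.
  rewrite -(sheet_incr_grid B (cell_pt T (4 ^ n)) (cell_pt X (4 ^ n)))//.
  by rewrite !cell_pt0 !cell_ptN.
rewrite E; under eq_Rintegral do rewrite big_mkord.
rewrite Rintegral_sum//; last first.
  move=> i; under [X in _.-integrable _ (EFin \o X)]eq_fun do rewrite big_mkord.
  by apply: L1_sum => // j; exact: iple.
rewrite !big_mkord !mulr_sumr -big_split /=; apply: eq_bigr => i _.
under eq_Rintegral do rewrite big_mkord.
rewrite Rintegral_sum//; last by move=> j; exact: iple.
rewrite !big_mkord !mulr_sumr -big_split /=; apply: eq_bigr => j _.
have rc := rcr i j (ltn_ord i) (ltn_ord j); have [i1 e1] := integral_ple rc.
rewrite RintegralZl// e1.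
have -> : ple (cr i.+1 j.+1) Z by have /andP[] := rc.
rewrite -{1}(gainE s K0 rc); move: (h _) (upper_area _ _ _) (sheet_incr _ _ _ _) => a a' a''.
by rewrite mulr1n; ring.
Qed.

Let K1 := T * X * ((`|s| * K * (2 * (T * X))) ^+ 2 + 2 * `|s| ^+ 2).

Let W_L2 z : rect Z z -> L2 (W z).
Proof. by move=> rz; have [] := wiener_error hB T0 X0 hC hL 0 rz. Qed.

Let mVW n : measurable_fun D (fun w => V n w.1 w.2 - W w.1 w.2).
Proof.
apply: measurable_funTS; apply: measurable_funB.
  exact: (measurable_wiener_approx hB T0 X0).
exact: (measurable_wiener hB T0 X0).
Qed.

(** A Wiener integral solves the backward equation with a deterministic first
    integrand and a vanishing second one. *)
Lemma explicit_solution (m : R) (xi : Omega -> R) :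
  {ae P, forall om, m + W Z om = xi om} ->
  bspde_solution P B Z xi (fun z om => m + W z om)
    (fun z _ => restrict_rect h Z z) (fun _ _ _ => 0).
Proof.
move=> xiE; have [mW aW] := wiener_adapted hB T0 X0 h.
have mh := measurable_gain s K0 (T := T) (X := X).
split.
- split; first by apply: measurable_funD.
  by move=> z rz; apply: measurable_wrtD; [exact: measurable_wrt_cst|exact: aW].
- have mq : measurable_fun D (fun w : (R * R) * Omega => restrict_rect h Z w.1).
    exact: (measurable_restrict_rect mh).
  split; first by split => // z _; exact: measurable_wrt_cst.
  apply: (L2_le mD mq _ (cylinder_L2_cst T0 X0 (prob_L2_cst P `|s|))) => w [rw _] /=.
  rewrite /restrict_rect normrM normr_id indicE.
  case: (_ \in _); rewrite ?normr1 ?mulr1 ?normr0 ?mulr0//.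
  exact: hC.
- split.
    split; first exact: measurable_cst.
    by rewrite integral0_eq ?ltry// => w _; rewrite expr0n.
  by move=> z z' _; exact: measurable_wrt_cst.
- exact: xiE.
exists W, (fun _ _ => 0); split.
- exact: (wiener_sheet_integral hB T0 X0 hC hL mh).
- exists (fun=> [::]); split.
  + by move=> n [].
  + rewrite /l2_cvg; apply: cvg_near_cst; apply: nearW => n.
    rewrite integral0_eq// => w _.
    by rewrite /wz_simple_eval big_nil subrr expr0n.
  + move=> z rz; split; first exact: measurable_cst.
    rewrite /l2_cvg; apply: cvg_near_cst; apply: nearW => n.
    rewrite integral0_eq// => om _.
    by rewrite /wz_simple_int big_nil subrr expr0n.
- by move=> z rz; apply: aeW => om; ring.
Qed.

(** Adjoint processes are square integrable, and [W] is one of them. *)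
Lemma wiener_field_L2 : L2F W.
Proof.
have /(adjoint_field_L2 hB T0 X0) := explicit_solution (m := 0)
  (xi := fun om => 0 + W Z om) (aeW _ (fun=> erefl)).
by congr square_integrable; apply/funext => w; rewrite add0r.
Qed.

(** The exact discrete identities bound the defect in L2 by [4 ^- n] times a
    constant, for every [n]. *)
Lemma gain_identity : {ae P, forall om,
  s * sheet_incr B (0, 0) Z om = W Z om + K * \int[leb2 R]_(z in rect Z) W z om}.
Proof.
have rZ := rect_refl Z0.
have LW := wiener_field_L2.
have LVW n : L2F (fun z om => V n z om - W z om) /\
    \int[mu]_(w in D) ((V n w.1 w.2 - W w.1 w.2) ^+ 2) <= T * X * (4 * K1 / 4 ^+ n).
  apply: (field_L2_bound T0 X0 (f := fun z om => V n z om - W z om)) => // z rz.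
    apply: L2B => //; [exact: (wiener_approx_L2 hB T0 X0)|exact: W_L2].
  by have [_] := wiener_error hB T0 X0 hC hL n rz.
pose E n om := (V n Z om - W Z om) + K * \int[leb2 R]_(z in rect Z) (V n z om - W z om).
pose F om := s * sheet_incr B (0, 0) Z om - (W Z om + K * \int[leb2 R]_(z in rect Z) W z om).
have iW : {ae P, forall om, (leb2 R).-integrable (rect Z) (EFin \o (W^~ om))}.
  by apply: ae_integrable_cylinder2 => //; exact: field_L1.
have iE n : {ae P, forall om, (leb2 R).-integrable (rect Z)
    (EFin \o (fun z => V n z om - W z om))}.
  have [Ln _] := LVW n; exact: (ae_integrable_cylinder2 mZ (f := fun z om => V n z om - W z om)
    (field_L1 T0 X0 (v := fun z om => V n z om - W z om) Ln)).
have EF n : {ae P, forall om, F om = E n om}.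
  move: (iE n); apply: filter_app; move: iW; apply: filterS => om i1 i2.
  rewrite /F /E (gain_approx_identity n om).
  have -> : \int[leb2 R]_(z in rect Z) V n z om =
     \int[leb2 R]_(z in rect Z) (V n z om - W z om) + \int[leb2 R]_(z in rect Z) W z om.
    by rewrite -RintegralD//; apply: eq_Rintegral => z _; rewrite subrK.
  by ring.
have LVZ n : L2 (fun om => V n Z om - W Z om).
  by apply: L2B => //; [exact: (wiener_approx_L2 hB T0 X0)|exact: W_L2].
have LI n : L2 (fun om => \int[leb2 R]_(z in rect Z) (V n z om - W z om)).
  by apply: (drift_L2 T0 X0 (v := fun z om => V n z om - W z om)); have [] := LVW n.
have LE n : L2 (E n) by apply: L2D => //; exact: L2Z.
have bE n : \int[P]_om (E n om ^+ 2) <=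
    (2 * (4 * K1) + 2 * K ^+ 2 * ((T * X) ^+ 2 * (4 * K1))) / 4 ^+ n.
  have i1 := L2_sqr (LVZ n); have i2 := L2_sqr (LI n).
  have [_ e1] := wiener_error hB T0 X0 hC hL n rZ.
  have [Ln e2] := LVW n.
  have := drift_sqr_le T0 X0 (v := fun z om => V n z om - W z om) Ln; rewrite Rintegral_EFin// lee_fin => e3.
  apply: (@le_trans _ _ (2 * \int[P]_om ((V n Z om - W Z om) ^+ 2) + 2 * K ^+ 2 *
     \int[P]_om ((\int[leb2 R]_(z in rect Z) (V n z om - W z om)) ^+ 2))).
    rewrite -!RintegralZl// -RintegralD//; [|exact: L1Z..].
    apply: le_Rintegral => //; first exact: L2_sqr.
      by apply: L1D => //; exact: L1Z.
    move=> om _; rewrite /E; move: (V n Z om - _) (\int[_]_(z in _) _) => a a'.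
    have := sqr_ge0 (a - K * a') => h0.
    rewrite -subr_ge0; apply: le_trans h0 _.
    by rewrite le_eqVlt; apply/orP; left; apply/eqP; ring.
  have -> : (2 * (4 * K1) + 2 * K ^+ 2 * ((T * X) ^+ 2 * (4 * K1))) / 4 ^+ n =
     2 * (4 * K1 / 4 ^+ n) + 2 * K ^+ 2 * (T * X * (T * X * (4 * K1 / 4 ^+ n))) by ring.
  apply: lerD; first by rewrite ler_pM2l.
  apply: ler_wpM2l; first by rewrite mulr_ge0 ?sqr_ge0.
  apply: (le_trans e3); apply: ler_wpM2l => //.
  by rewrite mulr_ge0// ltW.
have LF : L2 F.
  apply: L2_ae (LE 0%N) => //; last by apply: filterS (EF 0%N) => om ->.
  apply: measurable_funB.
    apply: measurable_funM => //; apply: (measurable_sheet_incr hB).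
    by rewrite /good_box Z0 /ple/= lexx.
  apply: measurable_funD; first exact: L2_measurable (W_L2 rZ).
  by apply: measurable_funM => //; apply: L2_measurable; exact: (drift_L2 T0 X0 LW).
have iF := L2_sqr LF.
have F0 : \int[P]_om (F om ^+ 2) = 0.
  apply/le_anti/andP; split; last by apply: Rintegral_ge0 => om _; exact: sqr_ge0.
  rewrite -lee_fin.
  pose c := 2 * (4 * K1) + 2 * K ^+ 2 * ((T * X) ^+ 2 * (4 * K1)).
  suff cv : (fun _ : nat => (\int[P]_om (F om ^+ 2))%:E) @ \oo --> 0%E.
    by have := cvg_lim (@ereal_hausdorff R) cv; rewrite lim_cst => // ->.
  apply: (@cvg_geometric_bound _ c) => n.
    by rewrite lee_fin; apply: Rintegral_ge0 => om _; exact: sqr_ge0.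
  rewrite lee_fin; apply: le_trans (bE n).
  rewrite le_eqVlt; apply/orP; left; apply/eqP.
  rewrite /Rintegral; congr fine; apply: ae_eq_integral => //.
  - exact: measurable_int iF.
  - exact: measurable_int (L2_sqr (LE n)).
  - by apply: filterS (EF n) => om ->.
apply: filterS (L2_norm0_ae measurableT LF F0) => om /(_ I) /eqP.
by rewrite subr_eq0 => /eqP.
Qed.

End explicit_martingale.

(** * The optimal control *)
Section explicit_optimum.
Context d (Omega : measurableType d) (R : realType) (P : probability Omega R).
Variable B : R * R -> Omega -> R.
Hypothesis hB : brownian_sheet P B.
Variables (T X : R).
Hypotheses (T0 : 0 < T) (X0 : 0 < X).
Local Notation Z := (T, X).
Variables (b k c y sigma : R).
Hypotheses (b0 : 0 < b) (c0 : 0 <= c).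
Local Notation L2F f :=
  (square_integrable (sfprod (leb2 R) P) (rect Z `*` setT) (fun w => f w.1 w.2)).
Local Notation cost v :=
  (quadratic_cost P Z b c v (state B y sigma (fun z om => k * v z om))).

(** Closing the loop: the control [- k / (2 b) * p] moves [2 c Y] by
    [- feedback] times the integral of [p]. *)
Definition feedback := k ^+ 2 * c / b.

(** The solution of [m = 2 c y - feedback * (T X) * m], the deterministic part
    of the terminal condition. *)
Definition explicit_mean := 2 * c * y / (1 + feedback * (T * X)).

Definition explicit_adjoint z om :=
  explicit_mean + wiener B T X (gain T X (2 * c * sigma) feedback) z om.

Definition explicit_control z om : R := - (k / (2 * b)) * explicit_adjoint z om.

Local Notation W := (wiener B T X (gain T X (2 * c * sigma) feedback)).

Let K0 : 0 <= feedback.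
Proof. by apply: divr_ge0; [rewrite mulr_ge0 ?sqr_ge0|exact: ltW]. Qed.

Lemma explicit_adjoint_solution (xi : Omega -> R) :
  {ae P, forall om, explicit_adjoint Z om = xi om} ->
  exists q r, bspde_solution P B Z xi explicit_adjoint q r.
Proof.
move=> /(explicit_solution hB T0 X0 K0) sol.
by exists (fun z _ => restrict_rect (gain T X (2 * c * sigma) feedback) Z z),
  (fun _ _ _ => 0).
Qed.

Lemma explicit_control_adapted : adapted B Z explicit_control.
Proof.
have [q [r sol]] := explicit_adjoint_solution (aeW P (fun=> erefl)).
have [mp ap] := adjoint_adapted sol; split; first exact: measurable_funM.
by move=> z rz; apply: measurable_wrtM; [exact: measurable_wrt_cst|exact: ap].
Qed.

(** Its deterministic part holds by the choice of [explicit_mean], its random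
    part by [gain_identity]. *)
Lemma explicit_terminal : {ae P, forall om, explicit_adjoint Z om =
  2 * c * state B y sigma (fun z om => k * explicit_control z om) Z om}.
Proof.
have LW := wiener_field_L2 hB T0 X0 (2 * c * sigma) K0.
have iW := ae_integrable_cylinder2 (measurable_rect Z) (field_L1 T0 X0 LW).
move: (gain_identity hB T0 X0 (2 * c * sigma) K0); apply: filter_app; move: iW.
apply: filterS => om iW gI; rewrite /state.
have -> : \int[leb2 R]_(z in rect Z) (k * explicit_control z om) =
    - (k ^+ 2 / (2 * b)) * (T * X * explicit_mean + \int[leb2 R]_(z in rect Z) W z om).
  have mZ := measurable_rect Z.
  have ic : (leb2 R).-integrable (rect Z) (EFin \o (fun=> explicit_mean)).
    apply/integrableP; split; first exact/measurable_EFinP.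
    by rewrite integral_cst// [X in (_ * X)%E](leb2_rect T0 X0) -EFinM ltry.
  have -> : T * X * explicit_mean = \int[leb2 R]_(z in rect Z) (fun=> explicit_mean) z.
    by rewrite /Rintegral integral_cst// [X in (_ * X)%E](leb2_rect T0 X0)/= mulrC.
  rewrite -RintegralD// -RintegralZl//; last exact: L1D.
  apply: eq_Rintegral => z _; rewrite /explicit_control /explicit_adjoint.
  by move: (W z om) => e; field; rewrite gt_eqF.
have n0 : 1 + feedback * (T * X) != 0.
  by rewrite gt_eqF// ltr_pwDl// mulr_ge0// mulr_ge0// ltW.
have mE : 2 * c * y = explicit_mean * (1 + feedback * (T * X)) by rewrite divfK.
rewrite /explicit_adjoint mulrDr mulrDr mE [_ * (sigma * _)]mulrA gI.
have -> : 2 * c * (- (k ^+ 2 / (2 * b)) *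
   (T * X * explicit_mean + \int[leb2 R]_(z in rect Z) W z om)) =
   - feedback * (T * X * explicit_mean + \int[leb2 R]_(z in rect Z) W z om).
  by rewrite /feedback; field; rewrite gt_eqF.
move: explicit_mean feedback (W Z om) (\int[leb2 R]_(z in rect Z) W z om) => a f e e'.
ring.
Qed.

Lemma explicit_control_L2 : L2F explicit_control.
Proof.
have [q [r sol]] := explicit_adjoint_solution explicit_terminal.
exact: (control_L2 hB T0 X0 sol explicit_control_adapted (aeW _ (fun _ _ => erefl))).
Qed.

Lemma explicit_verification v : adapted B Z v ->
  (cost explicit_control + (b * \int[sfprod (leb2 R) P]_(w in rect Z `*` setT)
     ((v w.1 w.2 - explicit_control w.1 w.2) ^+ 2))%:E <= cost v)%E.
Proof.
have [q [r sol]] := explicit_adjoint_solution explicit_terminal.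
exact: (verification hB T0 X0 b0 c0 sol explicit_control_adapted
  (aeW _ (fun=> erefl)) (aeW _ (fun _ _ => erefl))).
Qed.

Lemma explicit_optimal v : adapted B Z v -> (cost explicit_control <= cost v)%E.
Proof.
move=> av; apply: le_trans (explicit_verification av).
rewrite leeDl// lee_fin mulr_ge0// ?(ltW b0)//.
by apply: Rintegral_ge0 => w _; exact: sqr_ge0.
Qed.

(** The excess [b * |v - u|^2] in the verification inequality makes the
    minimizer unique up to null sets. *)
Lemma explicit_optimal_unique u : adapted B Z u ->
  (cost u <= cost explicit_control)%E -> field_eq P Z u explicit_control.
Proof.
move=> au uo; have Le := explicit_control_L2.
have mZ := measurable_rect Z; have mD := measurable_cylinder (T2 := Omega) mZ.
have Lu : L2F u.
  have [//|nL] := pselect (L2F u); move: uo.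
  by rewrite (cost_infty hB T0 X0 k y sigma b0 c0 au.1 nL) (cost_fin hB T0 X0 k y sigma b0 c0 Le).
have Lf := L2B mD Lu Le.
have /le_trans/(_ uo) := explicit_verification au.
rewrite (cost_fin hB T0 X0 k y sigma b0 c0 Le) -EFinD lee_fin gerDl pmulr_rle0// => h.
have f0 : \int[sfprod (leb2 R) P]_(w in rect Z `*` setT)
    ((u w.1 w.2 - explicit_control w.1 w.2) ^+ 2) = 0.
  by apply/le_anti; rewrite h/=; apply: Rintegral_ge0 => w _; exact: sqr_ge0.
apply/field_eqP; apply: filterS (L2_norm0_ae mD Lf f0) => w /[apply] /eqP.
by rewrite subr_eq0 => /eqP.
Qed.

End explicit_optimum.

(** * Optimal emission reductions *)
Theorem theorem4p1 (d : measure_display) (Omega : measurableType d)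
    (R : realType) (P : probability Omega R) (B : R * R -> Omega -> R)
    (hB : brownian_sheet P B)
    (T X a1 a2 c1 c2 sigma y : R)
    (hT : 0 < T) (hX : 0 < X)
    (ha1 : 0 < a1) (ha2 : 0 < a2) (hc1 : 0 < c1) (hc2 : 0 < c2) :
  let Z := (T, X) in
  let optimal := optimal_reductions P B Z y sigma a1 a2 c1 c2 in
  let adjoint (u1 u2 : R * R -> Omega -> R) := bspde_solution P B Z (fun om => 2 * (c1 + c2) *
        state B y sigma (fun z om' => u1 z om' + u2 z om') Z om) in
  let given_by (u1 u2 p : R * R -> Omega -> R) :=
    field_eq P Z u2 (fun z om => (c2 * a1) / (c1 * a2) * u1 z om) /\
    field_eq P Z u1 (fun z om =>
      - (alpha a1 a2 c1 c2 / (2 * beta a1 a2 c1 c2)) * p z om) in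
  [/\ exists u1 u2, optimal u1 u2,
      forall u1 u2, optimal u1 u2 ->
        (exists p q r, adjoint u1 u2 p q r) /\
        (forall p q r, adjoint u1 u2 p q r -> given_by u1 u2 p)
    & forall u1 u2 p q r, adapted B Z u1 -> adapted B Z u2 ->
        adjoint u1 u2 p q r -> given_by u1 u2 p -> optimal u1 u2].
Proof.
move=> Z optimal adjoint given_by.
set al := alpha a1 a2 c1 c2; set be := beta a1 a2 c1 c2; set rho := (c2 * a1) / (c1 * a2).
have be0 : 0 < be.
  by rewrite addr_gt0// divr_gt0// mulr_gt0// exprn_gt0.
have c0 : 0 <= c1 + c2 by rewrite ltW// addr_gt0.
pose uh := explicit_control B T X be al (c1 + c2) y sigma.
have auh : adapted B Z uh by exact: (explicit_control_adapted hB hT hX al y sigma be0 c0).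
have coordinated u1 u2 u : adapted B Z u1 -> adapted B Z u2 -> adapted B Z u ->
    field_eq P Z u2 (fun z om => rho * u1 z om) -> field_eq P Z u1 u ->
    {ae P, forall om, 2 * (c1 + c2) * state B y sigma (fun z om => u1 z om + u2 z om) Z om =
       2 * (c1 + c2) * state B y sigma (fun z om => al * u z om) Z om}.
  move=> [mu1 _] [mu2 _] [mu _] e2 e1.
  have : field_eq P Z (fun z om => u1 z om + u2 z om) (fun z om => al * u z om).
    move: e2; apply: filter_app; move: e1; apply: filterS => w h1 h2 rw.
    by rewrite h2// h1// /al /alpha /rho mulrDl mul1r.
  move=> /(field_eq_state B y sigma (f := fun z om => u1 z om + u2 z om)
    (g := fun z om => al * u z om) (measurable_funD mu1 mu2)
    (measurable_funM (measurable_cst al) mu)).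
  by apply: filterS => om ->.
split.
- exists uh, (fun z om => rho * uh z om); split.
  + exact: auh.
  + case: auh => muh fuh; split; first exact: measurable_funM.
    by move=> z rz; apply: measurable_wrtM; [exact: measurable_wrt_cst|exact: fuh].
  + exact: (aeW _ (fun _ _ => erefl)).
  + by move=> v av; exact: (explicit_optimal hB hT hX al y sigma be0 c0 av).
- move=> u1 u2 [au1 au2 e2 opt].
  have e1 : field_eq P Z u1 uh.
    exact: (explicit_optimal_unique hB hT hX be0 c0 au1 (opt uh auh)).
  have term := explicit_terminal hB hT hX al y sigma be0 c0.
  have xiE := coordinated u1 u2 uh au1 au2 auh e2 e1.
  have [|q [r sol]] := @explicit_adjoint_solution _ _ _ P B hB T X hT hX be al (c1 + c2)
    y sigma be0 c0 (fun om => 2 * (c1 + c2) * state B y sigma (fun z om => u1 z om + u2 z om) Z om).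
    by move: xiE; apply: filter_app; move: term; apply: filterS => om -> ->.
  split; first by exists (explicit_adjoint B T X be al (c1 + c2) y sigma), q, r.
  move=> p q' r' sol'; split => //.
  have := adjoint_unique hB hT hX sol sol' (aeW _ (fun=> erefl)).
  apply: filter_app; move: e1; apply: filterS => w h1 h2 rw.
  by rewrite h1// /uh /explicit_control h2.
- move=> u1 u2 p q r au1 au2 sol [e2 e1].
  split; [exact: au1|exact: au2|exact: e2|move=> v av].
  have xiE := coordinated u1 u2 u1 au1 au2 au1 e2 (aeW _ (fun _ _ => erefl)).
  apply: le_trans (verification hB hT hX be0 c0 sol au1 xiE e1 av).
  rewrite leeDl// lee_fin mulr_ge0// ?(ltW be0)//.
  by apply: Rintegral_ge0 => w _; exact: sqr_ge0.
Qed.
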